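(* Let $V=\mathbb{F}^d$, $q$, the type $\mathbf{X}$ and the group $G$ be as in the context, let $e$ be a positive integer with $2e\le d$, with $e$ even if $\mathbf{X}=\mathbf{Sp}$ or $\mathbf{X}=\mathbf{O}^\varepsilon$, and let $\mathcal{U}$ be a $G$-orbit of non-degenerate $e$-dimensional subspaces of $V$. Let $U\in\mathcal{U}$, and for $h\in G$ let $E(h)=U^\perp\cap (Uh)^\perp$. Let $$T=\{h\in G \mid V = E(h)\oplus (U\oplus Uh)\},$$ where the condition means that $U\cap Uh=0$ and that $V$ is the perpendicular direct sum of $E(h)$ and $U\oplus Uh$. Then $|T|/|G|=\rho(\mathbf{X},V,\mathcal{U},\mathcal{U})$. In particular, for all $\mathbf{X}$ and $\mathcal{U}$, $|T|/|G|>0.05$.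
   Context: Let $q$ be a prime power and $V=\mathbb{F}^d$ a vector space over a finite field $\mathbb{F}$ with a non-degenerate form of type $\mathbf{X}$, where: $\mathbf{X}=\mathbf{U}$ means $|\mathbb{F}|=q^2$ and $V$ carries a non-degenerate hermitian form; $\mathbf{X}=\mathbf{Sp}$ means $|\mathbb{F}|=q$ and $V$ carries a non-degenerate alternating form; $\mathbf{X}=\mathbf{O}^\varepsilon$ means $|\mathbb{F}|=q\ge3$ and $V$ carries a quadratic form of type $\varepsilon$ whose polar form is non-degenerate, where either $d$ is even and $\varepsilon\in\{-,+\}$, or $d$ and $q$ are odd and $\varepsilon=\circ$. Orthogonality $\perp$ and non-degeneracy of subspaces are with respect to the hermitian, alternating or polar form. $G$ is a group of isometries of $V$ with $\mathrm{SU}_d(q)\trianglelefteq G\le\mathrm{GU}_d(q)$, or $G=\mathrm{Sp}_d(q)$, or $\Omega_d^\varepsilon(q)\trianglelefteq G\le \mathrm{GO}_d^\varepsilon(q)$ (full isometry group), respectively; $G$ acts on $V$ on the right and $Uh$ is the image of $U$ under $h$. For $G$-orbits $\mathcal{U},\mathcal{U}'$ of non-degenerate subspaces of dimensions $e,e'$, a pair $(U,U')\in\mathcal{U}\times\mathcal{U}'$ is an $\mathbf{X}$-duo if $U\cap U'=0$ and $U\oplus U'$ is non-degenerate, and $$\rho(\mathbf{X},V,\mathcal{U},\mathcal{U}')=\frac{|\{\mathbf{X}\text{-duos in }\mathcal{U}\times\mathcal{U}'\}|}{|\mathcal{U}|\cdot|\mathcal{U}'|}.$$ *)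

(* Defs.v *)
From HB Require Import structures.
From mathcomp Require Import all_boot all_order all_algebra all_fingroup.
From mathcomp Require Import sesquilinear.

Set Implicit Arguments.
Unset Strict Implicit.
Unset Printing Implicit Defensive.

Import GRing.Theory.
Local Open Scope group_scope.
Local Open Scope ring_scope.

Definition prime_power (q : nat) : Prop :=
  exists p k, [/\ prime p, (0 < k)%N & q = (p ^ k)%N].

(* A subspace of a finite space is stored as a canonical matrix, so that       *)
(* {vspace 'rV[F]_n} inherits finiteness from the matrices.                    *)
Section FiniteSubspaces.

Import VectorInternalTheory.
Variables (F : finFieldType) (n : nat).

HB.instance Definition _ := [Countable of {vspace 'rV[F]_n} by <:].
HB.instance Definition _ := [Finite of {vspace 'rV[F]_n} by <:].

End FiniteSubspaces.

Section SubspaceAction.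

Variables (F : finFieldType) (n : nat).
Local Notation V := 'rV[F]_n.+1.
Local Notation GL := {'GL_n.+1[F]}.

(* Matrices act on row vectors from the right. *)
Definition imagev (W : {vspace V}) (h : GL) : {vspace V} :=
  (linfun (mulmxr (GLval h) : V -> V) @: W)%VS.

Lemma imagev_is_action : is_action [set: GL] imagev.
Proof.
apply: is_total_action => [W|W g h]; rewrite /imagev.
  rewrite -[RHS]lim1g; congr (_ @: _)%VS; apply/lfunP => v.
  by rewrite lfunE id_lfunE /= mulmx1.
rewrite -limg_comp; congr (_ @: _)%VS; apply/lfunP => v.
by rewrite comp_lfunE !lfunE /= mulmxA.
Qed.

Canonical imagev_action := Action imagev_is_action.

End SubspaceAction.

(* The types O^-, O^+ and O^o of quadratic forms. *)
Inductive orthogonal_sign := Minus | Plus | Circ.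

Inductive classical_type :=
  Unitary | Symplectic | Orthogonal of orthogonal_sign.

Section ClassicalSpace.

Variables (F : finFieldType) (n : nat).
Local Notation V := 'rV[F]_n.+1.
Local Notation GL := {'GL_n.+1[F]}.

Definition totally_singular (Q : V -> F) (W : {vspace V}) : Prop :=
  {in W, forall v, Q v = 0}.

Definition has_witt_index (Q : V -> F) (m : nat) : Prop :=
  (exists2 W : {vspace V}, totally_singular Q W & \dim W = m) /\
  (forall W : {vspace V}, totally_singular Q W -> (\dim W <= m)%N).

Definition quadratic_form_of_type (q : nat) (Q : V -> F)
    (s : orthogonal_sign) : Prop :=
  match s with
  | Minus => ~~ odd n.+1 /\ has_witt_index Q (n.+1)./2.-1
  | Plus => ~~ odd n.+1 /\ has_witt_index Q (n.+1)./2
  | Circ => odd n.+1 /\ odd q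
  end.

Variables (eps : bool) (theta : {rmorphism F -> F}).

Definition quadratic_with_polar (Q : V -> F)
    (B : {hermitian V for eps & theta}) : Prop :=
  (forall (a : F) (v : V), Q (a *: v) = a ^+ 2 * Q v) /\
  (forall u v : V, Q (u + v) - Q u - Q v = B u v).

(* B is the hermitian, alternating or polar form; Q is the quadratic form in   *)
(* the orthogonal case and is ignored, here and below, in the other two.       *)
Definition classical_form (X : classical_type) (q : nat)
    (B : {hermitian V for eps & theta}) (Q : V -> F) : Prop :=
  match X with
  | Unitary =>
      [/\ #|F| = (q ^ 2)%N, forall x, theta x = x ^+ q & is_unitary B]
  | Symplectic =>
      #|F| = q /\ is_psymplectic B
  | Orthogonal s =>
      [/\ #|F| = q /\ (3 <= q)%N, is_sym B /\ quadratic_with_polar Q B,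
          nondegenerate B & quadratic_form_of_type q Q s]
  end.

Definition form_isometries (B : {hermitian V for eps & theta}) : {set GL} :=
  [set h : GL | [forall u : V, [forall v : V,
     B (u *m GLval h) (v *m GLval h) == B u v]]].

Definition special_isometries (B : {hermitian V for eps & theta}) : {set GL} :=
  [set h in form_isometries B | \det (GLval h) == 1].

Definition quadratic_isometries (Q : V -> F) : {set GL} :=
  [set h : GL | [forall v : V, Q (v *m GLval h) == Q v]].

(* For q >= 3, Omega is the derived subgroup of the full isometry group GO.    *)
Definition Omega (Q : V -> F) : {set GL} :=
  [~: quadratic_isometries Q, quadratic_isometries Q].

Definition classical_group (X : classical_type)
    (B : {hermitian V for eps & theta}) (Q : V -> F) (G : {group GL}) : Prop :=
  match X with
  | Unitary => special_isometries B <| G /\ G \subset form_isometries B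
  | Symplectic => G :=: form_isometries B
  | Orthogonal _ => Omega Q <| G /\ G \subset quadratic_isometries Q
  end.

Variable B : {hermitian V for eps & theta}.

Definition nondegenerate_subspace (W : {vspace V}) : bool :=
  (W :&: orthov B W == 0)%VS.

Definition nondegenerate_orbits (G : {group GL}) (e : nat) :
    {set {set {vspace V}}} :=
  orbit (imagev_action F n) G @:
    [set W | (\dim W == e) && nondegenerate_subspace W].

Definition is_duo (p : {vspace V} * {vspace V}) : bool :=
  (p.1 :&: p.2 == 0)%VS && nondegenerate_subspace (p.1 + p.2).

Definition duo_proportion (calU calU' : {set {vspace V}}) : rat :=
  #|[set p in setX calU calU' | is_duo p]|%:R / (#|calU|%:R * #|calU'|%:R).

Definition Eperp (U : {vspace V}) (h : GL) : {vspace V} :=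
  (orthov B U :&: orthov B (imagev U h))%VS.

Definition spanning_isometries (G : {group GL}) (U : {vspace V}) : {set GL} :=
  [set h in G |
     [&& (U :&: imagev U h == 0)%VS,
         (Eperp U h :&: (U + imagev U h) == 0)%VS,
         (Eperp U h + (U + imagev U h) == fullv)%VS
       & (Eperp U h <= orthov B (U + imagev U h))%VS]].

End ClassicalSpace.

(* Main.v *)
Require Import Defs.
From HB Require Import structures.
From mathcomp Require Import all_boot all_order all_algebra all_fingroup.
From mathcomp Require Import finfield sesquilinear.
From mathcomp Require Import zify ring lra.

(* An isometry h lies in T exactly when (U, Uh) is a duo, and counting the     *)
(* elements of G that map U to a given member of its orbit gives the equality. *)
(*   For the bound, let A and C be bases of U and of its perpendicular space.  *)
(* In the unitary and symplectic cases every non-degenerate e-space lies in    *)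
(* the orbit, and the e-space spanned by the rows of a A + b C forms a duo     *)
(* with U when it is non-degenerate and so is the space spanned by b C. Both   *)
(* conditions ask that a Gram matrix be invertible. Singular ones are counted  *)
(* through the nonzero vectors of their kernels, which leads to counting       *)
(* vectors of given norm; second moments control these counts.                 *)
(*   In the orthogonal case the non-degenerate e-spaces may split into several *)
(* orbits. Let W be a non-degenerate 2e-space. Siegel transformations, which   *)
(* lie in Omega, move any nonzero vector of W to any other one with the same   *)
(* value of Q while fixing W. The number of members of the orbit that contain  *)
(* a given z in W thus depends only on Q z, so that few pairs of members in W  *)
(* meet nontrivially. Averaging over all W with Cauchy-Schwarz loses a factor  *)
(* that is the proportion of b for which b C spans a non-degenerate space.     *)

Set Implicit Arguments.
Unset Strict Implicit.
Unset Printing Implicit Defensive.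

Import Order.TTheory GRing.Theory Num.Theory.
Local Open Scope ring_scope.

(** * Fibres and second moments *)

(** The space E(h) is the perpendicular space of U + Uh, so h lies in T exactly when (U, Uh) is a
    duo ([spanning_isometriesE]). As h runs over G, the image Uh is each member of the orbit equally
    often ([card_transporters]), and all members have equally many duo partners ([card_duos]); the
    equality follows. It remains to bound the proportion of partners: it is at least 1/19 in the
    unitary case, at least 1/18 in the symplectic case, and more than 1/20 in the orthogonal case.

    Two counts drive the estimates. A singular matrix [a J1 a^! + J] or [b J b^!] has a nonzero left
    kernel vector v. Once v and x = v a (or v b) are fixed, x obeys a norm equation and few matrices
    are left ([card_singular_sum_le], [card_singular_gram_le]). The solutions of norm equations are
    controlled by the number of pairs of vectors of equal norm, which polarisation makes computable,
    and [fiber_deviation] turns this second moment into a bound for a single norm.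

    In the unitary and symplectic cases [hermitian_transport] and [alternating_transport], instances
    of Witt's theorem, identify the orbit with the set of all non-degenerate e-spaces. A random
    member is then modelled by a random matrix a A + b C ([duo_proportion_graph]), and only
    invertibility of Gram matrices matters.

    In the orthogonal case the orbit is known only through the action of Omega. Inside a
    non-degenerate W of dimension 2e, [sphere_transitive] shows that the number of members through z
    depends only on Q z. The sum of its squares is therefore determined by the shells of W and of
    the members, and since two members that meet share at least q - 1 nonzero vectors, a definite
    proportion of the pairs in W is disjoint ([disjoint_members]). Such a pair is a duo with sum W,
    so different W contribute different duos; Cauchy-Schwarz over all W then gives [duos_ge]. The
    field of order 3 is tight and has constants of its own. *)

Section Fibers.

Variables (T : finType) (A : eqType).
Implicit Types f g : T -> A.

Definition fiber f (c : A) : nat := #|[set x | f x == c]|.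

Definition coincidences (T' : finType) f (g : T' -> A) : nat :=
  #|[set p : T * T' | f p.1 == g p.2]|.

End Fibers.

Lemma card_rel_sum (T T' : finType) (R : T -> T' -> bool) :
  #|[set p : T * T' | R p.1 p.2]| = (\sum_x #|[set y | R x y]|)%N.
Proof.
rewrite -sum1_card (eq_bigl (fun p : T * T' => R p.1 p.2)); last first.
  by move=> p; rewrite inE.
rewrite -(pair_big_dep xpredT (fun x y => R x y) (fun _ _ => 1%N)) /=.
by apply: eq_bigr => x _; rewrite -sum1_card; apply: eq_bigl => y; rewrite inE.
Qed.

Lemma card_rel_sum_sym (T T' : finType) (R : T -> T' -> bool) :
  (\sum_x #|[set y | R x y]| = \sum_y #|[set x | R x y]|)%N.
Proof.
under eq_bigr do rewrite -sum1dep_card.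
under [RHS]eq_bigr do rewrite -sum1dep_card.
by rewrite (exchange_big_dep xpredT).
Qed.

Lemma coincidences_sum (T T' A : finType) (f : T -> A) (g : T' -> A) :
  coincidences f g = (\sum_c fiber f c * fiber g c)%N.
Proof.
rewrite /coincidences (card_rel_sum (fun x y => f x == g y)).
rewrite (partition_big f xpredT) //=.
apply: eq_bigr => c _.
rewrite (eq_bigr (fun=> fiber g c)) => [|x /eqP <-]; last first.
  by rewrite /fiber; apply: eq_card => y; rewrite !inE eq_sym.
by rewrite sum_nat_const; congr (_ * _)%N; apply: eq_card => x; rewrite !inE.
Qed.

(** Value by value this is 2ab <= a^2 + b^2. Thus two different forms can be compared when only the
    second moment of each is known. *)
Lemma coincidences_le (T T' A : finType) (f : T -> A) (g : T' -> A) :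
  (2 * coincidences f g <= coincidences f f + coincidences g g)%N.
Proof.
rewrite !coincidences_sum big_distrr -big_split /=.
by apply: leq_sum => c _; by rewrite !mulnn; exact: nat_Cauchy.
Qed.

Lemma sum_fiber (T A : finType) (f : T -> A) : (\sum_c fiber f c = #|T|)%N.
Proof.
rewrite -[RHS]sum1_card [RHS](partition_big f xpredT) //=.
by apply: eq_bigr => c _; rewrite /fiber -sum1dep_card.
Qed.

Lemma sum_sqr_ge (I : finType) (P : pred I) (a : I -> nat) :
  ((\sum_(i | P i) a i) ^ 2 <= #|P| * \sum_(i | P i) a i ^ 2)%N.
Proof.
have -> : ((\sum_(i | P i) a i) ^ 2 =
    \sum_(i | P i) \sum_(j | P j) a i * a j)%N.
  rewrite expnS expn1 big_distrl /=; apply: eq_bigr => i _.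
  by rewrite big_distrr.
rewrite -(leq_pmul2l (isT : 0 < 2)%N).
have -> : (2 * (#|P| * \sum_(i | P i) a i ^ 2) =
    \sum_(i | P i) \sum_(j | P j) (a i ^ 2 + a j ^ 2))%N.
  under [RHS]eq_bigr => i _ do rewrite big_split /= sum_nat_const.
  by rewrite big_split /= -big_distrr /= sum_nat_const addnn mul2n.
rewrite big_distrr /=; apply: leq_sum => i _; rewrite big_distrr /=.
by apply: leq_sum => j _; rewrite (nat_Cauchy (a i) (a j)).
Qed.

(* Cauchy-Schwarz over the fibres other than that of [c]. *)
Lemma fiber_deviation (T A : finType) (f : T -> A) (S : {set A}) (q0 : nat) c :
  (forall x, f x \in S) -> (#|S| <= q0)%N -> c \in S ->
  (coincidences f f * q0 <= #|T| * (q0 + #|T| - 1))%N ->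
  (((q0 * fiber f c)%:Z - #|T|%:Z) ^+ 2 <= (q0%:Z - 1) ^+ 2 * #|T|%:Z).
Proof.
move=> fS Sq cS hP.
have f0 d : d \notin S -> fiber f d = 0%N.
  move=> dS; apply/eqP; rewrite cards_eq0; apply/eqP/setP => x.
  by rewrite !inE; apply: contraNF dS => /eqP <-.
have supp (h : nat -> nat) : h 0%N = 0%N ->
    (\sum_d h (fiber f d) =
     h (fiber f c) + \sum_(d in S | d != c) h (fiber f d))%N.
  move=> h0; rewrite (bigID (mem S)) /= addnC big1 ?add0n => [|d /f0 -> //].
  by rewrite (bigD1 c).
have sumN := esym (supp id erefl); rewrite /= sum_fiber in sumN.
have sumP : (fiber f c ^ 2 + \sum_(d in S | d != c) fiber f d ^ 2
      = coincidences f f)%N.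
  by rewrite coincidences_sum -(supp (fun k => k ^ 2)%N erefl).
have := sum_sqr_ge [pred d | (d \in S) && (d != c)] (fiber f).
set M := (\sum_(_ | _) _)%N; set M2 := (\sum_(_ | _) _)%N => hM.
have EM : (fiber f c + M = #|T|)%N by exact: sumN.
have EM2 : (fiber f c ^ 2 + M2 = coincidences f f)%N by exact: sumP.
have cardS : (#|[pred d | (d \in S) && (d != c)]| + 1 <= q0)%N.
  apply: leq_trans Sq; rewrite (cardsD1 c) cS addnC leq_add2l.
  by apply/eq_leq/eq_card => d; rewrite !inE andbC.
have [k Ek] : exists k, q0 = k.+1 by exists q0.-1; lia.
have hM' : (M ^ 2 <= k * M2)%N.
  by apply: leq_trans hM _; rewrite leq_mul2r -ltnS -Ek -addn1 cardS orbT.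
move: hP; rewrite -EM2 -EM; move: hM'; rewrite {}Ek.
move: (fiber f c) (M) (M2) => N M0 M2'.
rewrite -[k.+1]addn1 => h1 h2; have -> : (k + 1)%N%:Z - 1 = k%:Z by lia.
(* With k = q0 - 1 and M the sum of the other fibres, q0 N - (N + M) = k N - M, and (k N - M)^2 = (k
   + 1)(k N^2 + M^2) - k (N + M)^2. Cauchy-Schwarz bounds M^2, the second moment bounds the rest. *)
suff: ((k%:Z + 1) * N%:Z - (N%:Z + M0%:Z)) ^+ 2 <= k%:Z ^+ 2 * (N%:Z + M0%:Z).
  by rewrite !PoszM !PoszD.
have h3 : M0%:Z ^+ 2 <= k%:Z * M2'%:Z by move: h1; rewrite -mulnn; lia.
have h4 : (N%:Z ^+ 2 + M2'%:Z) * (k%:Z + 1) <=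
    (N%:Z + M0%:Z) * (k%:Z + (N%:Z + M0%:Z)) by move: h2; rewrite -mulnn; lia.
have k0 : 0 <= k%:Z by [].
move: k%:Z N%:Z M0%:Z M2'%:Z k0 h3 h4 => k' n' m' m2 k0 h3 h4.
have h5 := ler_wpM2l k0 h4.
have h6 : m' ^+ 2 * (k' + 1) <= k' * m2 * (k' + 1).
  by rewrite ler_wpM2r // addr_ge0.
lra.
Qed.

(** * Counting matrices over a finite field *)

Section MatrixCounting.

Variable F : finFieldType.

(* A matrix is determined by one row combination, one column combination and *)
(* the minor that avoids a row and a column where these have a unit entry.   *)
Lemma card_mx_row_col_le (e k : nat) (v : 'rV[F]_e.+1) (y : 'cV[F]_k.+1)
    (u : 'rV[F]_k.+1) (z : 'cV[F]_e.+1) :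
  v != 0 -> y != 0 ->
  (#|[set a : 'M[F]_(e.+1, k.+1) | (v *m a == u) && (a *m y == z)]|
    <= #|F| ^ (e * k))%N.
Proof.
move=> v0 y0; have [i vi] := rV0Pn _ v0; have [j yj] := cV0Pn _ y0.
rewrite -card_mx; set S := [set a | _].
rewrite -(@card_in_imset _ _ (fun a => row' i (col' j a)) S) ?max_card // => a b.
rewrite !inE => /andP[/eqP va /eqP ay] /andP[/eqP vb /eqP yb] ab.
apply/eqP; rewrite -subr_eq0; set d := a - b.
have vd : v *m d = 0 by rewrite mulmxBr va vb subrr.
have dy : d *m y = 0 by rewrite mulmxBl ay yb subrr.
have d0 i' j' : i' != i -> j' != j -> d i' j' = 0.
  rewrite eq_sym [j' == j]eq_sym => /unlift_some[i1 -> _] /unlift_some[j1 -> _].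
  by move/matrixP/(_ i1 j1): ab; rewrite !mxE => ->; rewrite subrr.
have dr i' j' : i' != i -> d i' j' = 0.
  move=> i'i; have [->|/(d0 _ _ i'i)//] := eqVneq j' j.
  have: (d *m y) i' 0 = 0 by rewrite dy mxE.
  rewrite mxE (bigD1 j) //= big1 => [|l lj]; last by rewrite d0 ?mul0r.
  by rewrite addr0 => /eqP; rewrite mulf_eq0 (negPf yj) orbF => /eqP.
apply/eqP/matrixP => i' j'; rewrite [RHS]mxE.
have [->|/dr->//] := eqVneq i' i.
have: (v *m d) 0 j' = 0 by rewrite vd mxE.
rewrite mxE (bigD1 i) //= big1 => [|l li]; last by rewrite dr ?mulr0.
by rewrite addr0 => /eqP; rewrite mulf_eq0 (negPf vi) => /eqP.
Qed.

Lemma card_mx_row_le (e k : nat) (v : 'rV[F]_e.+1) (u : 'rV[F]_k) :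
  v != 0 ->
  (#|[set a : 'M[F]_(e.+1, k) | v *m a == u]| <= #|F| ^ (e * k))%N.
Proof.
move=> v0; have [i vi] := rV0Pn _ v0.
rewrite -card_mx; set S := [set a | _].
rewrite -(@card_in_imset _ _ (fun a => row' i a) S) ?max_card // => a b.
rewrite !inE => /eqP va /eqP vb ab.
apply/eqP; rewrite -subr_eq0; set d := a - b.
have vd : v *m d = 0 by rewrite mulmxBr va vb subrr.
have dr i' j' : i' != i -> d i' j' = 0.
  rewrite eq_sym => /unlift_some[i1 -> _].
  by move/matrixP/(_ i1 j'): ab; rewrite !mxE => ->; rewrite subrr.
apply/eqP/matrixP => i' j'; rewrite [RHS]mxE.
have [->|/dr->//] := eqVneq i' i.
have: (v *m d) 0 j' = 0 by rewrite vd mxE.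
rewrite mxE (bigD1 i) //= big1 => [|l li]; last by rewrite dr ?mulr0.
by rewrite addr0 => /eqP; rewrite mulf_eq0 (negPf vi) => /eqP.
Qed.

Lemma card_GL_unitmx (n : nat) :
  (0 < n)%N -> #|[set a : 'M[F]_n | a \in unitmx]| =
  (#|F| ^ 'C(n, 2) * \prod_(1 <= i < n.+1) (#|F| ^ i - 1))%N.
Proof.
case: n => // n _; rewrite -card_GL // cardsT card_sub.
by apply: eq_card => a; rewrite !inE.
Qed.

(** The matrix [row_ebase A] is invertible and its top rows span the row space of A, so its bottom
    rows complete A. *)
Lemma exists_completion (e m : nat) (A : 'M[F]_(e, e + m)) :
  row_free A -> exists C : 'M[F]_(m, e + m), col_mx A C \in unitmx.
Proof.
move=> /eqP rA; exists (dsubmx (row_ebase A)).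
suff -> : col_mx A (dsubmx (row_ebase A)) =
    block_mx (col_ebase A) 0 0 1%:M *m row_ebase A.
  by rewrite unitmx_mul row_ebase_unit unitmxE det_ublock det1 mulr1
    -unitmxE col_ebase_unit.
rewrite -[in RHS](vsubmxK (row_ebase A)) mul_block_col !mul0mx mul1mx addr0.
rewrite add0r; congr col_mx; rewrite -[A in LHS]mulmx_ebase rA pid_mx_row.
rewrite -{1}(vsubmxK (row_ebase A)) mul_mx_row mulmx1 mulmx0 mul_row_col mul0mx.
by rewrite addr0.
Qed.

Lemma card_ker_ge (n k : nat) (J : 'M[F]_n) :
  (\rank J + k <= n)%N ->
  (#|F| ^ k <= #|[set v : 'rV[F]_n | (v *m J == 0)%R]|)%N.
Proof.
move=> rJ; have rk : (k <= \rank (kermx J))%N by rewrite mxrank_ker; lia.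
apply: (@leq_trans (#|F| ^ \rank (kermx J))).
  by rewrite leq_pexp2l // ltnW // card_finNzRing_gt1.
rewrite -[X in (_ ^ X)%N]mul1n -card_mx.
rewrite -(card_imset _ (row_free_inj (row_base_free (kermx J)))).
apply/subset_leq_card/subsetP => _ /imsetP[c _ ->]; rewrite inE.
apply/eqP/sub_kermxP; rewrite -(eq_row_base (kermx J)).
exact: submxMl.
Qed.

End MatrixCounting.

(** * Singular Gram matrices *)

Section Forms.

Variables (F : finFieldType) (theta : {rmorphism F -> F}).
Hypothesis thetaK : involutive theta.

Local Notation "A ^!" := (map_mx theta A^T).

Lemma adjmx_mul (m n p : nat) (A : 'M[F]_(m, n)) (B : 'M[F]_(n, p)) :
  (A *m B)^! = B^! *m A^!.
Proof. by rewrite trmx_mul map_mxM. Qed.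

Lemma adjmxK (m n : nat) (A : 'M[F]_(m, n)) : A^!^! = A.
Proof. by apply/matrixP => i j; rewrite !mxE thetaK. Qed.

Lemma adjmx_inj (m n : nat) : injective (fun A : 'M[F]_(m, n) => A^!).
Proof. by move=> A B /(congr1 (fun C => map_mx theta C^T)); rewrite !adjmxK. Qed.

Lemma adjmx0 (m n : nat) : (0 : 'M[F]_(m, n))^! = 0.
Proof. by rewrite trmx0 map_mx0. Qed.

Lemma adjmx1 (n : nat) : (1%:M : 'M[F]_n)^! = 1%:M.
Proof. by rewrite trmx1 map_mx1. Qed.

Lemma adjmxN (m n : nat) (A : 'M[F]_(m, n)) : (- A)^! = - A^!.
Proof. by rewrite linearN map_mxN. Qed.

Lemma adjmx_unit (n : nat) (A : 'M[F]_n) : (A^! \in unitmx) = (A \in unitmx).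
Proof. by rewrite map_unitmx unitmx_tr. Qed.

Lemma adjmx_eq0 (m n : nat) (A : 'M[F]_(m, n)) : (A^! == 0) = (A == 0).
Proof. by rewrite -{1}(adjmx0 m n) (inj_eq (@adjmx_inj m n)). Qed.

Definition form_norm (n : nat) (J : 'M[F]_n) (v : 'rV[F]_n) : F :=
  (v *m J *m v^!) 0 0.

(** Double counting of the pairs (t, v) with v a nonzero vector in the left kernel of M t: every
    singular M t has at least w - 1 of them. *)
Lemma card_singular_le (T : finType) (n w : nat) (M : T -> 'M[F]_n) :
  (0 < w)%N ->
  (forall t, M t \notin unitmx -> w <= #|[set v : 'rV[F]_n | (v *m M t == 0)%R]|)%N ->
  ((w - 1) * #|[set t | M t \notin unitmx]| <=
    \sum_(v : 'rV[F]_n | v != 0%R) #|[set t | (v *m M t == 0)%R]|)%N.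
Proof.
move=> w0 hw.
have -> : (\sum_(v : 'rV[F]_n | v != 0%R) #|[set t | (v *m M t == 0)%R]| =
   \sum_t #|[set v : 'rV[F]_n | (v != 0%R) && (v *m M t == 0)%R]|)%N.
  under [RHS]eq_bigr do rewrite -sum1dep_card big_mkcondr.
  rewrite exchange_big /=; apply: eq_bigr => v _.
  by rewrite -big_mkcond sum1dep_card.
rewrite mulnC -sum_nat_const.
rewrite [X in (_ <= X)%N](bigID (mem [set t | M t \notin unitmx])) /=.
apply: (leq_trans _ (leq_addr _ _)); apply: leq_sum => t; rewrite inE => /hw.
rewrite (cardsD1 0) inE mul0mx eqxx -leq_subLR => h; apply: leq_trans h _.
by apply/subset_leq_card/subsetP => v; rewrite !inE.
Qed.

(* A vector [v] in the left kernel of [a J1 a^! + J], with [x = v a], obeys   *)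
(* [a (J1^! x^! ) = - (v J)^!]; multiplying by [v^!] gives the norm equation. *)
Lemma card_singular_sum_le (e w : nat) (J1 J : 'M[F]_e.+1) :
  J1 \in unitmx -> J \in unitmx -> (0 < w)%N ->
  (forall a, (a *m J1 *m a^! + J)%R \notin unitmx ->
    w <= #|[set v : 'rV[F]_e.+1 | (v *m (a *m J1 *m a^! + J) == 0)%R]|)%N ->
  ((w - 1) * #|[set a : 'M[F]_e.+1 | (a *m J1 *m a^! + J)%R \notin unitmx]| <=
   (coincidences (form_norm J1) (form_norm (- J)) - 1) * #|F| ^ (e * e))%N.
Proof.
move=> uJ1 uJ w0 hw.
apply: leq_trans (card_singular_le w0 hw) _.
pose P (p : 'rV[F]_e.+1 * 'rV[F]_e.+1) :=
  (form_norm J1 p.1 == form_norm (- J) p.2).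
have norm0 (K : 'M[F]_e.+1) : form_norm K 0 = 0.
  by rewrite /form_norm !mul0mx mxE.
have -> : (coincidences (form_norm J1) (form_norm (- J)) - 1 =
   #|[set p : 'rV[F]_e.+1 * 'rV[F]_e.+1 | (p != (0%R, 0%R)) && P p]|)%N.
  rewrite /coincidences (cardsD1 (0, 0)) inE /= !norm0 eqxx add1n subn1 /=.
  by apply: eq_card => p; rewrite !inE.
rewrite -sum_nat_const.
have -> : (\sum_(p in [set p : 'rV[F]_e.+1 * 'rV[F]_e.+1 |
      (p != (0%R, 0%R)) && P p]) #|F| ^ (e * e) =
    \sum_(v : 'rV[F]_e.+1) \sum_(x : 'rV[F]_e.+1 |
       ((x, v) != (0%R, 0%R)) && P (x, v)) #|F| ^ (e * e))%N.
  rewrite [RHS](exchange_big_dep xpredT) //= pair_big_dep /=.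
  by apply: eq_bigl => -[x v]; rewrite inE.
rewrite [X in (_ <= X)%N](bigID (fun v : 'rV[F]_e.+1 => v != 0)) /=.
apply: (leq_trans _ (leq_addr _ _)); apply: leq_sum => v v0.
set S := [set a | _].
have -> : #|S| = (\sum_(x : 'rV[F]_e.+1) #|[set a in S | v *m a == x]|)%N.
  rewrite -sum1_card (partition_big (fun a => v *m a) xpredT) //=.
  by apply: eq_bigr => x _; rewrite -sum1_card; apply: eq_bigl => a; rewrite inE.
rewrite [X in (_ <= X)%N]big_mkcond /=; apply: leq_sum => x _.
have key a : a \in S -> v *m a = x ->
   [/\ x != 0, a *m (J1^! *m x^!) = - (v *m J)^! & P (x, v)].
  rewrite inE => /eqP h va.
  have h1 : x *m J1 *m a^! = - (v *m J).
    apply/eqP; rewrite -addr_eq0 -va; apply/eqP.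
    by rewrite -h mulmxDr !mulmxA.
  split.
  - apply: contra_neq v0 => x0; move/eqP: h1; rewrite x0 !mul0mx eq_sym oppr_eq0.
    by move=> /eqP h1; rewrite -(mulmxK uJ v) h1 mul0mx.
  - by rewrite -adjmx_mul -[a in LHS]adjmxK -adjmx_mul h1 adjmxN.
  - rewrite /P /= /form_norm; apply/eqP; congr (fun_of_matrix _ 0 0).
    by rewrite -{2}va adjmx_mul mulmxA h1 mulmxN.
have [->|[a0]] := set_0Vmem [set a in S | v *m a == x]; first by rewrite cards0.
case/setIdP=> a0S /eqP va0; have [x0 _ Px] := key _ a0S va0.
rewrite xpair_eqE (negPf x0) Px /=.
(* For fixed v and x both v a and the product of a with a nonzero column are prescribed, so only an
   e by e minor of a is free. *)
apply: leq_trans (card_mx_row_col_le (y := J1^! *m x^!) x (- (v *m J)^!) v0 _).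
  apply/subset_leq_card/subsetP => a /setIdP[aS /eqP va].
  by have [_ ay _] := key a aS va; rewrite inE va ay !eqxx.
have : x^! != 0 by rewrite adjmx_eq0.
apply: contra_neq => h; rewrite -(mulKmx (_ : J1^! \in unitmx) x^!) ?h ?mulmx0 //.
by rewrite adjmx_unit.
Qed.

(** If v lies in the left kernel of [b J b^!], then x = v b is zero or isotropic. The case x = 0
    leaves e rows of b free; a nonzero x forces in addition that b kills the column [J^! x^!], which
    leaves an e by m minor. *)
Lemma card_singular_gram_le (e m w : nat) (J : 'M[F]_m.+1) :
  J \in unitmx -> (0 < w)%N ->
  (forall b : 'M[F]_(e.+1, m.+1), b *m J *m b^! \notin unitmx ->
    w <= #|[set v : 'rV[F]_e.+1 | (v *m (b *m J *m b^!) == 0)%R]|)%N ->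
  ((w - 1) * #|[set b : 'M[F]_(e.+1, m.+1) | (b *m J *m b^!)%R \notin unitmx]| <=
   (#|F| ^ e.+1 - 1) * (#|F| ^ (e * m.+1) +
     (fiber (form_norm J) 0%R - 1) * #|F| ^ (e * m)))%N.
Proof.
move=> uJ w0 hw; apply: leq_trans (card_singular_le w0 hw) _.
have norm0 (K : 'M[F]_m.+1) : form_norm K 0 = 0.
  by rewrite /form_norm !mul0mx mxE.
set c := (_ + _)%N.
have -> : (#|F| ^ e.+1 - 1 = #|[set v : 'rV[F]_e.+1 | v != 0%R]|)%N.
  rewrite -[X in (_ ^ X)%N]mul1n -card_mx -cardsT (cardsD1 0) in_setT add1n subn1 /=.
  by apply: eq_card => v; rewrite !inE andbT.
rewrite -sum_nat_const [X in (_ <= X)%N](eq_bigl (fun v => v != 0)) => [|v]; last first.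
  by rewrite inE.
apply: leq_sum => v v0; set S := [set b | _].
have -> : #|S| = (\sum_(x : 'rV[F]_m.+1) #|[set b in S | v *m b == x]|)%N.
  rewrite -sum1_card (partition_big (fun b => v *m b) xpredT) //=.
  by apply: eq_bigr => x _; rewrite -sum1_card; apply: eq_bigl => a; rewrite inE.
rewrite (bigD1 0) //=; apply: leq_add.
  apply: leq_trans (card_mx_row_le 0 v0).
  by apply/subset_leq_card/subsetP => b; rewrite !inE => /andP[_].
have -> : (fiber (form_norm J) 0%R - 1 =
    #|[set x : 'rV[F]_m.+1 | (x != 0%R) && (form_norm J x == 0%R)]|)%N.
  rewrite /fiber (cardsD1 0) inE norm0 eqxx add1n subn1 /=.
  by apply: eq_card => p; rewrite !inE.
rewrite -sum_nat_const big_mkcond [X in (_ <= X)%N]big_mkcond /=.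
apply: leq_sum => x _; rewrite inE; have [//|x0] := eqVneq x 0.
have key b : b \in S -> v *m b = x ->
   b *m (J^! *m x^!) = 0 /\ form_norm J x = 0.
  rewrite inE => /eqP h vb.
  have h1 : x *m J *m b^! = 0 by rewrite -vb -h !mulmxA.
  split; first by apply: adjmx_inj; rewrite !adjmx_mul !adjmxK h1 adjmx0.
  by rewrite /form_norm -{2}vb adjmx_mul mulmxA h1 mul0mx mxE.
have [->|[b0]] := set_0Vmem [set b in S | v *m b == x]; first by rewrite cards0.
case/setIdP=> b0S /eqP vb0; have [_ Px] := key _ b0S vb0.
rewrite Px eqxx /=.
apply: leq_trans (card_mx_row_col_le (y := J^! *m x^!) x 0 v0 _).
  apply/subset_leq_card/subsetP => a /setIdP[aS /eqP va].
  by have [ay _] := key a aS va; rewrite inE va ay !eqxx.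
have : x^! != 0 by rewrite adjmx_eq0.
apply: contra_neq => h; rewrite -(mulKmx (_ : J^! \in unitmx) x^!) ?h ?mulmx0 //.
by rewrite adjmx_unit.
Qed.

(* Gram-Schmidt: orthogonalise an arbitrary completion against [A].          *)
Lemma exists_orthogonal_completion (e m : nat) (J : 'M[F]_(e + m))
    (A : 'M[F]_(e, e + m)) (s : F) :
  s != 0 -> J^! = s *: J -> A *m J *m A^! \in unitmx ->
  exists C : 'M[F]_(m, e + m),
    [/\ col_mx A C \in unitmx, C *m J *m A^! = 0 & A *m J *m C^! = 0].
Proof.
move=> s0 hJ uA.
have /exists_completion[C0 uC0] : row_free A.
  apply/row_freeP; exists (J *m A^! *m invmx (A *m J *m A^!)).
  by rewrite !mulmxA mulmxV.
pose D := C0 *m J *m A^! *m invmx (A *m J *m A^!).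
exists (C0 - D *m A).
have CA : (C0 - D *m A) *m J *m A^! = 0.
  have DA : D *m A *m J *m A^! = C0 *m J *m A^!.
    by rewrite -(mulmxA D) -(mulmxA D) mulmxKV.
  by rewrite !mulmxBl DA subrr.
split => //; last first.
  apply: adjmx_inj; rewrite adjmx0 !adjmx_mul adjmxK hJ -scalemxAl -scalemxAr.
  by rewrite mulmxA CA scaler0.
have -> : col_mx A (C0 - D *m A) = block_mx 1%:M 0 (- D) 1%:M *m col_mx A C0.
  by rewrite mul_block_col !mul1mx mul0mx addr0 mulNmx addrC.
by rewrite unitmx_mul uC0 unitmxE det_lblock !det1 mulr1 unitr1.
Qed.

Lemma gram_col_mx (e m d : nat) (J : 'M[F]_d)
    (A : 'M[F]_(e, d)) (C : 'M[F]_(m, d)) :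
  C *m J *m A^! = 0 -> A *m J *m C^! = 0 ->
  col_mx A C *m J *m (col_mx A C)^! =
    block_mx (A *m J *m A^!) 0 0 (C *m J *m C^!).
Proof.
move=> CA AC; rewrite tr_col_mx map_row_mx mul_col_mx mul_col_row.
by rewrite CA AC.
Qed.

End Forms.

(** * Fibres of functionals and second moments of quadratic maps *)

Lemma card_roots_lt (F : finFieldType) (p : {poly F}) :
  p != 0 -> (#|[set t | root p t]| < size p)%N.
Proof.
move=> p0; rewrite cardE; apply: max_poly_roots => //; last exact: enum_uniq.
by apply/allP => t; rewrite mem_enum inE.
Qed.

Lemma card_functional_le (F : finFieldType) (n : nat) (y : 'cV[F]_n.+1) t :
  y != 0 -> (#|[set x : 'rV[F]_n.+1 | x *m y == t]| <= #|F| ^ n)%N.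
Proof.
move=> y0; have y0' : y^T != 0 by rewrite trmx_eq0.
have := card_mx_row_le t^T y0'; rewrite muln1; apply: leq_trans.
rewrite -(card_imset _ (@trmx_inj F 1 n.+1)); apply/subset_leq_card/subsetP.
by move=> _ /imsetP[x xt ->]; move: xt; rewrite !inE => /eqP <-; rewrite -trmx_mul.
Qed.

(** The |F| fibres have at most |F|^n elements each and |F|^(n+1) together, so none falls short. *)
Lemma card_functional (F : finFieldType) (n : nat) (y : 'cV[F]_n.+1) t :
  y != 0 -> (#|[set x : 'rV[F]_n.+1 | x *m y == t]| = #|F| ^ n)%N.
Proof.
move=> y0; apply/eqP; rewrite eqn_leq card_functional_le //= leqNgt.
apply/negP => h.
have : (#|{: 'rV[F]_n.+1}| < \sum_(s : 'M[F]_1) #|F| ^ n)%N.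
  rewrite -(sum_fiber (fun x : 'rV[F]_n.+1 => x *m y)).
  rewrite (bigD1 t) //= [X in (_ < X)%N](bigD1 t) //= -addSn leq_add //.
  by apply: leq_sum => s _; apply: card_functional_le.
by rewrite sum_nat_const !card_mx !mul1n expnS ltnn.
Qed.

Section SecondMoment.

Variables (F : finFieldType) (n : nat).
Variables (f : 'rV[F]_n -> F) (L : 'rV[F]_n -> 'rV[F]_n -> F).
Hypothesis fD : forall x s, f (x + s) = f x + L x s + f s.

(** The substitution y = x + s turns f x = f y into a condition on the polar form alone. *)
Lemma coincidences_polar :
  coincidences f f = (\sum_s #|[set x | L x s == (- f s)%R]|)%N.
Proof.
rewrite card_rel_sum_sym /coincidences (card_rel_sum (fun x y => f x == f y)).
apply: eq_bigr => x _; rewrite -[RHS](card_imset _ (addrI x)).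
apply: eq_card => y; rewrite inE; apply/eqP/imsetP => [fxy|[s + ->]].
  exists (y - x); last by rewrite addrC subrK.
  rewrite inE; have := fD x (y - x); rewrite [x + _]addrC subrK -fxy => h.
  by rewrite -addr_eq0 -(inj_eq (addrI (f x))) addrA -h addr0.
by rewrite inE fD => /eqP ->; rewrite subrK.
Qed.

Hypothesis f0 : f 0 = 0.
Hypothesis L0 : forall x, L x 0 = 0.

Let polar0 : #|[set x | L x 0 == - f 0]| = (#|F| ^ n)%N.
Proof.
rewrite -[X in (_ ^ X)%N]mul1n -card_mx -cardsT.
by apply: eq_card => x; rewrite !inE L0 f0 oppr0 eqxx.
Qed.

(** The shift s = 0 contributes all |F|^n vectors, any other shift at most a fraction 1 / q0 of
    them. Below, q0 is |F| for quadratic forms, and the square root of |F| for hermitian norms,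
    which take values in the fixed field only. *)
Lemma coincidences_le_second_moment (q0 : nat) :
  (forall s c, s != 0%R -> #|[set x | L x s == c]| * q0 <= #|F| ^ n)%N ->
  (coincidences f f * q0 <= #|F| ^ n * (q0 + #|F| ^ n - 1))%N.
Proof.
move=> hL; rewrite coincidences_polar (bigD1 0) //= polar0 mulnDl.
rewrite -addnBA ?expn_gt0 ?(ltnW (card_finNzRing_gt1 _)) // mulnDr leq_add2l.
rewrite big_distrl /=; apply: (@leq_trans (\sum_(s : 'rV[F]_n | s != 0%R) #|F| ^ n)%N).
  by apply: leq_sum => s s0; apply: hL.
rewrite sum_nat_const mulnC leq_mul2l -[X in (#|F| ^ X - 1)%N]mul1n -card_mx.
by rewrite subn1 (cardC1 (0 : 'rV[F]_n)) leqnn orbT.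
Qed.

Lemma coincidences_eq_second_moment (q0 : nat) :
  (forall s c, s != 0%R -> #|[set x | L x s == c]| * q0 = #|F| ^ n)%N ->
  (coincidences f f * q0 = #|F| ^ n * (q0 + #|F| ^ n - 1))%N.
Proof.
move=> hL; rewrite coincidences_polar (bigD1 0) //= polar0 mulnDl.
rewrite -addnBA ?expn_gt0 ?(ltnW (card_finNzRing_gt1 _)) // mulnDr.
congr (_ + _)%N; rewrite big_distrl /=.
rewrite (eq_bigr (fun=> #|F| ^ n)%N) => [|s s0]; last exact: hL.
rewrite sum_nat_const mulnC -[X in (#|F| ^ X - 1)%N]mul1n -card_mx.
by rewrite subn1 (cardC1 (0 : 'rV[F]_n)).
Qed.

End SecondMoment.

(** * Alternating forms *)

Section Alternating.

Variables (F : finFieldType) (theta : {rmorphism F -> F}).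
Hypothesis thetaE : theta =1 id.

Local Notation "A ^!" := (map_mx theta A^T).

Definition alternating (n : nat) (J : 'M[F]_n) : Prop :=
  forall v : 'rV[F]_n, v *m J *m v^! = 0.

Let thetaK : involutive theta. Proof. by move=> x; rewrite !thetaE. Qed.

Lemma alternating_congr (m n : nat) (J : 'M[F]_n) (A : 'M[F]_(m, n)) :
  alternating J -> alternating (A *m J *m A^!).
Proof. by move=> aJ v; rewrite -(aJ (v *m A)) adjmx_mul !mulmxA. Qed.

Lemma alternating_skew (n : nat) (J : 'M[F]_n) (u v : 'rV[F]_n) :
  alternating J -> u *m J *m v^! = - (v *m J *m u^!).
Proof.
move=> aJ; apply/eqP; rewrite -addr_eq0; apply/eqP.
have := aJ (u + v); rewrite linearD map_mxD !mulmxDl !mulmxDr !aJ add0r addr0.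
by [].
Qed.

Lemma bilinear_mx_inj (m n : nat) (A B : 'M[F]_(m, n)) :
  (forall (u : 'rV_m) (v : 'rV_n), u *m A *m v^! = u *m B *m v^!) -> A = B.
Proof.
move=> h; apply/matrixP => i j.
have := h (delta_mx 0 i) (delta_mx 0 j); rewrite !trmx_delta !map_delta_mx.
by rewrite -!rowE -!colE => /matrixP/(_ 0 0); rewrite !mxE.
Qed.

Lemma alternating_adj (n : nat) (J : 'M[F]_n) : alternating J -> J^! = - 1 *: J.
Proof.
move=> aJ; apply: bilinear_mx_inj => u v.
rewrite scaleN1r mulmxN mulNmx [in RHS](alternating_skew _ _ aJ) opprK.
have -> : u *m J^! *m v^! = (v *m J *m u^!)^!.
  by rewrite !(adjmx_mul theta) (adjmxK thetaK) mulmxA.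
by apply/matrixP => i j; rewrite !mxE thetaE !ord1.
Qed.

Definition hyperbolic_mx : 'M[F]_(1 + 1) := block_mx 0 1%:M (- 1%:M) 0.

Lemma hyperbolic_mx_unit : hyperbolic_mx \in unitmx.
Proof.
have h : hyperbolic_mx *m (- hyperbolic_mx) = 1%:M.
  rewrite /hyperbolic_mx opp_block_mx mulmx_block.
  rewrite !(mul0mx, mulmx0, mulmx1, mul1mx, oppr0, opprK, addr0, add0r, mulmxN).
  by rewrite -scalar_mx_block.
by case: (mulmx1_unit h).
Qed.

(** A nonzero entry of J, scaled to 1, yields a hyperbolic pair; its Gram matrix is invertible, so
    the plane that it spans splits off orthogonally. *)
Lemma alternating_split (k : nat) (J : 'M[F]_(2 + k)) :
  alternating J -> J != 0 ->
  exists (X : 'M[F]_(2 + k)) (J' : 'M[F]_k),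
    [/\ X \in unitmx, alternating J' &
        X *m J *m X^! = block_mx hyperbolic_mx 0 0 J'].
Proof.
move=> aJ J0.
have [u [v uv]] : exists u v : 'rV[F]_(2 + k), u *m J *m v^! = 1%:M.
  have [i [j ij]] := matrix0Pn _ J0.
  exists ((J i j)^-1 *: delta_mx 0 i), (delta_mx 0 j).
  rewrite trmx_delta map_delta_mx -!scalemxAl -rowE -colE.
  by apply/matrixP => a b; rewrite !mxE !ord1 mulVf.
pose A : 'M[F]_(1 + 1, 2 + k) := col_mx u v.
have gA : A *m J *m A^! = hyperbolic_mx.
  rewrite /A tr_col_mx map_row_mx mul_col_mx mul_col_row !aJ uv.
  by rewrite (alternating_skew _ _ aJ) uv.
have s0 : (-1 : F) != 0 by rewrite oppr_eq0 oner_eq0.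
have [|C [uX CA AC]] :=
    exists_orthogonal_completion thetaK s0 (alternating_adj aJ) (A := A).
  by rewrite gA hyperbolic_mx_unit.
exists (col_mx A C), (C *m J *m C^!); split => //.
  exact: alternating_congr.
by rewrite (gram_col_mx CA AC) gA.
Qed.

Lemma alternating_small (J : 'M[F]_1) : alternating J -> J = 0.
Proof.
move=> aJ; have := aJ 1%:M.
by rewrite mul1mx trmx1 map_mx1 mulmx1.
Qed.

(** Each hyperbolic plane that splits off contributes 2 to the rank. In consequence a singular
    alternating matrix of even size has a kernel of dimension at least 2, which sharpens the counts
    below. *)
Lemma alternating_rank_even (n : nat) (J : 'M[F]_n) :
  alternating J -> ~~ odd (\rank J).
Proof.
elim/ltn_ind: n J => -[|[|k]] IH J aJ.
- by rewrite (flatmx0 J) mxrank0.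
- by rewrite (alternating_small aJ) mxrank0.
have [->|J0] := eqVneq J 0; first by rewrite mxrank0.
have [X [J' [uX aJ' eJ]]] := alternating_split (aJ : alternating (J : 'M_(2 + k))) J0.
have := congr1 (@mxrank F _ _) eJ; rewrite rank_diag_block_mx.
rewrite mxrankMfree ?row_free_unit ?(adjmx_unit theta) // eqmxMfull ?row_full_unit //.
rewrite (eqP (_ : row_free hyperbolic_mx)) ?row_free_unit ?hyperbolic_mx_unit //.
by move=> ->; rewrite oddD /= IH.
Qed.

(** A hyperbolic plane is split off from both forms; a congruence of what remains, extended by the
    identity on the plane, is transported back. *)
Lemma alternating_congruent (n : nat) (J J' : 'M[F]_n) :
  alternating J -> alternating J' -> J \in unitmx -> J' \in unitmx ->
  exists2 P, P \in unitmx & P *m J *m P^! = J'.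
Proof.
elim/ltn_ind: n J J' => -[|[|k]] IH J J' aJ aJ' uJ uJ'.
- by exists 1%:M; rewrite ?unitmx1 // [LHS]flatmx0 [RHS]flatmx0.
- by move: uJ; rewrite (alternating_small aJ) unitmxE det0 unitr0.
have unit_neq0 (K : 'M[F]_k.+2) : K \in unitmx -> K != 0.
  by apply: contraTneq => ->; rewrite unitmxE det0 unitr0.
have [X [J1 [uX aJ1 e1]]] :=
  alternating_split (aJ : alternating (J : 'M_(2 + k))) (unit_neq0 _ uJ).
have [Y [J2 [uY aJ2 e2]]] :=
  alternating_split (aJ' : alternating (J' : 'M_(2 + k))) (unit_neq0 _ uJ').
have unit_sub (Z K : 'M[F]_(2 + k)) K1 : Z \in unitmx -> K \in unitmx ->
    Z *m K *m Z^! = block_mx hyperbolic_mx 0 0 K1 -> K1 \in unitmx.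
  move=> uZ uK eZ; have : Z *m K *m Z^! \in unitmx.
    by rewrite !unitmx_mul uZ uK (adjmx_unit theta).
  by rewrite eZ unitmxE det_ublock unitrM => /andP[].
have [P uP eP] := IH k (ltnW (ltnSn _)) J1 J2 aJ1 aJ2
  (unit_sub _ _ _ uX uJ e1) (unit_sub _ _ _ uY uJ' e2).
pose D : 'M[F]_(2 + k) := block_mx 1%:M 0 0 P.
have uD : D \in unitmx by rewrite unitmxE det_ublock det1 mul1r.
have eD : D *m (X *m J *m X^!) *m D^! = Y *m J' *m Y^!.
  rewrite e1 e2 /D tr_block_mx map_block_mx !mulmx_block.
  by rewrite !(trmx0, map_mx0, trmx1, map_mx1, mul0mx, mulmx0, mulmx1, mul1mx,
    addr0, add0r) eP.
exists (invmx Y *m D *m X).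
  by rewrite !unitmx_mul unitmx_inv uY uD.
have -> : invmx Y *m D *m X *m J *m (invmx Y *m D *m X)^! =
    invmx Y *m (D *m (X *m J *m X^!) *m D^!) *m (invmx Y)^!.
  by rewrite !(adjmx_mul theta) !mulmxA.
rewrite eD !mulmxA mulVmx // mul1mx -mulmxA -(adjmx_mul theta) mulVmx //.
by rewrite (adjmx1 theta) mulmx1.
Qed.

End Alternating.

(** * Hermitian forms *)

Section Hermitian.

Variables (F : finFieldType) (theta : {rmorphism F -> F}) (q : nat).
Hypothesis cardF : #|F| = (q ^ 2)%N.
Hypothesis thetaE : forall x, theta x = x ^+ q.

Local Notation "A ^!" := (map_mx theta A^T).

Lemma hermitian_q_gt1 : (1 < q)%N.
Proof.
have := card_finNzRing_gt1 F; rewrite cardF; case: q => [|[|]] //.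
Qed.

Lemma hermitian_thetaK : involutive theta.
Proof. by move=> x; rewrite !thetaE -exprM mulnn -cardF expf_card. Qed.

Let q1 := hermitian_q_gt1.
Let thetaK := hermitian_thetaK.

Lemma card_fixed_le : (#|[set c : F | theta c == c]| <= q)%N.
Proof.
have sz : size ('X^q - 'X : {poly F}) = q.+1.
  by rewrite size_polyDl size_polyXn // size_polyN size_polyX.
have p0 : ('X^q - 'X : {poly F}) != 0 by rewrite -size_poly_eq0 sz.
have := card_roots_lt p0; rewrite sz ltnS; apply: leq_trans.
apply/subset_leq_card/subsetP => c; rewrite !inE thetaE => /eqP h.
by rewrite rootE !hornerE h subrr.
Qed.

Lemma card_trace_fiber_le (c : F) : (#|[set t : F | (t + theta t == c)%R]| <= q)%N.
Proof.
have sz : size ('X^q + ('X - c%:P) : {poly F}) = q.+1.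
  by rewrite size_polyDl size_polyXn // size_XsubC.
have p0 : ('X^q + ('X - c%:P) : {poly F}) != 0 by rewrite -size_poly_eq0 sz.
have := card_roots_lt p0; rewrite sz ltnS; apply: leq_trans.
apply/subset_leq_card/subsetP => t; rewrite !inE thetaE => /eqP h.
rewrite rootE !(hornerD, hornerN, hornerXn, hornerX, hornerC) -h.
by rewrite addrA [_ + t]addrC subrr.
Qed.

Lemma card_norm_fiber_le (c : F) : (#|[set t : F | (t * theta t == c)%R]| <= q.+1)%N.
Proof.
have sz : size ('X^(q.+1) - c%:P : {poly F}) = q.+2 by rewrite size_XnsubC.
have p0 : ('X^(q.+1) - c%:P : {poly F}) != 0 by rewrite -size_poly_eq0 sz.
have := card_roots_lt p0; rewrite sz ltnS; apply: leq_trans.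
apply/subset_leq_card/subsetP => t; rewrite !inE thetaE => /eqP h.
by rewrite rootE !hornerE -h -exprS subrr.
Qed.

(** By counting. Norms are fixed by [theta], there are at most q fixed scalars, and a value has at
    most q + 1 preimages, zero having only itself. With fewer than q norms the field would have at
    most 1 + (q - 2)(q + 1) < q^2 elements. *)
Lemma norm_surjective c : theta c = c -> exists t, t * theta t = c.
Proof.
move=> hc; pose K := [set c | theta c == c]; pose NS := [set t * theta t | t : F].
have NSK : NS \subset K.
  by apply/subsetP => _ /imsetP[t _ ->]; rewrite inE rmorphM thetaK mulrC.
suff /eqP ENS : NS == K.
  have : c \in NS by rewrite ENS inE hc.
  by case/imsetP => t _ ->; exists t.
rewrite eqEcard NSK /=; apply: leq_trans card_fixed_le _.
rewrite leqNgt; apply/negP => hlt.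
    have : (#|F| <= 1 + #|NS :\ 0%R| * q.+1)%N.
      rewrite -[X in (X <= _)%N]sum1_card.
      rewrite (partition_big (fun t => t * theta t)
         (mem NS)) /=; last by move=> t _; apply: imset_f.
      have z0 : 0 \in NS.
        by apply/imsetP; exists 0; rewrite ?mul0r.
      rewrite (bigD1 0) //=; apply: leq_add.
        rewrite sum1dep_card (_ : [set _ | _] = [set 0]) ?cards1 //.
        apply/setP => t; rewrite !inE mulf_eq0 fmorph_eq0 orbb //.
      rewrite -sum_nat_const big_mkcond [X in (_ <= X)%N]big_mkcond /=.
      apply: leq_sum => d _; rewrite !inE andbC; case: ifP => // _.
      by rewrite sum1dep_card card_norm_fiber_le.
    have z0 : 0 \in NS.
      by apply/imsetP; exists 0; rewrite ?mul0r.
    move: hlt; rewrite (cardsD1 0 NS) z0 cardF.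
    move: #|_ :\ _| => k; have := q1; rewrite -mulnn; nia.
Qed.

Lemma exists_trace_neq0 : exists t, t + theta t != 0.
Proof.
apply/existsP; rewrite -[X in is_true X]negbK negb_exists; apply/negP => /forallP h.
have := card_trace_fiber_le 0; rewrite (_ : [set _ | _] = setT).
  by rewrite cardsT cardF -mulnn; have := q1; nia.
by apply/setP => t; rewrite !inE; have := h t; rewrite negbK.
Qed.

Lemma hermitian_norm_fixed (n : nat) (J : 'M[F]_n) v :
  J^! = J -> theta (form_norm theta J v) = form_norm theta J v.
Proof.
move=> hJ; have h : (v *m J *m v^!)^! = v *m J *m v^!.
  by rewrite !(adjmx_mul theta) (adjmxK thetaK) hJ mulmxA.
by rewrite /form_norm -[in RHS]h !mxE.
Qed.

Lemma hermitian_congr_adj (m n : nat) (J : 'M[F]_n) (A : 'M[F]_(m, n)) :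
  J^! = J -> (A *m J *m A^!)^! = A *m J *m A^!.
Proof. by move=> hJ; rewrite !(adjmx_mul theta) (adjmxK thetaK) hJ mulmxA. Qed.

Lemma hermitian_norm_polar (n : nat) (J : 'M[F]_n) x s :
  J^! = J ->
  form_norm theta J (x + s) = form_norm theta J x +
    ((x *m J *m s^!) 0 0 + theta ((x *m J *m s^!) 0 0)) + form_norm theta J s.
Proof.
move=> hJ; rewrite /form_norm linearD map_mxD !mulmxDl !mulmxDr.
have -> : s *m J *m x^! = (x *m J *m s^!)^!.
  by rewrite !(adjmx_mul theta) (adjmxK thetaK) hJ mulmxA.
by rewrite !mxE !addrA.
Qed.

(** For s nonzero, [x J s^!] runs uniformly over F, and at most q scalars have a given trace; so the
    polar form takes a given value on at most a fraction 1 / q of all x. *)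
Lemma hermitian_coincidences (n : nat) (J : 'M[F]_n) :
  J^! = J -> J \in unitmx ->
  (coincidences (form_norm theta J) (form_norm theta J) * q
    <= #|F| ^ n * (q + #|F| ^ n - 1))%N.
Proof.
move=> hJ uJ.
apply: (coincidences_le_second_moment (fun x s => hermitian_norm_polar x s hJ)).
- by rewrite /form_norm mul0mx mul0mx mxE.
- by move=> x; rewrite trmx0 map_mx0 mulmx0 mxE rmorph0 addr0.
case: n J hJ uJ => [|n] J hJ uJ s c s0.
  by rewrite [s]thinmx0 eqxx in s0.
have y0 : J *m s^! != 0.
  apply: contra_neq s0 => /(congr1 (mulmx (invmx J))).
  by rewrite mulKmx // mulmx0 => /eqP; rewrite (adjmx_eq0 thetaK) => /eqP.
rewrite (_ : #|_| = \sum_(t : F | (t + theta t == c)%R)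
    #|[set x : 'rV[F]_n.+1 | x *m (J *m s^!) == t%:M]|)%N; last first.
  rewrite -sum1_card (partition_big (fun x : 'rV[F]_n.+1 => (x *m J *m s^!) 0%R 0%R)
    (fun t => t + theta t == c)%R) => [|x]; last by rewrite inE.
  apply: eq_bigr => t tc; rewrite -sum1_card; apply: eq_bigl => x; rewrite !inE.
  apply/andP/eqP => [[_ /eqP <-]|]; first by rewrite mulmxA -mx11_scalar.
  by rewrite mulmxA => ->; rewrite mxE eqxx mulr1n.
apply: (@leq_trans ((q * #|F| ^ n) * q)%N); last first.
  by rewrite mulnAC mulnn -cardF expnS.
rewrite leq_mul2r; apply/orP; right.
apply: (@leq_trans (\sum_(t : F | (t + theta t == c)%R) #|F| ^ n)%N).
  by apply: leq_sum => t _; apply: card_functional_le.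
rewrite sum_nat_const leq_mul2r; apply/orP; right.
apply: leq_trans (card_trace_fiber_le c).
by apply/subset_leq_card/subsetP => t; rewrite !inE.
Qed.

(** This is [fiber_deviation] with the fixed scalars as possible values. Since |F|^n is the square
    of q^n, the square root of the bound is exact. *)
Lemma hermitian_isotropic_le (n : nat) (J : 'M[F]_n) :
  J^! = J -> J \in unitmx ->
  (q * fiber (form_norm theta J) 0%R <= q ^ (2 * n) + (q - 1) * q ^ n)%N.
Proof.
move=> hJ uJ; have hc := hermitian_coincidences hJ uJ.
have := @fiber_deviation _ _ (form_norm theta J) [set c : F | theta c == c] q 0.
rewrite card_mx mul1n cardF -expnM => /(_ _ card_fixed_le _ _)/wrap[].
- by move=> v; rewrite inE; apply/eqP/hermitian_norm_fixed.
- by rewrite inE rmorph0.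
- by move: hc; rewrite cardF -expnM.
have -> : (q ^ (2 * n) = q ^ n * q ^ n)%N by rewrite mul2n -addnn expnD.
move: (fiber _ _) (q ^ n)%N => N T h.
have {}h : ((q * N)%:Z - (T * T)%:Z) ^+ 2 <= ((q%:Z - 1) * T%:Z) ^+ 2.
  by apply: le_trans h _; rewrite PoszM exprMn.
have hp : 0 <= (q%:Z - 1) * T%:Z by rewrite mulr_ge0 //; have := q1; lia.
have := q1 => hq; rewrite leqNgt; apply/negP => hlt.
suff : ((q%:Z - 1) * T%:Z) ^+ 2 < ((q * N)%:Z - (T * T)%:Z) ^+ 2 by rewrite ltNge h.
have hlt' : (q%:Z - 1) * T%:Z < (q * N)%:Z - (T * T)%:Z by nia.
by rewrite !expr2 ltr_pM.
Qed.

(** If all norms vanished, polarisation would make every t of trace zero, because a nonzero entry of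
    J can be scaled to any t. A vector of nonzero norm is then rescaled by surjectivity of the
    norm. *)
Lemma hermitian_exists_unit_norm (n : nat) (J : 'M[F]_n) :
  J^! = J -> J != 0 -> exists u : 'rV[F]_n, u *m J *m u^! = 1%:M.
Proof.
move=> hJ J0.
have [v v0] : exists v, form_norm theta J v != 0.
  apply/existsP; rewrite -[X in is_true X]negbK negb_exists; apply/negP => /forallP h.
  have {}h v : form_norm theta J v = 0 by apply/eqP; have := h v; rewrite negbK.
  have [i [j ij]] := matrix0Pn _ J0; have [t /negP[]] := exists_trace_neq0.
  have := hermitian_norm_polar ((t * (J i j)^-1) *: delta_mx 0 i) (delta_mx 0 j) hJ.
  rewrite !h add0r addr0 trmx_delta map_delta_mx -!scalemxAl -rowE -colE !mxE.
  by rewrite mulfVK // => <-.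
have [t ht] : exists t, t * theta t = (form_norm theta J v)^-1.
  by apply: norm_surjective; rewrite fmorphV hermitian_norm_fixed.
exists (t *: v).
rewrite linearZ map_mxZ -!scalemxAl -scalemxAr scalerA ht [v *m J *m _]mx11_scalar.
by rewrite -/(form_norm theta J v) scale_scalar_mx mulVf.
Qed.

Lemma hermitian_orthonormal (n : nat) (J : 'M[F]_n) :
  J^! = J -> J \in unitmx -> exists2 P, P \in unitmx & P *m J *m P^! = 1%:M.
Proof.
elim: n J => [|n IH] J hJ uJ.
  by exists 1%:M; rewrite ?unitmx1 // [LHS]flatmx0 [RHS]flatmx0.
have J0 : J != 0 by apply: contraTneq uJ => ->; rewrite unitmxE det0 unitr0.
have [u uu] := hermitian_exists_unit_norm hJ J0.
have hJ1 : J^! = 1 *: J by rewrite scale1r.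
have [|C [uX CA AC]] := exists_orthogonal_completion thetaK (oner_neq0 F)
   (hJ1 : (J : 'M_(1 + n))^! = _) (A := u); first by rewrite uu unitmx1.
have := gram_col_mx CA AC; set X := col_mx u C; set J1 := C *m _ *m _; rewrite uu => eX.
have uJ1 : J1 \in unitmx.
  have : X *m J *m X^! \in unitmx by rewrite !unitmx_mul uX uJ (adjmx_unit theta).
  by rewrite eX unitmxE det_ublock unitrM => /andP[].
have [P uP eP] := IH J1 (hermitian_congr_adj C hJ) uJ1.
pose D : 'M[F]_(1 + n) := block_mx 1%:M 0 0 P.
have uD : D \in unitmx by rewrite unitmxE det_ublock det1 mul1r.
exists (D *m X); first by rewrite unitmx_mul uD uX.
have -> : D *m X *m J *m (D *m X)^! = D *m (X *m J *m X^!) *m D^!.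
  by rewrite (adjmx_mul theta) !mulmxA.
rewrite eX /D tr_block_mx map_block_mx !mulmx_block.
rewrite !(trmx0, map_mx0, trmx1, map_mx1, mul0mx, mulmx0, mulmx1, mul1mx,
    addr0, add0r) eP.
by rewrite -scalar_mx_block.
Qed.

End Hermitian.

(** * Row spaces and frames *)

Section RowSpaces.

Variables (F : finFieldType) (d : nat).
Local Notation V := 'rV[F]_d.

Definition rowv (k : nat) (Y : 'M[F]_(k, d)) : {vspace V} :=
  limg (linfun (mulmxr Y : 'rV[F]_k -> V)).

Lemma mem_rowv (k : nat) (Y : 'M[F]_(k, d)) (u : V) :
  (u \in rowv Y) = (u <= Y)%MS.
Proof.
apply/memv_imgP/submxP => [[c _ ->]|[c ->]]; exists c; rewrite ?memvf //;
  by rewrite lfunE.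
Qed.

Lemma rowvP (k : nat) (Y : 'M[F]_(k, d)) (u : V) :
  reflect (exists c, u = c *m Y) (u \in rowv Y).
Proof. by rewrite mem_rowv; apply: submxP. Qed.

Lemma dim_rowv (k : nat) (Y : 'M[F]_(k, d)) : row_free Y -> \dim (rowv Y) = k.
Proof.
move=> fY; rewrite limg_dim_eq ?dimvf ?mul1n //=; first by rewrite /dim /= mul1n.
apply/eqP; rewrite capfv -subv0; apply/subvP => c; rewrite memv_ker lfunE /= memv0.
by rewrite mulmx_free_eq0.
Qed.

Lemma rowv_mulmx_sub (k l : nat) (P : 'M[F]_(k, l)) (Y : 'M[F]_(l, d)) :
  (rowv (P *m Y) <= rowv Y)%VS.
Proof. by apply/subvP => u /rowvP[c ->]; apply/rowvP; exists (c *m P); rewrite mulmxA. Qed.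

Lemma rowv_unit (k : nat) (P : 'M[F]_k) (Y : 'M[F]_(k, d)) :
  P \in unitmx -> rowv (P *m Y) = rowv Y.
Proof.
move=> uP; apply/eqP; rewrite eqEsubv rowv_mulmx_sub /=.
by rewrite -{1}(mulKmx uP Y) rowv_mulmx_sub.
Qed.

Lemma rowv_subP (k l : nat) (Y : 'M[F]_(k, d)) (Z : 'M[F]_(l, d)) :
  reflect (exists P, Y = P *m Z) (rowv Y <= rowv Z)%VS.
Proof.
apply: (iffP idP) => [/subvP h|[P ->]]; last exact: rowv_mulmx_sub.
apply/submxP/row_subP => i; rewrite -mem_rowv; apply: h.
by rewrite mem_rowv row_sub.
Qed.

Lemma rowv_eqP (k : nat) (Y Z : 'M[F]_(k, d)) :
  row_free Y -> rowv Y = rowv Z -> exists2 P, P \in unitmx & Y = P *m Z.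
Proof.
move=> fY eYZ.
have /rowv_subP[P eP] : (rowv Y <= rowv Z)%VS by rewrite eYZ.
exists P => //; rewrite -row_free_unit -kermx_eq0.
apply/rowV0P => c /sub_kermxP cP; apply/eqP; rewrite -(mulmx_free_eq0 c fY).
by rewrite eP mulmxA cP mul0mx.
Qed.

Lemma exists_rowv (k : nat) (W : {vspace V}) :
  \dim W = k -> exists2 Y : 'M[F]_(k, d), row_free Y & rowv Y = W.
Proof.
move=> dW; pose Y : 'M[F]_(k, d) := \matrix_i (vbasis W)`_i.
have YE c : c *m Y = \sum_(i < k) c 0 i *: (vbasis W)`_i.
  by rewrite mulmx_sum_row; apply: eq_bigr => i _; rewrite rowK.
have eY : rowv Y = W.
  apply/vspaceP => u; apply/rowvP/idP => [[c ->]|uW].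
    rewrite YE memv_suml // => i _; rewrite memvZ // vbasis_mem // mem_nth //.
    by rewrite size_tuple dW.
  have := coord_vbasis uW => ->.
  exists (\row_i coord (vbasis W) (cast_ord (esym dW) i) u); rewrite YE.
  rewrite (reindex (cast_ord (esym dW))) /=; last first.
    exists (cast_ord dW) => i _; first by rewrite cast_ordKV.
    by rewrite cast_ordK.
  by apply: eq_bigr => i _; rewrite mxE.
exists Y => //; rewrite -kermx_eq0; apply/rowV0P => c /sub_kermxP.
rewrite YE => h; apply/rowP => i; rewrite mxE.
have /freeP fW := basis_free (vbasisP W).
have := fW (fun j => c 0 (cast_ord dW j)) _ (cast_ord (esym dW) i).
rewrite cast_ordKV; apply.
rewrite -[RHS]h [RHS](reindex (cast_ord dW)) //=.
exists (cast_ord (esym dW)) => j _; first by rewrite cast_ordK.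
by rewrite cast_ordKV.
Qed.

Lemma card_row_bases (k : nat) (W : {vspace V}) :
  \dim W = k ->
  #|[set Y : 'M[F]_(k, d) | row_free Y && (rowv Y == W)]| =
  #|[set P : 'M[F]_k | P \in unitmx]|.
Proof.
move=> dW; have [Z fZ eZ] := exists_rowv dW.
rewrite -(card_imset _ (row_free_inj fZ)); apply: eq_card => Y; rewrite !inE.
apply/andP/imsetP => [[fY /eqP eY]|[P + ->]].
  have [P uP ->] : exists2 P, P \in unitmx & Y = P *m Z.
    by apply: rowv_eqP; rewrite // eY eZ.
  by exists P; rewrite ?inE.
rewrite inE => uP; rewrite rowv_unit // eZ eqxx; split => //.
by rewrite /row_free mxrankMfree // mxrank_unit.
Qed.

(** Every k-space has |GL_k| bases. This translates counts of subspaces into counts of matrices. *)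
Lemma card_frames (k : nat) (D : {set {vspace V}}) :
  (forall W, W \in D -> \dim W = k) ->
  #|[set Y : 'M[F]_(k, d) | row_free Y && (rowv Y \in D)]| =
  (#|D| * #|[set P : 'M[F]_k | P \in unitmx]|)%N.
Proof.
move=> hD; rewrite -sum1_card (partition_big (@rowv k) (mem D)) => [|Y]; last first.
  by rewrite inE => /andP[].
rewrite -sum_nat_const; apply: eq_bigr => W WD'; have WD : W \in D := WD'.
rewrite -(card_row_bases (hD W WD)) -sum1_card; apply: eq_bigl => Y.
by rewrite !inE; case: eqVneq => [->|]; rewrite ?andbF //= WD !andbT.
Qed.

Lemma rowv_col_mx (k l : nat) (Y : 'M[F]_(k, d)) (Z : 'M[F]_(l, d)) :
  rowv (col_mx Y Z) = (rowv Y + rowv Z)%VS.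
Proof.
apply/vspaceP => u; apply/rowvP/memv_addP => [[c ->]|[y /rowvP[a ->] [z /rowvP[b ->] ->]]].
  exists (lsubmx c *m Y); first by apply/rowvP; exists (lsubmx c).
  exists (rsubmx c *m Z); first by apply/rowvP; exists (rsubmx c).
  by rewrite -mul_row_col hsubmxK.
by exists (row_mx a b); rewrite mul_row_col.
Qed.

Lemma rowv_cap0 (k l : nat) (Y : 'M[F]_(k, d)) (Z : 'M[F]_(l, d)) :
  row_free (col_mx Y Z) -> (rowv Y :&: rowv Z = 0)%VS.
Proof.
move=> fYZ; apply/eqP; rewrite -subv0; apply/subvP => u; rewrite memv_cap memv0.
move=> /andP[/rowvP[a ->] /rowvP[b eab]].
have : row_mx a (- b) *m col_mx Y Z == 0.
  by rewrite mul_row_col mulNmx eab subrr.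
rewrite mulmx_free_eq0 // -row_mx0 => /eqP/eq_row_mx[-> _].
by rewrite mul0mx.
Qed.

End RowSpaces.

Section FormMatrix.

Variables (F : finFieldType) (n : nat) (eps : bool) (theta : {rmorphism F -> F}).
Local Notation d := n.+1.
Local Notation V := 'rV[F]_d.
Variable B : {hermitian V for eps & theta}.

Local Notation "A ^!" := (map_mx theta A^T).

Definition formmx : 'M[F]_d := \matrix_(i, j) B (delta_mx 0 i) (delta_mx 0 j).

Lemma formmxE (u v : V) : B u v = (u *m formmx *m v^!) 0 0.
Proof.
rewrite {1}(row_sum_delta u) linear_sumlz mxE.
under [RHS]eq_bigr => j _ do rewrite mxE mulr_suml.
rewrite exchange_big /=; apply: eq_bigr => i _.
rewrite {1}(row_sum_delta v) linear_sumr; apply: eq_bigr => j _.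
by rewrite linearZl_LR linearZr_LR /= !mxE mulrA mulrAC.
Qed.

Lemma formmx_adj : formmx^! = (-1) ^+ eps *: formmx.
Proof.
apply/matrixP => i j; rewrite !mxE [in RHS]hermC mulrA -expr2 sqrr_sign.
by rewrite mul1r.
Qed.

Lemma form_rows (k l : nat) (Y : 'M[F]_(k, d)) (Z : 'M[F]_(l, d)) c c' :
  B (c *m Y) (c' *m Z) = (c *m (Y *m formmx *m Z^!) *m c'^!) 0 0.
Proof. by rewrite formmxE adjmx_mul !mulmxA. Qed.

Lemma mx_form_eq0 (k : nat) (c : 'rV[F]_k) :
  (forall c' : 'rV[F]_k, (c *m c'^!) 0 0 = 0) -> c = 0.
Proof.
move=> h; apply/rowP => i; have := h (delta_mx 0 i).
by rewrite trmx_delta map_delta_mx -colE !mxE.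
Qed.

Lemma mem_orthov_rowv (k : nat) (Y : 'M[F]_(k, d)) (u : V) :
  (u \in orthov B (rowv Y)) = (u *m formmx *m Y^! == 0).
Proof.
apply/mem_orthovP/eqP => [h|h v /rowvP[c ->]]; last first.
  by rewrite formmxE adjmx_mul mulmxA h mul0mx mxE.
apply: mx_form_eq0 => c; have /h : c *m Y \in rowv Y by apply/rowvP; exists c.
by rewrite formmxE adjmx_mul mulmxA.
Qed.

Lemma nondegenerate_rowv (k : nat) (Y : 'M[F]_(k, d)) :
  row_free Y ->
  nondegenerate_subspace B (rowv Y) = (Y *m formmx *m Y^! \in unitmx).
Proof.
move=> fY; rewrite /nondegenerate_subspace -row_free_unit -kermx_eq0.
apply/eqP/eqP => [h|/eqP h].
  apply/eqP/rowV0P => c /sub_kermxP hc; apply/eqP.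
  rewrite -(mulmx_free_eq0 c fY) -memv0 -h memv_cap; apply/andP; split.
    by apply/rowvP; exists c.
  by rewrite mem_orthov_rowv -hc !mulmxA.
apply/eqP; rewrite -subv0; apply/subvP => u; rewrite memv_cap memv0.
move=> /andP[/rowvP[c ->]]; rewrite mem_orthov_rowv => /eqP hc.
have /rowV0P/(_ c)-> := h; first by rewrite mul0mx.
by apply/sub_kermxP; rewrite -hc !mulmxA.
Qed.

Lemma gram_unit_free (k : nat) (Y : 'M[F]_(k, d)) :
  Y *m formmx *m Y^! \in unitmx -> row_free Y.
Proof.
move=> uY; apply/row_freeP; exists (formmx *m Y^! *m invmx (Y *m formmx *m Y^!)).
by rewrite !mulmxA mulmxV.
Qed.

Lemma nondegenerate_formmx : nondegenerate B -> formmx \in unitmx.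
Proof.
move=> nB; have f1 : row_free (1%:M : 'M[F]_d) by rewrite row_free_unit unitmx1.
have := nondegenerate_rowv f1; rewrite trmx1 map_mx1 mul1mx mulmx1 => <-.
have -> : rowv (1%:M : 'M[F]_d) = fullv.
  by apply/vspaceP => u; rewrite memvf; apply/rowvP; exists u; rewrite mulmx1.
by rewrite /nondegenerate_subspace capfv.
Qed.

End FormMatrix.

(** * Duos spanned by graphs *)

Section Duos.

Variables (F : finFieldType) (n : nat) (eps : bool) (theta : {rmorphism F -> F}).
Local Notation d := n.+1.
Hypothesis thetaK : involutive theta.
Local Notation V := 'rV[F]_d.
Variable B : {hermitian V for eps & theta}.
Hypothesis nB : nondegenerate B.

Local Notation "A ^!" := (map_mx theta A^T).
Local Notation M := (formmx B).

Lemma exists_orthogonal_complement (e m : nat) (A : 'M[F]_(e, d)) :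
  (e + m)%N = d -> A *m M *m A^! \in unitmx ->
  exists C : 'M[F]_(m, d),
    [/\ row_free (col_mx A C), row_full (col_mx A C),
        C *m M *m A^! = 0, A *m M *m C^! = 0 & C *m M *m C^! \in unitmx].
Proof.
move=> ed; have uM := nondegenerate_formmx nB; move: (formmx_adj B) uM.
move: M A; case: n.+1 / ed => J A hJ uJ uA.
have [|C [uX CA AC]] := exists_orthogonal_completion thetaK _ hJ uA.
  by rewrite signr_eq0.
exists C; split => //; rewrite ?row_free_unit ?row_full_unit //.
have : col_mx A C *m J *m (col_mx A C)^! \in unitmx.
  by rewrite !unitmx_mul uX uJ (adjmx_unit theta).
by rewrite (gram_col_mx CA AC) unitmxE det_ublock unitrM => /andP[].
Qed.

Section Graph.

Variables (e m : nat) (A : 'M[F]_(e, d)) (C : 'M[F]_(m, d)).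
Hypothesis CA : C *m M *m A^! = 0.
Hypothesis AC : A *m M *m C^! = 0.

Definition graph_mx (p : 'M[F]_e * 'M[F]_(e, m)) := p.1 *m A + p.2 *m C.

Lemma gram_graph p :
  graph_mx p *m M *m (graph_mx p)^! =
  p.1 *m (A *m M *m A^!) *m p.1^! + p.2 *m (C *m M *m C^!) *m p.2^!.
Proof.
have -> : graph_mx p = row_mx p.1 p.2 *m col_mx A C by rewrite mul_row_col.
have assoc (r : 'M[F]_(e, e + m)) (X : 'M[F]_(e + m, d)) :
    r *m X *m M *m (r *m X)^! = r *m (X *m M *m X^!) *m r^!.
  by rewrite adjmx_mul !mulmxA.
rewrite assoc (gram_col_mx CA AC) tr_row_mx map_col_mx.
by rewrite mul_row_block !mulmx0 addr0 add0r mul_row_col.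
Qed.

(** Modulo the rows of A, the matrix a A + b C is b C. So the two spaces together are spanned by A
    and b C, which are perpendicular, and the Gram matrix of the sum is block diagonal. *)
Lemma duo_graph p :
  A *m M *m A^! \in unitmx -> p.2 *m (C *m M *m C^!) *m p.2^! \in unitmx ->
  is_duo B (rowv A, rowv (graph_mx p)).
Proof.
move=> uA ub; pose Y := col_mx A (p.2 *m C).
have gY : Y *m M *m Y^! =
    block_mx (A *m M *m A^!) 0 0 (p.2 *m (C *m M *m C^!) *m p.2^!).
  rewrite /Y gram_col_mx.
  - by rewrite (adjmx_mul theta) !mulmxA.
  - by rewrite -!mulmxA [C *m _]mulmxA CA mulmx0.
  - by rewrite (adjmx_mul theta) mulmxA AC mul0mx.
have uY : Y *m M *m Y^! \in unitmx by rewrite gY unitmxE det_ublock unitrM -!unitmxE uA.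
have eY : col_mx A (graph_mx p) = block_mx 1%:M 0 p.1 1%:M *m Y.
  by rewrite mul_block_col !mul1mx mul0mx addr0.
have uT : block_mx 1%:M 0 p.1 (1%:M : 'M[F]_e) \in unitmx.
  by rewrite unitmxE det_lblock !det1 mulr1 unitr1.
have fY : row_free (col_mx A (graph_mx p)).
  by rewrite eY /row_free eqmxMfull ?row_full_unit // (eqP (gram_unit_free uY)).
rewrite /is_duo /= rowv_cap0 // eqxx /= -rowv_col_mx nondegenerate_rowv // eY.
have assoc T : T *m Y *m M *m (T *m Y)^! = T *m (Y *m M *m Y^!) *m T^!.
  by rewrite adjmx_mul !mulmxA.
by rewrite assoc !unitmx_mul uT uY (adjmx_unit theta) uT.
Qed.

Lemma graph_mx_inj : row_free (col_mx A C) -> injective graph_mx.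
Proof.
move=> fX [a b] [a' b']; rewrite /graph_mx /= -!mul_row_col.
by move/(row_free_inj fX)/eq_row_mx => [-> ->].
Qed.

End Graph.

(* Each frame [a A + b C] spans the graph of a map from a subspace of the    *)
(* perpendicular space of [rowv A] into [rowv A].                            *)
Lemma duo_proportion_graph (e m : nat) (A : 'M[F]_(e, d)) (C : 'M[F]_(m, d))
    (calU : {set {vspace V}}) (good : nat) :
  (e + m)%N = d ->
  row_free (col_mx A C) -> C *m M *m A^! = 0 -> A *m M *m C^! = 0 ->
  A *m M *m A^! \in unitmx ->
  (forall W, W \in calU = (\dim W == e) && nondegenerate_subspace B W) ->
  (good <= #|[set p : 'M[F]_e * 'M[F]_(e, m) |
     ((p.2 *m (C *m M *m C^!) *m p.2^!)%R \in unitmx) &&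
     ((p.1 *m (A *m M *m A^!) *m p.1^! +
       p.2 *m (C *m M *m C^!) *m p.2^!)%R \in unitmx)]|)%N ->
  (#|F| ^ (e * d) * #|[set W in calU | is_duo B (rowv A, W)]| >= good * #|calU|)%N.
Proof.
move=> ed fX CA AC uA hU hgood; set D := [set W in calU | _].
have dimU W : W \in calU -> \dim W = e by rewrite hU => /andP[/eqP].
have dimD W : W \in D -> \dim W = e by rewrite inE => /andP[/dimU].
have u0 : (0 < #|[set P : 'M[F]_e | P \in unitmx]|)%N.
  by apply/card_gt0P; exists 1%:M; rewrite inE unitmx1.
(* The frames of members of [calU] are some of the e by d matrices, while the good pairs inject into
   the frames of duo partners; the factor |GL_e| cancels in the quotient. *)
have h1 : (#|calU| * #|[set P : 'M[F]_e | P \in unitmx]| <= #|F| ^ (e * d))%N.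
  by rewrite -card_frames // -card_mx max_card.
have h2 : (good <= #|D| * #|[set P : 'M[F]_e | P \in unitmx]|)%N.
  rewrite -card_frames //; apply: leq_trans hgood _.
  rewrite -(card_imset _ (graph_mx_inj fX)).
  apply/subset_leq_card/subsetP => _ /imsetP[p + ->].
  rewrite !inE => /andP[ub ug]; rewrite -(gram_graph CA AC) in ug.
  have fg := gram_unit_free ug.
  by rewrite fg /= hU dim_rowv // eqxx nondegenerate_rowv // ug duo_graph.
rewrite -(leq_pmul2r u0); apply: (@leq_trans (good * #|F| ^ (e * d))).
  by rewrite -mulnA leq_mul2l h1 orbT.
by rewrite mulnC -mulnA leq_mul2l h2 orbT.
Qed.

End Duos.

(** * Transitivity on non-degenerate subspaces *)

Section Transport.

Variables (F : finFieldType) (theta : {rmorphism F -> F}).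
Hypothesis thetaK : involutive theta.

Local Notation "A ^!" := (map_mx theta A^T).

Lemma transporter_isometry (d : nat) (J X Y : 'M[F]_d) :
  X \in unitmx -> X *m J *m X^! = Y *m J *m Y^! ->
  (invmx X *m Y) *m J *m (invmx X *m Y)^! = J.
Proof.
move=> uX eXY.
have -> : (invmx X *m Y) *m J *m (invmx X *m Y)^! =
    invmx X *m (Y *m J *m Y^!) *m (invmx X)^!.
  by rewrite (adjmx_mul theta) !mulmxA.
rewrite -eXY !mulmxA mulVmx // mul1mx -mulmxA -(adjmx_mul theta) mulVmx //.
by rewrite (adjmx1 theta) mulmx1.
Qed.

Lemma gram_mulmx (k d : nat) (J : 'M[F]_d) (P : 'M[F]_k) (A : 'M[F]_(k, d)) :
  (P *m A) *m J *m (P *m A)^! = P *m (A *m J *m A^!) *m P^!.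
Proof. by rewrite (adjmx_mul theta) !mulmxA. Qed.

Lemma gram_complement_unit (e m : nat) (J : 'M[F]_(e + m))
    (A : 'M[F]_(e, e + m)) (C : 'M[F]_(m, e + m)) :
  J \in unitmx -> col_mx A C \in unitmx ->
  C *m J *m A^! = 0 -> A *m J *m C^! = 0 -> C *m J *m C^! \in unitmx.
Proof.
move=> uJ uX CA AC; have : col_mx A C *m J *m (col_mx A C)^! \in unitmx.
  by rewrite !unitmx_mul uX uJ (adjmx_unit theta).
by rewrite (gram_col_mx CA AC) unitmxE det_ublock unitrM => /andP[].
Qed.

Lemma block_diag_unit (e m : nat) (P : 'M[F]_e) (R : 'M[F]_m) :
  (block_mx P 0 0 R \in unitmx) = (P \in unitmx) && (R \in unitmx).
Proof. by rewrite unitmxE det_ublock unitrM -!unitmxE. Qed.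

(** Witt's theorem in coordinates: the two spaces are congruent, and so are their perpendicular
    spaces, because non-degenerate alternating forms of equal size are. The two congruences together
    define h. *)
Lemma alternating_transport (e m : nat) (J : 'M[F]_(e + m))
    (A A' : 'M[F]_(e, e + m)) :
  theta =1 id -> alternating theta J -> J \in unitmx ->
  A *m J *m A^! \in unitmx -> A' *m J *m A'^! \in unitmx ->
  exists h P, [/\ h \in unitmx, h *m J *m h^! = J, P \in unitmx & A *m h = P *m A'].
Proof.
move=> thetaE aJ uJ uA uA'; have hJ := alternating_adj thetaE aJ.
have s0 : (-1 : F) != 0 by rewrite oppr_eq0 oner_eq0.
have [C [uX CA AC]] := exists_orthogonal_completion thetaK s0 hJ uA.
have [C' [uX' CA' AC']] := exists_orthogonal_completion thetaK s0 hJ uA'.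
have [P uP eP] := alternating_congruent thetaE (alternating_congr A aJ)
  (alternating_congr A' aJ) uA uA'.
have [R uR eR] := alternating_congruent thetaE (alternating_congr C aJ)
  (alternating_congr C' aJ) (gram_complement_unit uJ uX CA AC)
  (gram_complement_unit uJ uX' CA' AC').
pose D := block_mx P 0 0 R; pose X := D *m col_mx A C; pose Y := col_mx A' C'.
have uD : D \in unitmx by rewrite block_diag_unit uP uR.
have uDX : X \in unitmx by rewrite unitmx_mul uD uX.
have eXY : X *m J *m X^! = Y *m J *m Y^!.
  rewrite gram_mulmx (gram_col_mx CA AC) (gram_col_mx CA' AC') -eP -eR.
  rewrite /D tr_block_mx map_block_mx !mulmx_block.
  by rewrite !(trmx0, map_mx0, mul0mx, mulmx0, addr0, add0r).
exists (invmx X *m Y), (invmx P); split.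
- by rewrite unitmx_mul unitmx_inv uDX uX'.
- exact: transporter_isometry.
- by rewrite unitmx_inv.
have eX : X = col_mx (P *m A) (R *m C).
  by rewrite /X mul_block_col !mul0mx addr0 add0r.
have := mulKVmx uDX Y; rewrite {1}eX mul_col_mx => /eq_col_mx[h _].
by rewrite -h -(mulmxA P) mulKmx.
Qed.

End Transport.

Section HermitianTransport.

Variables (F : finFieldType) (theta : {rmorphism F -> F}) (q : nat).
Hypothesis cardF : #|F| = (q ^ 2)%N.
Hypothesis thetaE : forall x, theta x = x ^+ q.
Let thetaK := hermitian_thetaK cardF thetaE.

Local Notation "A ^!" := (map_mx theta A^T).

Lemma isometry_with_det (e : nat) (t : F) :
  t * theta t = 1 ->
  exists D : 'M[F]_e.+1, D *m D^! = 1%:M /\ \det D = t.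
Proof.
move=> ht; pose r : 'rV[F]_e.+1 := \row_i (if i == 0 then t else 1).
exists (diag_mx r); split; last first.
  rewrite det_diag big_ord_recl big1 => [|i _]; rewrite !mxE //=.
  by rewrite mulr1.
rewrite tr_diag_mx map_diag_mx mulmx_diag -diag_const_mx; congr diag_mx.
apply/rowP => i; rewrite !mxE; case: ifP => _ //.
by rewrite rmorph1 mulr1.
Qed.

(* The frames are normalised to orthonormal ones; the determinant is then    *)
(* corrected by a diagonal isometry of the first block.                      *)
Lemma hermitian_transport (e m : nat) (J : 'M[F]_(e.+1 + m))
    (A A' : 'M[F]_(e.+1, e.+1 + m)) :
  J^! = J -> J \in unitmx ->
  A *m J *m A^! \in unitmx -> A' *m J *m A'^! \in unitmx ->
  exists h P, [/\ h \in unitmx, h *m J *m h^! = J, \det h = 1,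
     P \in unitmx & A *m h = P *m A'].
Proof.
move=> hJ uJ uA uA'.
have hJ1 : J^! = 1 *: J by rewrite scale1r.
have [C [uX CA AC]] := exists_orthogonal_completion thetaK (oner_neq0 F) hJ1 uA.
have [C' [uX' CA' AC']] := exists_orthogonal_completion thetaK (oner_neq0 F) hJ1 uA'.
have hadj k (K : 'M[F]_(k, _)) := hermitian_congr_adj cardF thetaE K hJ.
have normal k (K : 'M[F]_k) := @hermitian_orthonormal _ _ _ cardF thetaE k K.
have [P1 uP1 eP1] := normal _ _ (hadj _ A) uA.
have [P2 uP2 eP2] := normal _ _ (hadj _ C) (gram_complement_unit uJ uX CA AC).
have [R1 uR1 eR1] := normal _ _ (hadj _ A') uA'.
have [R2 uR2 eR2] := normal _ _ (hadj _ C') (gram_complement_unit uJ uX' CA' AC').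
have gram1 K K' (S1 : 'M[F]_e.+1) (S2 : 'M[F]_m) :
    K' *m J *m K^! = 0 -> K *m J *m K'^! = 0 ->
    S1 *m (K *m J *m K^!) *m S1^! = 1%:M -> S2 *m (K' *m J *m K'^!) *m S2^! = 1%:M ->
    block_mx S1 0 0 S2 *m col_mx K K' *m J *m (block_mx S1 0 0 S2 *m col_mx K K')^! = 1%:M.
  move=> K'K KK' h1 h2; rewrite gram_mulmx (gram_col_mx K'K KK').
  rewrite tr_block_mx map_block_mx !mulmx_block.
  by rewrite !(trmx0, map_mx0, mul0mx, mulmx0, addr0, add0r) h1 h2 -scalar_mx_block.
pose X := block_mx P1 0 0 P2 *m col_mx A C.
pose Y := block_mx R1 0 0 R2 *m col_mx A' C'.
have gX : X *m J *m X^! = 1%:M by apply: gram1.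
have gY : Y *m J *m Y^! = 1%:M by apply: gram1.
have uXX : X \in unitmx by rewrite unitmx_mul block_diag_unit uP1 uP2 uX.
have uYY : Y \in unitmx by rewrite unitmx_mul block_diag_unit uR1 uR2 uX'.
pose t := \det X / \det Y.
have dX0 : \det X != 0 by rewrite -unitfE -unitmxE.
have dY0 : \det Y != 0 by rewrite -unitfE -unitmxE.
have dJ0 : \det J != 0 by rewrite -unitfE -unitmxE.
(* Both determinants have norm 1 / det J, so their quotient t has norm 1 and is the determinant of a
   diagonal isometry. *)
have ht : t * theta t = 1.
  have detg Z : Z *m J *m Z^! = 1%:M -> \det Z * theta (\det Z) = (\det J)^-1.
    move=> gZ; apply: (mulfI dJ0); rewrite divff // -[RHS](det1 F (e.+1 + m)) -gZ.
    by rewrite !det_mulmx det_map_mx det_tr; ring.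
  rewrite /t rmorphM fmorphV mulrACA -invfM (detg X gX) (detg Y gY).
  by rewrite divff // invr_neq0.
have [D [gD dD]] := isometry_with_det e ht.
have uD : D \in unitmx by case: (mulmx1_unit gD).
pose E : 'M[F]_(e.+1 + m) := block_mx D 0 0 1%:M.
have gEY : (E *m Y) *m J *m (E *m Y)^! = 1%:M.
  rewrite gram_mulmx gY mulmx1 /E tr_block_mx map_block_mx mulmx_block.
  rewrite !(trmx0, map_mx0, trmx1, map_mx1, mul0mx, mulmx0, mulmx1, addr0, add0r) gD.
  by rewrite -scalar_mx_block.
exists (invmx X *m (E *m Y)), (invmx P1 *m D *m R1); split.
- by rewrite unitmx_mul unitmx_inv uXX unitmx_mul uYY block_diag_unit uD unitmx1.
- by apply: transporter_isometry; rewrite // gX gEY.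
- rewrite det_mulmx det_inv [X in _ * X]det_mulmx /E det_ublock det1 mulr1 dD /t.
  by field; rewrite dX0 dY0.
- by rewrite !unitmx_mul unitmx_inv uP1 uD uR1.
have eX : X = col_mx (P1 *m A) (P2 *m C).
  by rewrite /X mul_block_col !mul0mx addr0 add0r.
have eY : E *m Y = col_mx (D *m (R1 *m A')) (R2 *m C').
  by rewrite /Y /E !mul_block_col !mul0mx !addr0 !add0r mul1mx.
have := mulKVmx uXX (E *m Y); rewrite {1}eX {2}eY mul_col_mx => /eq_col_mx[h _].
by rewrite -!mulmxA -h -(mulmxA P1) mulKmx.
Qed.

End HermitianTransport.

Section Orbits.

Variables (F : finFieldType) (n : nat) (eps : bool) (theta : {rmorphism F -> F}).
Local Notation d := n.+1.
Local Notation V := 'rV[F]_d.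
Local Notation GL := {'GL_d[F]}.
Variable B : {hermitian V for eps & theta}.

Local Notation "A ^!" := (map_mx theta A^T).
Local Notation M := (formmx B).

Lemma imagevP (W : {vspace V}) (h : GL) (u : V) :
  reflect (exists2 w, w \in W & u = w *m GLval h) (u \in imagev W h).
Proof.
by apply: (iffP memv_imgP) => -[w wW ->]; exists w => //; rewrite lfunE.
Qed.

Lemma imagev_rowv (k : nat) (Y : 'M[F]_(k, d)) (h : GL) :
  imagev (rowv Y) h = rowv (Y *m GLval h).
Proof.
apply/vspaceP => u; apply/imagevP/rowvP => [[_ /rowvP[c ->] ->]|[c ->]].
  by exists c; rewrite mulmxA.
by exists (c *m Y); rewrite ?mulmxA //; apply/rowvP; exists c.
Qed.

Lemma form_isometriesP (h : GL) :
  reflect (forall u v, B (u *m GLval h) (v *m GLval h) = B u v)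
    (h \in form_isometries B).
Proof.
rewrite inE; apply: (iffP forallP) => [hB u v|hB u].
  by have /forallP/(_ v)/eqP := hB u.
by apply/forallP => v; rewrite hB.
Qed.

Lemma form_isometries_mx (h : GL) :
  GLval h *m M *m (GLval h)^! = M -> h \in form_isometries B.
Proof.
move=> hM; apply/form_isometriesP => u v; rewrite form_rows hM.
by rewrite -formmxE.
Qed.

Lemma dim_imagev (W : {vspace V}) (h : GL) : \dim (imagev W h) = \dim W.
Proof.
have [Y fY <-] := exists_rowv (erefl (\dim W)).
rewrite imagev_rowv !dim_rowv // /row_free mxrankMfree // row_free_unit.
exact: (valP h).
Qed.

Lemma imagevD (U W : {vspace V}) (h : GL) :
  imagev (U + W)%VS h = (imagev U h + imagev W h)%VS.
Proof. exact: limgD. Qed.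

Lemma imagev_eq0 (W : {vspace V}) (h : GL) : (imagev W h == 0)%VS = (W == 0)%VS.
Proof. by rewrite -!dimv_eq0 dim_imagev. Qed.

Lemma imagev_cap_eq0 (U W : {vspace V}) (h : GL) :
  (imagev U h :&: imagev W h == 0)%VS = (U :&: W == 0)%VS.
Proof.
rewrite -(imagev_eq0 (U :&: W) h); congr (_ == _); apply/vspaceP => u.
rewrite memv_cap; apply/andP/imagevP => [[/imagevP[w wU ->] /imagevP[w' w'W e]]|].
  exists w => //; rewrite memv_cap wU.
  suff -> : w = w' by [].
  by apply: (row_free_inj (_ : row_free (GLval h))) e; rewrite row_free_unit (valP h).
by move=> [w]; rewrite memv_cap => /andP[wU wW] ->; split; apply/imagevP; exists w.
Qed.

Lemma orthov_imagev (W : {vspace V}) (h : GL) :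
  h \in form_isometries B -> orthov B (imagev W h) = imagev (orthov B W) h.
Proof.
move=> /form_isometriesP hB; apply/vspaceP => u.
apply/mem_orthovP/imagevP => [hu|[w /mem_orthovP hw ->] _ /imagevP[v vW ->]].
  exists (u *m invmx (GLval h)); last by rewrite mulmxKV // (valP h).
  apply/mem_orthovP => v vW; rewrite -hB mulmxKV ?(valP h) //; apply: hu.
  by apply/imagevP; exists v.
by rewrite hB; apply: hw.
Qed.

Lemma nondegenerate_imagev (W : {vspace V}) (h : GL) :
  h \in form_isometries B ->
  nondegenerate_subspace B (imagev W h) = nondegenerate_subspace B W.
Proof.
by move=> hB; rewrite /nondegenerate_subspace orthov_imagev // imagev_cap_eq0.
Qed.

Lemma is_duo_imagev (U W : {vspace V}) (h : GL) :
  h \in form_isometries B -> is_duo B (imagev U h, imagev W h) = is_duo B (U, W).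
Proof.
by move=> hB; rewrite /is_duo /= imagev_cap_eq0 -imagevD nondegenerate_imagev.
Qed.

(** Isometries preserve dimension and non-degeneracy; conversely it is enough to move frames to one
    another up to a base change P. *)
Lemma transitive_orbit (G : {group GL}) (e : nat) (calU : {set {vspace V}}) :
  G \subset form_isometries B ->
  (forall A A' : 'M[F]_(e, d), A *m M *m A^! \in unitmx -> A' *m M *m A'^! \in unitmx ->
     exists h P, [/\ h \in G, P \in unitmx & A *m GLval h = P *m A']) ->
  calU \in nondegenerate_orbits B G e ->
  forall W, W \in calU = (\dim W == e) && nondegenerate_subspace B W.
Proof.
move=> sG trG /imsetP[W0]; rewrite inE => /andP[/eqP dW0 nW0] -> W.
apply/orbitP/andP => [[h hG <-]|[/eqP dW nW]].
  by rewrite /= dim_imagev dW0 eqxx nondegenerate_imagev // (subsetP sG).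
have [Y fY eY] := exists_rowv dW; have [Y0 fY0 eY0] := exists_rowv dW0.
have [||h [P [hG uP hP]]] := trG Y0 Y.
- by rewrite -nondegenerate_rowv // eY0.
- by rewrite -nondegenerate_rowv // eY.
by exists h; rewrite //= -eY0 imagev_rowv hP rowv_unit.
Qed.

Lemma orbit_symplectic (G : {group GL}) (e m : nat) (calU : {set {vspace V}}) :
  (e + m)%N = d -> nondegenerate B -> theta =1 id -> alternating theta M ->
  G :=: form_isometries B -> calU \in nondegenerate_orbits B G e ->
  forall W, W \in calU = (\dim W == e) && nondegenerate_subspace B W.
Proof.
move=> ed nB thetaE aM eG; apply: transitive_orbit; first by rewrite eG.
have uM := nondegenerate_formmx nB.
have thetaK : involutive theta by move=> x; rewrite !thetaE.
move=> A A' uA uA'.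
have [h [P [uh hM uP hP]]] : exists (h : 'M[F]_d) (P : 'M[F]_e),
   [/\ h \in unitmx, h *m M *m h^! = M, P \in unitmx & A *m h = P *m A'].
  move: M A A' aM uM uA uA'; case: n.+1 / ed => J A A' aJ uJ uA uA'.
  exact: alternating_transport.
by exists (Sub h uh), P; rewrite eG; split => //; apply: form_isometries_mx.
Qed.

Lemma orbit_unitary (q : nat) (G : {group GL}) (e m : nat) (calU : {set {vspace V}}) :
  (e.+1 + m)%N = d -> #|F| = (q ^ 2)%N -> (forall x, theta x = x ^+ q) ->
  nondegenerate B -> M^! = M ->
  special_isometries B \subset G -> G \subset form_isometries B ->
  calU \in nondegenerate_orbits B G e.+1 ->
  forall W, W \in calU = (\dim W == e.+1) && nondegenerate_subspace B W.
Proof.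
move=> ed cardF thetaE nB hM sG Gs; apply: transitive_orbit => //.
have uM := nondegenerate_formmx nB.
move=> A A' uA uA'.
have [h [P [uh hM' dh uP hP]]] : exists (h : 'M[F]_d) (P : 'M[F]_e.+1),
   [/\ h \in unitmx, h *m M *m h^! = M, \det h = 1, P \in unitmx & A *m h = P *m A'].
  move: M A A' hM uM uA uA'; case: n.+1 / ed => J A A' hJ uJ uA uA'.
  exact: (hermitian_transport cardF thetaE).
exists (Sub h uh), P; split => //; apply: (subsetP sG).
by rewrite inE form_isometries_mx //= dh eqxx.
Qed.

End Orbits.

(** * Unitary and symplectic frames *)

(** A proportion r' of all b satisfies P, and each of these admits a proportion r of all a. *)
Lemma card_pairs_ge (T T' : finType) (P : pred T') (R : T -> T' -> bool)
    (r r' : rat) :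
  0 <= r -> r' * #|T'|%:R <= #|[set b | P b]|%:R ->
  (forall b, P b -> r * #|T|%:R <= #|[set a | R a b]|%:R) ->
  (r * r') * (#|T| * #|T'|)%:R <= #|[set p : T * T' | P p.2 && R p.1 p.2]|%:R.
Proof.
move=> r0 hr' hr; rewrite (card_rel_sum (fun a b => P b && R a b)) card_rel_sum_sym.
rewrite natr_sum (bigID P) /=; apply: (@le_trans _ _ (\sum_(b | P b) r * #|T|%:R)).
  have -> : \sum_(b | P b) r * #|T|%:R = r * #|T|%:R * #|[set b | P b]|%:R.
    by rewrite sumr_const [RHS]mulr_natr; congr (_ *+ _); apply: eq_card => b; rewrite !inE.
  have -> : r * r' * (#|T| * #|T'|)%:R = r * #|T|%:R * (r' * #|T'|%:R) by rewrite natrM; ring.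
  by rewrite ler_wpM2l ?mulr_ge0.
rewrite -[leLHS]addr0 lerD ?sumr_ge0 //; apply: ler_sum => b Pb.
apply: le_trans (hr b Pb) _; rewrite ler_nat.
by apply/subset_leq_card/subsetP => a; rewrite !inE Pb.
Qed.

Lemma card_good_ge (T : finType) (P : pred T) (r : rat) :
  #|[set t | ~~ P t]|%:R <= r * #|T|%:R -> (1 - r) * #|T|%:R <= #|[set t | P t]|%:R.
Proof.
have -> : #|[set t | ~~ P t]| = #|~: [set t | P t]|.
  by apply: eq_card => t; rewrite !inE.
by rewrite -(cardsC [set t | P t]) natrD; lra.
Qed.

(** * Numeric bounds for the unitary and symplectic cases *)

Section NumericBounds.

Variable R : realFieldType.
Implicit Types c x s t : R.

Lemma cubic_bound_two c : 2%:R <= c -> c + 1 <= 3%:R / 4%:R * c ^+ 2.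
Proof.
by move=> c2; have : 0 <= (c - 2%:R) * (3%:R * c + 2%:R); [apply: mulr_ge0|]; lra.
Qed.

Lemma cubic_bound_three c : 3%:R <= c -> c + 1 <= 1 / 2%:R * c ^+ 2.
Proof.
by move=> c3; have : 0 <= (c - 3%:R) * (c + 1); [apply: mulr_ge0|]; lra.
Qed.

Lemma quadratic_bound_quarter x :
  0 <= x -> x <= 1 / 4%:R -> 11%:R / 16%:R <= 1 - x - x ^+ 2.
Proof.
move=> x0 x1.
by have : 0 <= (1 / 4%:R - x) * (x + 5%:R / 4%:R); [apply: mulr_ge0|]; lra.
Qed.

Lemma quadratic_bound_half x :
  0 <= x -> x <= 1 / 2%:R -> 1 / 6%:R <= 1 - x - x ^+ 2.
Proof.
move=> x0 x1.
by have : 0 <= (1 / 2%:R - x) * (x + 3%:R / 2%:R); [apply: mulr_ge0|]; lra.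
Qed.

Lemma alternating_gram_bound c :
  2%:R <= c -> 1 + c ^+ 2 <= 5%:R / 6%:R * (c * (c ^+ 2 - 1)).
Proof.
move=> c2.
have h : 0 <= (c - 2%:R) * (5%:R * c ^+ 2 + 4%:R * c + 3%:R).
  apply: mulr_ge0; first by lra.
  by have := sqr_ge0 c; lra.
by lra.
Qed.

(** In the [gram_bound] lemmas c stands for q, t for |F| to the dimension of U, x for 1 / t, and s
    for q to the dimension of the perpendicular space. The fraction on the right bounds the
    proportion of b with singular Gram matrix. Here q = 2 and U is a line. *)
Lemma gram_bound_line s :
  4%:R <= s ->
  (1 - 1 / 4%:R) * (4%:R + 2%:R * (s ^+ 2 + (2%:R - 1) * s) - 2%:R ^+ 2)
    <= 5%:R / 8%:R * ((2%:R ^+ 2 - 1) * s ^+ 2).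
Proof. by move=> s4; have : 0 <= (s - 4%:R) * s; [apply: mulr_ge0|]; lra. Qed.

Lemma gram_bound_two x s t :
  0 <= x -> x <= 1 -> 8%:R <= s -> 0 <= t -> t * 2%:R ^+ 2 <= s ^+ 2 ->
  (1 - x) * (t + 2%:R * (s ^+ 2 + (2%:R - 1) * s) - 2%:R ^+ 2)
    <= 13%:R / 16%:R * ((2%:R ^+ 2 - 1) * s ^+ 2).
Proof.
move=> x0 x1 s8 t0 ts.
have ss : 0 <= s ^+ 2 by rewrite sqr_ge0.
have h : 0 <= t + 2%:R * (s ^+ 2 + (2%:R - 1) * s) - 2%:R ^+ 2 by lra.
apply: (@le_trans _ _ (t + 2%:R * (s ^+ 2 + (2%:R - 1) * s) - 2%:R ^+ 2)).
  by apply: ler_piMl => //; lra.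
by have : 0 <= (s - 8%:R) * (3%:R * s - 8%:R); [apply: mulr_ge0|]; lra.
Qed.

Lemma sum_bound_two x :
  0 <= x -> x <= 1 / 16%:R ->
  2%:R * (1 - x) * (1 + 2%:R * x) <= 45%:R / 64%:R * (2%:R ^+ 2 - 1).
Proof.
move=> x0 x1.
by have : 0 <= (1 / 16%:R - x) * (1 - 2%:R * (x + 1 / 16%:R));
  [apply: mulr_ge0|]; lra.
Qed.

Lemma gram_bound_three c x s t :
  0 <= x -> x <= 1 -> 3%:R <= c -> c ^+ 2 <= s -> 0 <= t -> t * c ^+ 2 <= s ^+ 2 ->
  (1 - x) * (t + c * (s ^+ 2 + (c - 1) * s) - c ^+ 2)
    <= 1 / 2%:R * ((c ^+ 2 - 1) * s ^+ 2).
Proof.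
move=> x0 x1 c3 cs t0 ts.
have c0 : 0 < c by lra.
have c20 : 0 < c ^+ 2 by rewrite exprn_gt0.
have ss : 0 <= s ^+ 2 by rewrite sqr_ge0.
have s0 : 0 <= s by apply: le_trans cs; apply: ltW.
have s1 : c ^+ 2 * s <= s ^+ 2 by rewrite [s ^+ 2]expr2 ler_wpM2r.
have h0 : 0 <= c * ((c - 1) * s) - c ^+ 2.
  suff : c * c <= c * ((c - 1) * s) by rewrite expr2; lra.
  rewrite ler_wpM2l ?(ltW c0) //; apply: le_trans (_ : _ <= 1 * s) _; last first.
    by rewrite ler_wpM2r //; lra.
  rewrite mul1r; apply: le_trans cs; rewrite expr2 ler_peMr ?ltW //; lra.
have h1 : c * (c - 1) * (c ^+ 2 * s) <= c * (c - 1) * s ^+ 2.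
  by apply: ler_wpM2l => //; apply: mulr_ge0; lra.
apply: (@le_trans _ _ (t + c * (s ^+ 2 + (c - 1) * s) - c ^+ 2)).
  apply: ler_piMl; last by lra.
  by have : 0 <= c * s ^+ 2; [apply: mulr_ge0|]; lra.
rewrite -(ler_pM2r c20).
have h3 : 0 <= (c ^+ 4 - 2%:R * c ^+ 3 - 3%:R * c ^+ 2 + 2%:R * c - 2%:R) * s ^+ 2.
  rewrite mulr_ge0 //.
  have -> : c ^+ 4 - 2%:R * c ^+ 3 - 3%:R * c ^+ 2 + 2%:R * c - 2%:R =
    (c - 3%:R) * (c ^+ 2 * (c + 1) + 2%:R) + 4%:R by ring.
  apply: addr_ge0 => //; apply: mulr_ge0; first by lra.
  by apply: addr_ge0 => //; apply: mulr_ge0; [exact: ltW|lra].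
have h4 : 0 <= c ^+ 2 * c ^+ 2 by rewrite mulr_ge0 // ltW.
lra.
Qed.

End NumericBounds.

Lemma singular_ker (F : finFieldType) (n : nat) (J : 'M[F]_n) :
  J \notin unitmx -> (#|F| <= #|[set v : 'rV[F]_n | (v *m J == 0)%R]|)%N.
Proof.
move=> sJ; rewrite -{1}[#|F|]expn1; apply: card_ker_ge.
have : \rank J != n by rewrite -/(row_free J) row_free_unit.
by have := rank_leq_row J; lia.
Qed.

(* The order of GL_k divided by that of M_k over a field of order [1 / x]. *)
Definition gl_ratio (x : rat) (k : nat) : rat := \prod_(i < k) (1 - x ^+ i.+1).

Lemma card_unitmx_ratio (F : finFieldType) (k : nat) :
  #|[set P : 'M[F]_k | P \in unitmx]|%:R =
  #|F|%:R ^+ (k * k) * gl_ratio (#|F|%:R^-1) k :> rat.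
Proof.
have Q0 : #|F|%:R != 0 :> rat.
  by rewrite pnatr_eq0 -lt0n (ltn_trans _ (card_finNzRing_gt1 F)).
case: k => [|k].
  rewrite /gl_ratio big_ord0 mulr1 expr0 (eq_card (B := predT)) => [|P].
    by rewrite card_mx.
  by rewrite !inE (flatmx0 P) unitmxE det_mx00 unitr1.
rewrite card_GL_unitmx // natrM natrX big_add1 /= big_mkord natr_prod.
rewrite (eq_bigr (fun i : 'I_k.+1 =>
   #|F|%:R ^+ i.+1 * (1 - #|F|%:R^-1 ^+ i.+1))) => [|i _]; last first.
  rewrite natrB ?expn_gt0 ?(ltnW (card_finNzRing_gt1 _)) // natrX.
  by rewrite mulrBr mulr1 exprVn divff // expf_neq0.
rewrite big_split /= mulrA; congr (_ * _).
rewrite -expr_sum -exprD; congr (_ ^+ _).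
have -> : (\sum_(i < k.+1) i.+1 = 'C(k.+2, 2))%N.
  rewrite -bin2_sum big_mkord [RHS]big_ord_recl add0n.
  by apply: eq_bigr => i _.
rewrite !bin2 /=.
have h1 : (2 * (k.+1 * k)./2 = k.+1 * k)%N by rewrite mul2n even_halfK // oddM /=; case: (odd k).
have h2 : (2 * (k.+2 * k.+1)./2 = k.+2 * k.+1)%N by rewrite mul2n even_halfK // oddM /=; case: (odd k).
nia.
Qed.

(** These are the first terms of Euler's pentagonal number expansion. The induction carries the
    extra term x^(k+2), with equality for a single factor, because the bare bound does not survive
    multiplication by the next factor. *)
Lemma gl_ratio_ge (x : rat) (k : nat) :
  0 <= x -> x <= 1 / 2%:R -> 1 - x - x ^+ 2 <= gl_ratio x k.
Proof.
move=> x0 x1.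
have xk0 j : 0 <= x ^+ j by apply: exprn_ge0.
have xk1 j : x ^+ j <= 1 by apply: exprn_ile1 => //; lra.
case: k => [|k]; first by rewrite /gl_ratio big_ord0; have := xk0 2%N; lra.
suff : 1 - x - x ^+ 2 + x ^+ k.+2 <= gl_ratio x k.+1 by have := xk0 k.+2; lra.
elim: k => [|k IH]; first by rewrite /gl_ratio big_ord1 expr1; lra.
rewrite /gl_ratio big_ord_recr /= -/(gl_ratio x k.+1).
have e3 : x ^+ k.+3 = x * x ^+ k.+2 by rewrite exprS.
have e2 : x ^+ k.+2 = x ^+ 2 * x ^+ k by rewrite -exprD.
have y1 : 0 <= 1 - x ^+ k.+2 by have := xk1 k.+2; lra.
apply: le_trans (ler_wpM2r y1 IH).
have := xk0 k.+2; have : x ^+ k.+2 <= x ^+ 2.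
  by rewrite e2 ler_piMr // xk1.
rewrite e3; move: (x ^+ k.+2) => y h2 h3; nra.
Qed.

Lemma half_unitr (F : finFieldType) : 0 <= (#|F|%:R^-1 : rat) <= 1 / 2%:R.
Proof.
rewrite invr_ge0 ler0n /= div1r lef_pV2 ?posrE ?ltr0n // ?ler_nat.
  exact: card_finNzRing_gt1.
by rewrite (ltn_trans _ (card_finNzRing_gt1 F)).
Qed.

Section AlternatingBounds.

Variables (F : finFieldType) (theta : {rmorphism F -> F}).
Hypothesis thetaE : theta =1 id.

Local Notation "A ^!" := (map_mx theta A^T).
Local Notation Q := (#|F|%:R : rat).

Let thetaK : involutive theta. Proof. by move=> x; rewrite !thetaE. Qed.

Lemma alternating_singular_ker (n : nat) (J : 'M[F]_n) :
  ~~ odd n -> alternating theta J -> J \notin unitmx ->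
  (#|F| ^ 2 <= #|[set v : 'rV[F]_n | (v *m J == 0)%R]|)%N.
Proof.
move=> ev aJ sJ; apply: card_ker_ge.
have : \rank J != n by rewrite -/(row_free J) row_free_unit.
have := alternating_rank_even thetaE aJ; have := rank_leq_row J.
by lia.
Qed.

Lemma alternatingD (n : nat) (J K : 'M[F]_n) :
  alternating theta J -> alternating theta K -> alternating theta (J + K).
Proof. by move=> aJ aK v; rewrite mulmxDr mulmxDl aJ aK addr0. Qed.

Lemma Q_ge2 : 2%:R <= Q.
Proof. by rewrite ler_nat card_finNzRing_gt1. Qed.

(** Alternating norms all vanish, so the trivial bound for coincidences is used; the gain is that
    singular matrices have at least |F|^2 kernel vectors. The proportion is at most |F| / (|F|^2 -
    1), which is 2/3 for |F| = 2. *)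
Lemma alternating_sum_singular_le (e : nat) (J1 J : 'M[F]_e.+1) :
  odd e -> alternating theta J1 -> alternating theta J ->
  J1 \in unitmx -> J \in unitmx ->
  #|[set a : 'M[F]_e.+1 | (a *m J1 *m a^! + J)%R \notin unitmx]|%:R * 3%:R <=
  2%:R * Q ^+ (e.+1 * e.+1).
Proof.
move=> oe a1 aJ u1 uJ.
have w0 : (0 < #|F| ^ 2)%N by rewrite expn_gt0 (ltn_trans _ (card_finNzRing_gt1 F)).
have hw a : (a *m J1 *m a^! + J)%R \notin unitmx ->
    (#|F| ^ 2 <= #|[set v : 'rV[F]_e.+1 | (v *m (a *m J1 *m a^! + J) == 0)%R]|)%N.
  apply: alternating_singular_ker; first by rewrite /= oe.
  by apply: alternatingD => //; apply: alternating_congr.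
have h := card_singular_sum_le thetaK u1 uJ w0 hw.
have hc : (coincidences (form_norm theta J1) (form_norm theta (- J))
    <= #|F| ^ e.+1 * #|F| ^ e.+1)%N.
  by apply: leq_trans (max_card _) _; rewrite card_prod card_mx mul1n.
have {h hc} h : ((#|F| ^ 2 - 1) * #|[set a : 'M[F]_e.+1 |
     (a *m J1 *m a^! + J)%R \notin unitmx]|
   <= #|F| * #|F| ^ (e.+1 * e.+1))%N.
  apply: leq_trans h _; rewrite -expnS.
  have -> : ((e.+1 * e.+1).+1 = (e.+1 + e.+1) + e * e)%N by lia.
  rewrite expnD leq_mul2r expnD; apply/orP; right.
  by apply: leq_trans hc; rewrite leq_subr.
have := card_finNzRing_gt1 F; rewrite -natrX -!natrM ler_nat.
move: h; move: (#|F| ^ (e.+1 * e.+1))%N #|[set a | _]| => K bad.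
move: #|F| => k; rewrite -mulnn => h hk.
have : ((k * k - 1) * bad * 3 <= 3 * k * K)%N by lia.
have : (3 * k * K <= 2 * (k * k - 1) * K)%N by rewrite leq_mul2r; nia.
move=> h1 h2; rewrite -(leq_pmul2l (_ : 0 < k * k - 1)%N); last by nia.
lia.
Qed.

(** Of the two terms of [card_singular_gram_le], x = 0 contributes at most 1 / |F| relative to all
    b, because e < m, and nonzero x at most |F|; both are divided by |F|^2 - 1. *)
Lemma alternating_gram_singular_le (e m : nat) (J : 'M[F]_m.+1) :
  odd e -> (e < m)%N -> alternating theta J -> J \in unitmx ->
  #|[set b : 'M[F]_(e.+1, m.+1) | (b *m J *m b^!)%R \notin unitmx]|%:R
    * (Q * (Q ^+ 2 - 1)) <= Q ^+ (e.+1 * m.+1) * (1 + Q ^+ 2).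
Proof.
move=> oe em aJ uJ.
have w0 : (0 < #|F| ^ 2)%N by rewrite expn_gt0 (ltn_trans _ (card_finNzRing_gt1 F)).
have hw (b : 'M[F]_(e.+1, m.+1)) : (b *m J *m b^!)%R \notin unitmx ->
    (#|F| ^ 2 <= #|[set v : 'rV[F]_e.+1 | (v *m (b *m J *m b^!) == 0)%R]|)%N.
  apply: alternating_singular_ker; first by rewrite /= oe.
  exact: alternating_congr.
have h := card_singular_gram_le thetaK uJ w0 hw.
have hc : (fiber (form_norm theta J) 0%R <= #|F| ^ m.+1)%N.
  by apply: leq_trans (max_card _) _; rewrite card_mx mul1n.
have {h hc} h : (#|[set b : 'M[F]_(e.+1, m.+1) |
    (b *m J *m b^!)%R \notin unitmx]| * (#|F| * (#|F| ^ 2 - 1))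
   <= #|F| ^ (e.+1 * m.+1) * (1 + #|F| ^ 2))%N.
  rewrite mulnCA mulnC [(#|_| * _)%N]mulnC.
  apply: (@leq_trans (#|F| ^ e.+1 * (#|F| ^ (e * m.+1) + #|F| ^ m.+1 * #|F| ^ (e * m)) * #|F|)).
    rewrite leq_mul2r; apply/orP; right; apply: leq_trans h _.
    apply: leq_mul; first exact: leq_subr.
    rewrite leq_add2l leq_mul2r; apply/orP; right.
    by apply: leq_trans hc; rewrite leq_subr.
  rewrite mulnDr mulnDl mulnDr muln1 -!expnD -!expnSr.
  apply: leq_add; rewrite leq_pexp2l ?(ltnW (card_finNzRing_gt1 _)) //; lia.
have -> : Q ^+ 2 - 1 = (#|F| ^ 2 - 1)%N%:R by rewrite natrB // natrX.
by rewrite -!natrX -(natrD _ 1) -!natrM ler_nat.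
Qed.

Lemma card_good_frames_alternating (e m : nat) (J1 : 'M[F]_e.+1) (J2 : 'M[F]_m.+1) :
  odd e -> (e <= m)%N -> alternating theta J1 -> alternating theta J2 ->
  J1 \in unitmx -> J2 \in unitmx ->
  1 / 18%:R * Q ^+ (e.+1 * (e.+1 + m.+1)) <=
  #|[set p : 'M[F]_e.+1 * 'M[F]_(e.+1, m.+1) |
     ((p.2 *m J2 *m p.2^!)%R \in unitmx) &&
     ((p.1 *m J1 *m p.1^! + p.2 *m J2 *m p.2^!)%R \in unitmx)]|%:R.
Proof.
move=> oe em a1 a2 u1 u2; have Q2 := Q_ge2.
have hb : (1 / 6%:R : rat) * #|{: 'M[F]_(e.+1, m.+1)}|%:R <=
    #|[set b : 'M[F]_(e.+1, m.+1) | (b *m J2 *m b^!)%R \in unitmx]|%:R.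
  rewrite card_mx natrX; move: em; rewrite leq_eqVlt => /orP[/eqP em|em].
    (* For e = m the kernel count is too weak over the field of order 2; here b is square and the
       order of GL is used instead. *)
    case: m / em J2 a2 u2 => J2 a2 u2.
    rewrite (_ : [set b | _] = [set b | b \in unitmx]); last first.
      by apply/setP => b; rewrite !inE !unitmx_mul u2 (adjmx_unit theta) andbT andbb.
    rewrite card_unitmx_ratio mulrC; apply: ler_wpM2l.
      by rewrite exprn_ge0 // ler0n.
    have /andP[x0 x1] := half_unitr F; apply: le_trans (gl_ratio_ge e.+1 x0 x1).
    exact: quadratic_bound_half.
  have -> : 1 / 6%:R = 1 - 5%:R / 6%:R :> rat by lra.
  rewrite -natrX -card_mx; apply: card_good_ge; rewrite card_mx natrX.
  have h := alternating_gram_singular_le oe em a2 u2.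
  have X0 : 0 <= Q ^+ (e.+1 * m.+1) by rewrite exprn_ge0 ?ler0n.
  move: h X0; move: (Q ^+ (e.+1 * m.+1)) (_ %:R) => X bad h X0.
  have c0 : 0 < Q * (Q ^+ 2 - 1) by rewrite mulr_gt0; nra.
  rewrite -(ler_pM2r c0); apply: le_trans h _.
  rewrite [leRHS](_ : _ = X * (5%:R / 6%:R * (Q * (Q ^+ 2 - 1)))); last by ring.
  by apply: ler_wpM2l; [exact: X0 | exact: alternating_gram_bound].
have -> : Q ^+ (e.+1 * (e.+1 + m.+1)) =
    (#|{: 'M[F]_e.+1}| * #|{: 'M[F]_(e.+1, m.+1)}|)%:R.
  by rewrite !card_mx natrM !natrX -exprD mulnDr.
have -> : 1 / 18%:R = 1 / 3%:R * (1 / 6%:R) :> rat by lra.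
apply: (card_pairs_ge (r := 1 / 3%:R)
  (P := fun b : 'M[F]_(e.+1, m.+1) => (b *m J2 *m b^!)%R \in unitmx)
  (R := fun (a : 'M[F]_e.+1) (b : 'M[F]_(e.+1, m.+1)) =>
    (a *m J1 *m a^! + b *m J2 *m b^!)%R \in unitmx) _ hb) => [|b ub].
  by rewrite divr_ge0 ?ler0n.
have -> : 1 / 3%:R = 1 - 2%:R / 3%:R :> rat by lra.
apply: card_good_ge; rewrite card_mx natrX.
have := alternating_sum_singular_le oe a1 (alternating_congr b a2) u1 ub.
by lra.
Qed.

End AlternatingBounds.

Section HermitianBounds.

Variables (F : finFieldType) (theta : {rmorphism F -> F}) (q : nat).
Hypothesis cardF : #|F| = (q ^ 2)%N.
Hypothesis thetaE : forall x, theta x = x ^+ q.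

Local Notation "A ^!" := (map_mx theta A^T).
Local Notation Q := (#|F|%:R : rat).
Local Notation c := (q%:R : rat).

Let thetaK := hermitian_thetaK cardF thetaE.
Let q1 : (1 < q)%N := hermitian_q_gt1 cardF.

Let c2 : 2%:R <= c. Proof. by rewrite ler_nat. Qed.

Let QE : Q = c ^+ 2. Proof. by rewrite cardF natrX. Qed.

(** With T = |F|^(e+1), the norms of J1 and -J have at most T (q + T - 1) / q coincidences, the mean
    of the bounds for the two forms. Removing the pair (0, 0) leaves (T - 1)(T + q) / q. *)
Lemma hermitian_sum_singular_le (e : nat) (J1 J : 'M[F]_e.+1) (x := (Q ^+ e.+1)^-1) :
  J1^! = J1 -> J^! = J -> J1 \in unitmx -> J \in unitmx ->
  #|[set a : 'M[F]_e.+1 | (a *m J1 *m a^! + J)%R \notin unitmx]|%:R * (c ^+ 2 - 1) <=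
  c * (1 - x) * (1 + c * x) * Q ^+ (e.+1 * e.+1).
Proof.
move=> h1 hJ u1 uJ.
have w0 : (0 < #|F|)%N by rewrite (ltn_trans _ (card_finNzRing_gt1 F)).
have h := card_singular_sum_le thetaK u1 uJ w0 (fun a => @singular_ker F e.+1 _).
have hJ' : (- J)^! = - J by rewrite (adjmxN theta) hJ.
have uJ' : - J \in unitmx by rewrite -scaleN1r unitmxZ // unitrN unitr1.
have hc : (q * coincidences (form_norm theta J1) (form_norm theta (- J)) <=
    #|F| ^ e.+1 * (q + #|F| ^ e.+1 - 1))%N.
  have := coincidences_le (form_norm theta J1) (form_norm theta (- J)).
  have := hermitian_coincidences cardF thetaE h1 u1.
  have := hermitian_coincidences cardF thetaE hJ' uJ'.
  move: (coincidences _ _) (coincidences _ _) (coincidences _ _) => k1 k2 k3.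
  by move: (_ * (_ - 1))%N => X; nia.
set bad := #|_| in h *; set N := coincidences _ _ in h hc.
have T1 : (1 < #|F| ^ e.+1)%N by rewrite -(exp1n e.+1) ltn_exp2r // card_finNzRing_gt1.
have hN : (q * (N - 1) <= (#|F| ^ e.+1 - 1) * (#|F| ^ e.+1 + q))%N.
  move: hc T1; move: (#|F| ^ e.+1)%N => T; have := q1; nia.
have {h hN hc} h : (q * (#|F| - 1) * bad <=
    (#|F| ^ e.+1 - 1) * (#|F| ^ e.+1 + q) * #|F| ^ (e * e))%N.
  rewrite -mulnA; apply: (@leq_trans (q * ((N - 1) * #|F| ^ (e * e)))).
    by rewrite leq_mul2l h orbT.
  by rewrite mulnA leq_mul2r hN orbT.
rewrite -(ler_nat rat) in h.
rewrite !natrM !natrB ?(ltnW T1) // natrD !natrX in h.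
have eY : Q ^+ (e.+1 * e.+1) * Q = Q ^+ e.+1 ^+ 2 * Q ^+ (e * e).
  by rewrite -exprSr -exprM -exprD; congr (_ ^+ _); lia.
have T0 : Q ^+ e.+1 != 0 by rewrite expf_neq0 // pnatr_eq0 -lt0n.
move: h eY T0; rewrite /x -QE; have := c2; have := QE.
move: (Q ^+ e.+1) (Q ^+ (e * e)) (Q ^+ (e.+1 * e.+1)) (bad%:R) => T K Y b.
move: Q c => k c' -> c'2 h eY T0.
have c0 : c' != 0 by apply: contraTneq c'2 => ->; rewrite -ltNge ltr0n.
have -> : c' * (1 - T^-1) * (1 + c' * T^-1) * Y =
    c'^-1 * ((T - 1) * (T + c') * K).
  have -> : K = Y * c' ^+ 2 / T ^+ 2 by rewrite eY mulrAC divff ?mul1r // expf_neq0.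
  by field; rewrite T0 c0.
rewrite ler_pdivlMl; last by lra.
by rewrite [b * _]mulrC mulrA.
Qed.

(** [card_singular_gram_le] combined with the bound for isotropic vectors: T - 1 is the number of
    vectors v, and S^2 = |F|^(m+1) is the number of all x. *)
Lemma hermitian_gram_singular_le (e m : nat) (J : 'M[F]_m.+1)
    (T := Q ^+ e.+1) (S := c ^+ m.+1) :
  J^! = J -> J \in unitmx ->
  #|[set b : 'M[F]_(e.+1, m.+1) | (b *m J *m b^!)%R \notin unitmx]|%:R
    * ((c ^+ 2 - 1) * S ^+ 2) <=
  (1 - T^-1) * (T + c * (S ^+ 2 + (c - 1) * S) - c ^+ 2) * Q ^+ (e.+1 * m.+1).
Proof.
move=> hJ uJ.
have w0 : (0 < #|F|)%N by rewrite (ltn_trans _ (card_finNzRing_gt1 F)).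
have h := card_singular_gram_le thetaK uJ w0
  (fun b : 'M[F]_(e.+1, m.+1) => @singular_ker F e.+1 _).
have hN := hermitian_isotropic_le cardF thetaE hJ uJ.
set bad := #|_| in h *; set N := fiber _ _ in h hN.
have N0 : (0 < N)%N.
  by apply/card_gt0P; exists 0; rewrite inE /form_norm !mul0mx mxE.
have T1 : (0 < #|F| ^ e.+1)%N by rewrite expn_gt0 w0.
rewrite -(ler_nat rat) !natrM !natrB // natrD natrM natrB // !natrX in h.
have {}hN : c * N%:R <= S ^+ 2 + (c - 1) * S.
  rewrite /S -!natrX -expnM mulnC -natrM -[1]/(1%:R) -natrB ?(ltnW q1) //.
  by rewrite -natrM -natrD ler_nat.
have X0 : Q ^+ (e.+1 * m.+1) * Q = T * S ^+ 2 * Q ^+ (e * m).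
  rewrite /T /S exprAC -QE -exprSr -!exprD; congr (_ ^+ _); lia.
have X1 : Q ^+ (e * m.+1) * Q = T * Q ^+ (e * m).
  by rewrite /T -exprSr -!exprD; congr (_ ^+ _); lia.
have K0 : 0 <= Q ^+ (e * m) by rewrite exprn_ge0 ?ler0n.
have T1' : 1 <= T by rewrite /T -natrX ler1n.
have S0 : 0 <= S by rewrite exprn_ge0 ?ler0n.
move: h X0 X1 K0 T1' hN S0; rewrite -/T; have := c2; have := QE.
move: (bad%:R) (N%:R) (Q ^+ (e * m)) (Q ^+ (e.+1 * m.+1)) (Q ^+ (e * m.+1)).
move=> b N' K X K'; move: T S Q c => t s k c' -> c'2 h X0 X1 K0 t1 hN s0.
have c0 : c' != 0 by apply: contraTneq c'2 => ->; rewrite -ltNge ltr0n.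
have t0 : t != 0 by apply: contraTneq t1 => ->; rewrite -ltNge ltr01.
have c0' : c' ^+ 2 != 0 by rewrite expf_neq0.
have eK : K' = t * K / c' ^+ 2 by rewrite -X1 mulfK.
have eX : X = t * s ^+ 2 * K / c' ^+ 2 by rewrite -X0 mulfK.
have t10 : 0 <= t - 1 by lra.
have h1 : s ^+ 2 * ((c' ^+ 2 - 1) * b) <=
    s ^+ 2 * ((t - 1) * (t * K / c' ^+ 2 + (N' - 1) * K)).
  by rewrite ler_wpM2l ?sqr_ge0 // -eK.
rewrite [leLHS](_ : _ = s ^+ 2 * ((c' ^+ 2 - 1) * b)); last by ring.
apply: le_trans h1 _.
rewrite [leRHS](_ : _ = s ^+ 2 * ((t - 1) * (t * K / c' ^+ 2 +
   (c' * (s ^+ 2 + (c' - 1) * s) - c' ^+ 2) / c' ^+ 2 * K))); last first.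
  by rewrite eX; field; rewrite c0 t0.
rewrite ler_wpM2l ?sqr_ge0 // ler_wpM2l // lerD2l ler_wpM2r //.
have -> : N' - 1 = (c' * (c' * N') - c' ^+ 2) / c' ^+ 2 by field.
rewrite ler_wpM2r ?invr_ge0 ?sqr_ge0 // lerB // ler_wpM2l //; lra.
Qed.

(** The worst case is x = 1 / c^2. With y = x c^2 the left side is (c^2 - y)(c + y), and it falls
    short of the right side by (1 - y)(c^2 - c - 1 - y). *)
Lemma hermitian_sum_bound (x : rat) :
  0 <= x -> x * c ^+ 2 <= 1 ->
  c * (1 - x) * (1 + c * x) * c ^+ 2 <= (c + 1) * (c ^+ 2 - 1).
Proof.
move=> x0 x1; move: c c2 x1 => k k2; set y := x * k ^+ 2 => y1.
have y0 : 0 <= y by rewrite mulr_ge0 ?sqr_ge0.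
have -> : k * (1 - x) * (1 + k * x) * k ^+ 2 = (k ^+ 2 - y) * (k + y).
  by rewrite /y; ring.
have : 0 <= (1 - y) * (k ^+ 2 - k - 1 - y) by rewrite mulr_ge0; nra.
by nra.
Qed.

(** The proportion of good b is multiplied by the least proportion of good a. The products are 11/64
    for square b, 3/32 for q = 2 and lines, 57/1024 for q = 2 and larger dimension, and 1/4 for q at
    least 3. The smallest, 57/1024, exceeds 1/19. *)
Lemma card_good_frames_hermitian (e m : nat) (J1 : 'M[F]_e.+1) (J2 : 'M[F]_m.+1) :
  (e <= m)%N -> J1^! = J1 -> J2^! = J2 -> J1 \in unitmx -> J2 \in unitmx ->
  1 / 19%:R * Q ^+ (e.+1 * (e.+1 + m.+1)) <=
  #|[set p : 'M[F]_e.+1 * 'M[F]_(e.+1, m.+1) |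
     ((p.2 *m J2 *m p.2^!)%R \in unitmx) &&
     ((p.1 *m J1 *m p.1^! + p.2 *m J2 *m p.2^!)%R \in unitmx)]|%:R.
Proof.
move=> em h1 h2 u1 u2.
pose x := (Q ^+ e.+1)^-1; pose S := c ^+ m.+1.
have Q0 : 0 < Q by rewrite ltr0n (ltn_trans _ (card_finNzRing_gt1 F)).
have cc0 : 0 < c ^+ 2 - 1 by have := c2; nra.
have x0 : 0 <= x by rewrite invr_ge0 exprn_ge0 ?ler0n.
have xT : x * Q ^+ e.+1 = 1 by rewrite mulVf // expf_neq0 // gt_eqF.
have x1 : x * c ^+ 2 <= 1.
  rewrite -QE; apply: (@le_trans _ _ (x * Q ^+ e.+1)); last by rewrite xT.
  rewrite ler_wpM2l //; apply: ler_eXnr => //.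
  by rewrite ler1n; exact: ltnW (card_finNzRing_gt1 F).
have X0 k : 0 <= Q ^+ k by rewrite exprn_ge0 ?ler0n.
have ha (r : rat) : c * (1 - x) * (1 + c * x) <= r * (c ^+ 2 - 1) ->
    forall b : 'M[F]_(e.+1, m.+1), (b *m J2 *m b^!)%R \in unitmx ->
    (1 - r) * #|{: 'M[F]_e.+1}|%:R <=
    #|[set a : 'M[F]_e.+1 | (a *m J1 *m a^! + b *m J2 *m b^!)%R \in unitmx]|%:R.
  move=> hr b ub; apply: card_good_ge; rewrite card_mx natrX.
  rewrite -(ler_pM2r cc0).
  apply: le_trans (hermitian_sum_singular_le h1 (hermitian_congr_adj cardF thetaE b h2) u1 ub) _.
  rewrite -/x [leRHS]mulrAC ler_wpM2r //.
have hb (r : rat) : (1 - x) * (Q ^+ e.+1 + c * (S ^+ 2 + (c - 1) * S) - c ^+ 2)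
      <= r * ((c ^+ 2 - 1) * S ^+ 2) ->
    (1 - r) * #|{: 'M[F]_(e.+1, m.+1)}|%:R <=
    #|[set b : 'M[F]_(e.+1, m.+1) | (b *m J2 *m b^!)%R \in unitmx]|%:R.
  move=> hr; apply: card_good_ge; rewrite card_mx natrX.
  have cS0 : 0 < (c ^+ 2 - 1) * S ^+ 2.
    by rewrite mulr_gt0 // exprn_gt0 // exprn_gt0 //; have := c2; lra.
  rewrite -(ler_pM2r cS0).
  apply: le_trans (hermitian_gram_singular_le e h2 u2) _.
  rewrite -/x -/S [leRHS]mulrAC ler_wpM2r //.
have combine (r r' : rat) : 0 <= r -> 1 / 19%:R <= r * r' ->
    r' * #|{: 'M[F]_(e.+1, m.+1)}|%:R <=
      #|[set b : 'M[F]_(e.+1, m.+1) | (b *m J2 *m b^!)%R \in unitmx]|%:R ->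
    (forall b : 'M[F]_(e.+1, m.+1), (b *m J2 *m b^!)%R \in unitmx ->
      r * #|{: 'M[F]_e.+1}|%:R <=
      #|[set a : 'M[F]_e.+1 | (a *m J1 *m a^! + b *m J2 *m b^!)%R \in unitmx]|%:R) ->
  1 / 19%:R * Q ^+ (e.+1 * (e.+1 + m.+1)) <=
  #|[set p : 'M[F]_e.+1 * 'M[F]_(e.+1, m.+1) |
     ((p.2 *m J2 *m p.2^!)%R \in unitmx) &&
     ((p.1 *m J1 *m p.1^! + p.2 *m J2 *m p.2^!)%R \in unitmx)]|%:R.
  move=> r0 rr' hr' hr.
  have -> : Q ^+ (e.+1 * (e.+1 + m.+1)) =
      (#|{: 'M[F]_e.+1}| * #|{: 'M[F]_(e.+1, m.+1)}|)%:R.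
    by rewrite !card_mx natrM !natrX -exprD mulnDr.
  apply: le_trans (ler_wpM2r (ler0n _ _) rr') _.
  exact: (card_pairs_ge
    (P := fun b : 'M[F]_(e.+1, m.+1) => (b *m J2 *m b^!)%R \in unitmx)
    (R := fun (a : 'M[F]_e.+1) (b : 'M[F]_(e.+1, m.+1)) =>
      (a *m J1 *m a^! + b *m J2 *m b^!)%R \in unitmx)).
have hs := hermitian_sum_bound x0 x1.
have c20 : 0 < c ^+ 2 by rewrite exprn_gt0 //; have := c2; lra.
have ha34 := ha (3%:R / 4%:R).
have {}ha34 := ha34 _.
have s34 : c * (1 - x) * (1 + c * x) <= 3%:R / 4%:R * (c ^+ 2 - 1).
  rewrite -(ler_pM2r c20); apply: le_trans hs _.
  by rewrite [leRHS]mulrAC ler_wpM2r ?(ltW cc0) // cubic_bound_two.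
have xle1 : x <= 1.
  by rewrite -xT ler_peMr // exprn_ege1 // ler1n; exact: ltnW (card_finNzRing_gt1 F).
move: em; rewrite leq_eqVlt => /orP[/eqP em|em].
  case: m / em J2 h2 u2 S ha hb combine ha34 => J2 h2 u2 S ha hb combine ha34.
  apply: (combine (1 - 3%:R / 4%:R) (11%:R / 16%:R) isT isT); last exact: ha34.
  rewrite (_ : [set b | _] = [set b | b \in unitmx]); last first.
    by apply/setP => b; rewrite !inE !unitmx_mul u2 (adjmx_unit theta) andbT andbb.
  rewrite card_mx card_unitmx_ratio mulrC natrX; apply: ler_wpM2l; first exact: X0.
  have /andP[y0 y1] := half_unitr F; apply: le_trans (gl_ratio_ge e.+1 y0 y1).
  apply: quadratic_bound_quarter => //.
  rewrite div1r lef_pV2 ?posrE // QE -[4%:R]/((2 * 2)%N%:R) natrM -expr2.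
  by rewrite ler_pXn2r ?nnegrE ?ler0n.
have S0 : 0 < S by rewrite exprn_gt0 // ltr0n ltnW.
have TS : Q ^+ e.+1 * c ^+ 2 <= S ^+ 2.
  have -> : Q ^+ e.+1 * c ^+ 2 = c ^+ (2 * e.+1 + 2) by rewrite QE -exprM -exprD.
  rewrite /S -exprM; apply: ler_weXn2l; first by rewrite ler1n ltnW.
  by clear -em; lia.
have T0 : 0 <= Q ^+ e.+1 by [].
have [q2|q3] : q = 2%N \/ (3 <= q)%N by have := q1; clear; lia.
  have ec : c = 2%:R by rewrite q2.
  have eQ : Q = 4%:R by rewrite QE ec -natrX.
  have [e0|e0] := posnP e.
    have S4 : 4%:R <= S.
      by rewrite /S ec -natrX ler_nat -[4%N]/(2 ^ 2)%N leq_exp2l // ltnS -e0.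
    apply: (combine (1 - 3%:R / 4%:R) (1 - 5%:R / 8%:R) isT isT); last exact: ha34.
    apply: hb; move: xT; rewrite e0 expr1 eQ ec => xT.
    have -> : x = 1 / 4%:R by apply: (@mulIf _ 4%:R) => //; rewrite xT divfK.
    exact: gram_bound_line.
  have T16 : 16%:R <= Q ^+ e.+1.
    by rewrite eQ -natrX ler_nat -[16%N]/(4 ^ 2)%N leq_exp2l.
  have S8 : 8%:R <= S.
    by rewrite /S ec -natrX ler_nat -[8%N]/(2 ^ 3)%N leq_exp2l // !ltnS; clear -em e0; lia.
  have x16 : x <= 1 / 16%:R.
    rewrite ler_pdivlMr ?ltr0n //; apply: (@le_trans _ _ (x * Q ^+ e.+1)).
      by rewrite ler_wpM2l.
    by rewrite xT.
  apply: (combine (1 - 45%:R / 64%:R) (1 - 13%:R / 16%:R) isT isT).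
    by apply: hb; rewrite ec; apply: gram_bound_two => //; rewrite -ec.
  by apply: ha; rewrite ec; apply: sum_bound_two.
have c3 : 3%:R <= c by rewrite ler_nat.
have cS : c ^+ 2 <= S.
  by rewrite /S ler_weXn2l //; [rewrite ler1n ltnW | clear -em; lia].
apply: (combine (1 - 1 / 2%:R) (1 - 1 / 2%:R) isT isT).
  by apply: hb; apply: gram_bound_three.
apply: ha; rewrite -(ler_pM2r c20); apply: le_trans hs _.
by rewrite [leRHS]mulrAC ler_wpM2r ?(ltW cc0) // cubic_bound_three.
Qed.

End HermitianBounds.

(** * Orbit counting *)

Section SpanningIsometries.

Variables (F : finFieldType) (n : nat) (eps : bool) (theta : {rmorphism F -> F}).
Local Notation d := n.+1.
Local Notation V := 'rV[F]_d.
Local Notation GL := {'GL_d[F]}.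
Variable B : {hermitian V for eps & theta}.

Local Notation "A ^!" := (map_mx theta A^T).
Local Notation M := (formmx B).

Lemma orthov_add (U W : {vspace V}) :
  orthov B (U + W) = (orthov B U :&: orthov B W)%VS.
Proof.
apply/vspaceP => u; rewrite memv_cap.
apply/mem_orthovP/andP => [h|[/mem_orthovP hU /mem_orthovP hW] _ /memv_addP[v vU [w wW ->]]].
  split; apply/mem_orthovP => v vU; apply: h.
    by rewrite (subvP (addvSl U W)).
  by rewrite (subvP (addvSr U W)).
by rewrite linearDr /= hU // hW // addr0.
Qed.

Lemma addv_orthov (W : {vspace V}) :
  nondegenerate_subspace B W -> (orthov B W + W = fullv)%VS.
Proof.
have [Y fY <-] := exists_rowv (erefl (\dim W)); rewrite nondegenerate_rowv // => uY.
apply/vspaceP => v; rewrite memvf; apply/memv_addP.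
pose c := v *m M *m Y^! *m invmx (Y *m M *m Y^!).
exists (v - c *m Y); last first.
  by exists (c *m Y); rewrite ?subrK //; apply/rowvP; exists c.
rewrite mem_orthov_rowv !mulmxBl -(mulmxA c) -(mulmxA c) mulmxKV //.
by rewrite subrr.
Qed.

(** E(h) is the perpendicular space of U + Uh. It meets U + Uh trivially exactly when U + Uh is
    non-degenerate, and then it is automatically a complement. *)
Lemma spanning_isometriesE (G : {group GL}) (U : {vspace V}) :
  spanning_isometries B G U = [set h in G | is_duo B (U, imagev U h)].
Proof.
apply/setP => h; rewrite !inE; congr (_ && _).
rewrite /is_duo /= /Eperp -orthov_add; congr (_ && _).
have -> : (orthov B (U + imagev U h) :&: (U + imagev U h) == 0)%VS =
    nondegenerate_subspace B (U + imagev U h) by rewrite capvC.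
have [h0|//] := boolP (nondegenerate_subspace B (U + imagev U h)).
by rewrite addv_orthov // eqxx subvv.
Qed.

Variables (G : {group GL}) (e : nat) (calU : {set {vspace V}}).
Hypothesis sG : G \subset form_isometries B.
Hypothesis orbU : calU \in nondegenerate_orbits B G e.

Lemma orbit_eq (U : {vspace V}) : U \in calU -> calU = orbit (imagev_action F n) G U.
Proof. by case/imsetP: orbU => W0 _ -> /orbit_eqP ->. Qed.

Lemma imagev_calU (W : {vspace V}) (g : GL) :
  g \in G -> (imagev W g \in calU) = (W \in calU).
Proof. by case/imsetP: orbU => W0 _ -> gG; rewrite -(orbit_actr _ W0 W gG). Qed.

(** The elements of G that take U to W form a coset of the stabiliser of U. *)
Lemma card_transporters (U W : {vspace V}) :
  U \in calU -> W \in calU ->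
  (#|[set h in G | imagev U h == W]| * #|calU| = #|G|)%N.
Proof.
move=> UU WU; have := WU; rewrite (orbit_eq UU) => /orbitP[g gG gW].
rewrite -(card_orbit_stab (imagev_action F n) G U) mulnC; congr (_ * _)%N.
rewrite -gW -[RHS](card_rcoset _ g) -(amove_act (imagev_action F n) U (subsetT G) gG).
by apply: eq_card => h; rewrite !inE.
Qed.

(** An element of G that takes U to another member carries the partners of U bijectively to its
    partners. *)
Lemma card_duos (U : {vspace V}) :
  U \in calU ->
  #|[set p in setX calU calU | is_duo B p]| =
    (#|calU| * #|[set W in calU | is_duo B (U, W)]|)%N.
Proof.
move=> UU; pose R (U1 W : {vspace V}) := [&& U1 \in calU, W \in calU & is_duo B (U1, W)].
transitivity #|[set p : {vspace V} * {vspace V} | R p.1 p.2]|.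
  by apply: eq_card => -[U1 W]; rewrite !inE /R /= andbA.
rewrite (card_rel_sum R) (bigID (mem calU)) /= [X in (_ + X)%N]big1 => [|U1 hU1].
  rewrite addn0 -sum_nat_const; apply: eq_bigr => U1 U1U.
  have /orbitP[g gG gU] : U1 \in orbit (imagev_action F n) G U by rewrite -(orbit_eq UU).
  rewrite -[RHS](card_imset _ (act_inj (imagev_action F n) g)).
  apply: eq_card => W; rewrite inE /R U1U /= -gU; apply/andP/imsetP => [[WU dW]|].
    exists (imagev W g^-1%g); last by rewrite -[imagev _ _]/(imagev_action F n _ g) actKV.
    rewrite inE imagev_calU ?groupV // WU -(is_duo_imagev _ _ (subsetP sG g gG)).
    by rewrite -[imagev (imagev W _) g]/(imagev_action F n (imagev_action F n W _) g) actKV.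
  move=> [W']; rewrite inE => /andP[W'U dW'] ->; split; first by rewrite /= imagev_calU.
  by rewrite is_duo_imagev // (subsetP sG).
by rewrite /R (negPf hU1); apply/eqP; rewrite cards_eq0; apply/eqP/setP => W; rewrite !inE.
Qed.

Lemma card_calU_gt0 (U : {vspace V}) : U \in calU -> (0 < #|calU|)%N.
Proof. by move=> UU; apply/card_gt0P; exists U. Qed.

Lemma spanning_proportion (U : {vspace V}) :
  U \in calU ->
  #|spanning_isometries B G U|%:R / #|G|%:R =
    #|[set W in calU | is_duo B (U, W)]|%:R / #|calU|%:R :> rat.
Proof.
move=> UU; rewrite spanning_isometriesE.
have cU0 : #|calU|%:R != 0 :> rat by rewrite pnatr_eq0 -lt0n (card_calU_gt0 UU).
have G0 : #|G|%:R != 0 :> rat by rewrite pnatr_eq0 -lt0n cardG_gt0.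
apply/eqP; rewrite eqr_div // -!natrM eqr_nat; apply/eqP.
have -> : #|[set h in G | is_duo B (U, imagev U h)]| =
    (\sum_(W in [set W in calU | is_duo B (U, W)]) #|[set h in G | imagev U h == W]|)%N.
  rewrite -sum1_card (partition_big (imagev U)
    (fun W => W \in [set W in calU | is_duo B (U, W)])) /= => [|h]; last first.
    rewrite !inE => /andP[hG ->]; rewrite andbT (orbit_eq UU).
    exact: (mem_orbit (imagev_action F n)).
  apply: eq_bigr => W; rewrite inE => /andP[_ dW]; rewrite -sum1_card.
  apply: eq_bigl => h; rewrite !inE; case: eqVneq => [->|]; last by rewrite !andbF.
  by rewrite dW andbT.
rewrite big_distrl /= (eq_bigr (fun=> #|G|)) => [|W]; first by rewrite sum_nat_const mulnC.
by rewrite inE => /andP[WU _]; apply: card_transporters.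
Qed.

Lemma duo_proportionE (U : {vspace V}) :
  U \in calU ->
  duo_proportion B calU calU =
    #|[set W in calU | is_duo B (U, W)]|%:R / #|calU|%:R :> rat.
Proof.
move=> UU; rewrite /duo_proportion (card_duos UU).
have cU0 : #|calU|%:R != 0 :> rat by rewrite pnatr_eq0 -lt0n (card_calU_gt0 UU).
by rewrite natrM -mulf_div divff // mul1r.
Qed.

End SpanningIsometries.

Section ConnectedTypes.

Variables (F : finFieldType) (n : nat) (eps : bool) (theta : {rmorphism F -> F}).
Local Notation d := n.+1.
Local Notation V := 'rV[F]_d.
Local Notation GL := {'GL_d[F]}.
Variable B : {hermitian V for eps & theta}.
Hypothesis nB : nondegenerate B.

Local Notation "A ^!" := (map_mx theta A^T).
Local Notation M := (formmx B).

Lemma duo_proportion_ge (r : rat) (e m : nat) (calU : {set {vspace V}}) (U : {vspace V}) :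
  involutive theta -> (e.+1 + m.+1)%N = d -> (e <= m)%N -> 0 <= r ->
  (forall W, W \in calU = (\dim W == e.+1) && nondegenerate_subspace B W) ->
  U \in calU ->
  (forall (A : 'M[F]_(e.+1, d)) (C : 'M[F]_(m.+1, d)),
    A *m M *m A^! \in unitmx -> C *m M *m C^! \in unitmx ->
    r * #|F|%:R ^+ (e.+1 * (e.+1 + m.+1)) <=
    #|[set p : 'M[F]_e.+1 * 'M[F]_(e.+1, m.+1) |
     ((p.2 *m (C *m M *m C^!) *m p.2^!)%R \in unitmx) &&
     ((p.1 *m (A *m M *m A^!) *m p.1^! +
       p.2 *m (C *m M *m C^!) *m p.2^!)%R \in unitmx)]|%:R) ->
  r <= #|[set W in calU | is_duo B (U, W)]|%:R / #|calU|%:R.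
Proof.
move=> thetaK ed em r0 hU UU hgood.
have := UU; rewrite hU => /andP[/eqP dU nU].
have [A fA eA] := exists_rowv dU.
have uA : A *m M *m A^! \in unitmx by rewrite -nondegenerate_rowv ?eA.
have [C [fX _ CA AC uC]] := exists_orthogonal_complement thetaK nB ed uA.
have h1 := hgood A C uA uC.
have := duo_proportion_graph ed fX CA AC uA hU (leqnn _).
rewrite eA -(ler_nat rat) !natrM natrX => h2.
rewrite ler_pdivlMr ?ltr0n ?(card_calU_gt0 UU) //.
have X0 : 0 < #|F|%:R ^+ (e.+1 * d) :> rat.
  by rewrite exprn_gt0 // ltr0n (ltn_trans _ (card_finNzRing_gt1 F)).
rewrite -(ler_pM2l X0); apply: le_trans h2; rewrite mulrA.
rewrite ler_wpM2r ?ler0n // mulrC; apply: le_trans h1.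
by rewrite [(e.+1 + m.+1)%N]ed.
Qed.

End ConnectedTypes.

(** * Siegel transformations *)

Section Orthogonal.

Variables (F : finFieldType) (n : nat) (eps : bool) (theta : {rmorphism F -> F}).
Local Notation d := n.+1.
Local Notation V := 'rV[F]_d.
Local Notation GL := {'GL_d[F]}.
Variables (B : {hermitian V for eps & theta}) (Q : V -> F).

Local Notation "A ^!" := (map_mx theta A^T).
Local Notation M := (formmx B).

Hypotheses (symB : is_sym B) (QB : quadratic_with_polar Q B) (nB : nondegenerate B).

Lemma polarC u v : B u v = B v u.
Proof.
case: symB => e0 th; rewrite hermC th.
have -> : (-1) ^+ eps = 1 :> F by rewrite e0.
by rewrite mul1r.
Qed.

Lemma polarZl a u v : B (a *: u) v = a * B u v.
Proof. by rewrite linearZl_LR. Qed.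

Lemma polarZr a u v : B u (a *: v) = a * B u v.
Proof. by rewrite polarC polarZl polarC. Qed.

Lemma quadZ a u : Q (a *: u) = a ^+ 2 * Q u.
Proof. by case: QB => h _. Qed.

Lemma quadD u v : Q (u + v) = Q u + Q v + B u v.
Proof. by case: QB => _ h; rewrite -h; ring. Qed.

Lemma quad0 : Q 0 = 0.
Proof. by rewrite -(scale0r 0) quadZ expr0n mul0r. Qed.

Lemma quadN u : Q (- u) = Q u.
Proof. by rewrite -scaleN1r quadZ sqrrN expr1n mul1r. Qed.

Lemma polar_diag u : B u u = Q u *+ 2.
Proof.
have := quadD u u; rewrite -{1}[u in Q (u + _)]scale1r -{1}[u in Q (_ + u)]scale1r.
rewrite -scalerDl quadZ => h.
have : (1 + 1) ^+ 2 * Q u - Q u - Q u = B u u by rewrite h; ring.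
by move=> <-; ring.
Qed.

Lemma polarDl u v w : B (u + v) w = B u w + B v w.
Proof. exact: linearDl. Qed.

Lemma polarDr u v w : B u (v + w) = B u v + B u w.
Proof. exact: linearDr. Qed.

Lemma polarNl u v : B (- u) v = - B u v.
Proof. exact: linearNl. Qed.

Lemma polarNr u v : B u (- v) = - B u v.
Proof. exact: linearNr. Qed.

Definition polarE := (polarDl, polarDr, polarNl, polarNr, polarZl, polarZr).

Lemma nondegenerate_polar u : (forall v, B u v = 0) -> u = 0.
Proof.
move=> h; apply/eqP; rewrite -memv0 -(eqP nB); apply/mem_orthovP => v _.
exact: h.
Qed.

Lemma quadratic_isometriesP (h : GL) :
  reflect (forall v, Q (v *m GLval h) = Q v) (h \in quadratic_isometries Q).
Proof.
rewrite inE; apply: (iffP forallP) => hQ v; first by apply/eqP.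
by rewrite hQ.
Qed.

Lemma quadratic_isometries_sub : quadratic_isometries Q \subset form_isometries B.
Proof.
apply/subsetP => h /quadratic_isometriesP hQ; apply/form_isometriesP => u v.
have e x y : B x y = Q (x + y) - Q x - Q y by rewrite quadD; ring.
by rewrite !e -mulmxDl !hQ.
Qed.

(** A matrix that preserves Q preserves the polar form, so its kernel lies in the radical, which is
    zero. *)
Lemma quadratic_isometry_mx (A : 'M[F]_d) :
  (forall v, Q (v *m A) = Q v) ->
  exists2 h : GL, h \in quadratic_isometries Q & GLval h = A.
Proof.
move=> hA; have uA : A \in unitmx.
  rewrite -row_free_unit -kermx_eq0; apply/rowV0P => v /sub_kermxP vA.
  apply: nondegenerate_polar => w.
  have -> : B v w = Q (v + w) - Q v - Q w by rewrite quadD; ring.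
  by rewrite -hA mulmxDl vA add0r -(hA v) vA quad0 -(hA w); ring.
by exists (Sub A uA) => //; apply/quadratic_isometriesP.
Qed.

Lemma mulmx_rank1 (u z w : V) : u *m (M *m z^! *m w) = B u z *: w.
Proof. by rewrite !mulmxA [u *m M *m _]mx11_scalar -formmxE mul_scalar_mx. Qed.

(** The Siegel, or Eichler, transformation; it is an isometry when z is singular and perpendicular
    to w. *)
Definition siegel (z w : V) : 'M[F]_d :=
  1%:M + M *m z^! *m w - M *m w^! *m z - Q w *: (M *m z^! *m z).

Lemma siegelE z w u :
  u *m siegel z w = u + B u z *: w - B u w *: z - (Q w * B u z) *: z.
Proof.
rewrite /siegel !mulmxBr mulmxDr mulmx1 -scalemxAr !mulmx_rank1 scalerA.
by [].
Qed.

(** For a hyperbolic pair this scales z by t and z' by 1 / t and fixes the vectors perpendicular to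
    both. *)
Definition torus (t : F) (z z' : V) : 'M[F]_d :=
  1%:M + (t - 1) *: (M *m z'^! *m z) + (t^-1 - 1) *: (M *m z^! *m z').

Lemma torusE t z z' u :
  u *m torus t z z' = u + ((t - 1) * B u z') *: z + ((t^-1 - 1) * B u z) *: z'.
Proof. by rewrite /torus !mulmxDr mulmx1 -!scalemxAr !mulmx_rank1 !scalerA. Qed.

Lemma siegel_isometry z w :
  Q z = 0 -> B z w = 0 -> forall u, Q (u *m siegel z w) = Q u.
Proof.
move=> Qz zw u; rewrite siegelE -!addrA -opprD -scalerDl -scaleNr !quadD !quadZ.
by rewrite !polarE [B w z]polarC zw Qz; ring.
Qed.

Lemma torus_isometry t z z' :
  t != 0 -> Q z = 0 -> Q z' = 0 -> B z z' = 1 ->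
  forall u, Q (u *m torus t z z') = Q u.
Proof.
move=> t0 Qz Qz' zz u; rewrite torusE -addrA !quadD !quadZ !polarE Qz Qz' zz.
by field.
Qed.

Lemma hyperbolic_partner (W : {vspace V}) z :
  nondegenerate_subspace B W -> z \in W -> z != 0 -> Q z = 0 ->
  exists z', [/\ z' \in W, Q z' = 0 & B z z' = 1].
Proof.
move=> nW zW z0 Qz.
have [y yW zy] : exists2 y, y \in W & B z y != 0.
  apply/mem_orthovPn; apply: contra z0 => zo.
  by rewrite -memv0 -(eqP nW) memv_cap zW.
have [y1 y1W zy1] : exists2 y1, y1 \in W & B z y1 = 1.
  by exists ((B z y)^-1 *: y); rewrite ?memvZ // polarZr mulVf.
exists (y1 - Q y1 *: z); split.
- by rewrite memvB ?memvZ.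
- rewrite quadD quadN quadZ Qz !polarE polarC zy1; ring.
- by rewrite !polarE polar_diag Qz zy1 mul0rn mulr0 subr0.
Qed.

(* [siegel z w] is the commutator of [siegel z ((t - 1)^-1 w)] and a torus   *)
(* element, which exists as soon as some [t] differs from 0 and 1.           *)
Lemma siegel_Omega z w :
  (2 < #|F|)%N -> z != 0 -> Q z = 0 -> B z w = 0 ->
  exists2 g : GL, g \in Omega Q & GLval g = siegel z w.
Proof.
move=> F3 z0 Qz zw.
have nV : nondegenerate_subspace B fullv.
  by rewrite /nondegenerate_subspace capfv.
have [z' [_ Qz' zz]] := hyperbolic_partner nV (memvf z) z0 Qz.
have [t t0 t1] : exists2 t : F, t != 0 & t != 1.
  have : (0 < #|~: [set 0%R; 1%R : F]|)%N.
    have := cardsC [set 0%R; 1%R : F]; rewrite cards2 eq_sym oner_eq0 /= => h.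
    by rewrite -(ltn_add2l 2) addn0 h.
  by case/card_gt0P => t; rewrite !inE negb_or => /andP[]; exists t.
have t10 : t - 1 != 0 by rewrite subr_eq0.
(* Adding a multiple of z to w does not change the Siegel transformation, so w may be made
   perpendicular to z' and thus fixed by the torus. *)
pose w0 := w - B w z' *: z.
have zw0 : B z w0 = 0 by rewrite !polarE zw polar_diag Qz mul0rn mulr0 subr0.
have zw0' : B z' w0 = 0 by rewrite !polarE [B z' z]polarC zz [B z' w]polarC; ring.
have Qw0 : Q w0 = Q w.
  by rewrite /w0 quadD quadN quadZ Qz !polarE [B w z]polarC zw; ring.
have -> : siegel z w = siegel z w0.
  apply/row_matrixP => i; rewrite !rowE !siegelE Qw0.
  move: (delta_mx _ _) => u.
  by apply/rowP => j; rewrite !polarE !mxE; ring.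
move: w0 zw0 zw0' {Qw0 zw} => w0 zw0 zw0'.
have zw1 : B z ((t - 1)^-1 *: w0) = 0 by rewrite polarZr zw0 mulr0.
have [g gQ eg] := quadratic_isometry_mx (siegel_isometry Qz zw1).
have [h hQ eh] := quadratic_isometry_mx (torus_isometry t0 Qz Qz' zz).
exists [~ g, h]%g; first exact: mem_commg.
apply/row_matrixP => i; rewrite !rowE; move: (delta_mx _ _) => v.
have mulE (x : V) (a b : GL) : x *m GLval (a * b)%g = x *m GLval a *m GLval b.
  by rewrite mulmxA.
have [u <-] : exists u, u *m GLval (h * g)%g = v.
  exists (v *m GLval (h * g)%g^-1); rewrite -mulE mulVg.
  by rewrite mulmx1.
rewrite -mulE.
have -> : (h * g * [~ g, h] = g * h)%g.
  by rewrite commgEl -!mulgA (mulKVg g) conjgE !mulgA mulgV mul1g.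
rewrite !mulE eg eh torusE !siegelE torusE !polarE.
rewrite !polar_diag Qz ![B _ z]polarC ![B _ z']polarC zw0 zw0'.
rewrite (polarC z' z) zz !quadZ !mul0rn.
by apply/rowP => j; rewrite !mxE; field; rewrite t0 t10.
Qed.

End Orthogonal.

Section Spheres.

Variables (F : finFieldType) (n : nat) (eps : bool) (theta : {rmorphism F -> F}).
Local Notation d := n.+1.
Local Notation V := 'rV[F]_d.
Local Notation GL := {'GL_d[F]}.
Variables (B : {hermitian V for eps & theta}) (Q : V -> F).

Local Notation "A ^!" := (map_mx theta A^T).
Local Notation M := (formmx B).

Hypotheses (symB : is_sym B) (QB : quadratic_with_polar Q B) (nB : nondegenerate B).

Definition coord_quad (k : nat) (Y : 'M[F]_(k, d)) (c : 'rV[F]_k) : F := Q (c *m Y).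

Lemma coord_quadD (k : nat) (Y : 'M[F]_(k, d)) c s :
  coord_quad Y (c + s) = coord_quad Y c + B (c *m Y) (s *m Y) + coord_quad Y s.
Proof. by rewrite /coord_quad mulmxDl (quadD QB) addrAC. Qed.

Lemma card_polar_fiber (k : nat) (Y : 'M[F]_(k.+1, d)) (s : 'rV[F]_k.+1) t :
  Y *m M *m Y^! \in unitmx -> s != 0 ->
  (#|[set c : 'rV[F]_k.+1 | B (c *m Y) (s *m Y) == t]| = #|F| ^ k)%N.
Proof.
move=> uY s0; have thetaK : involutive theta by move=> x; rewrite !(symB.2).
have y0 : Y *m M *m Y^! *m s^! != 0.
  apply: contra_neq s0 => /(congr1 (mulmx (invmx (Y *m M *m Y^!)))).
  by rewrite mulKmx // mulmx0 => /eqP; rewrite (adjmx_eq0 thetaK) => /eqP.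
rewrite -(card_functional t%:M y0); apply: eq_card => c; rewrite !inE form_rows.
rewrite -mulmxA; apply/eqP/eqP => [<-|->]; first by rewrite -mx11_scalar.
by rewrite mxE eqxx mulr1n.
Qed.

Lemma coord_quad_coincidences (k : nat) (Y : 'M[F]_(k.+1, d)) :
  Y *m M *m Y^! \in unitmx ->
  (coincidences (coord_quad Y) (coord_quad Y) * #|F| =
    #|F| ^ k.+1 * (#|F| + #|F| ^ k.+1 - 1))%N.
Proof.
move=> uY.
apply: (coincidences_eq_second_moment (coord_quadD Y)).
- by rewrite /coord_quad mul0mx (quad0 QB).
- by move=> c; rewrite mul0mx linear0r.
by move=> s c s0; rewrite card_polar_fiber // expnSr.
Qed.

Lemma sphere_deviation (k : nat) (Y : 'M[F]_(k.+1, d)) t :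
  Y *m M *m Y^! \in unitmx ->
  ((#|F| * fiber (coord_quad Y) t)%:Z - (#|F| ^ k.+1)%:Z) ^+ 2
    <= (#|F|%:Z - 1) ^+ 2 * (#|F| ^ k.+1)%:Z.
Proof.
move=> uY; have := @fiber_deviation _ _ (coord_quad Y) setT #|F| t.
rewrite card_mx mul1n cardsT => /(_ _ (leqnn _) _ _)/wrap[] //.
by rewrite coord_quad_coincidences.
Qed.

(** In dimension l, an empty fibre would force |F|^l <= (|F| - 1)^2 by [sphere_deviation], which is
    false for l at least 2. *)
Lemma exists_quad (N : {vspace V}) c :
  nondegenerate_subspace B N -> (1 < \dim N)%N -> exists2 v, v \in N & Q v = c.
Proof.
move=> nN; case dN: (\dim N) => [|k] // k0.
have [Y fY eY] := exists_rowv dN.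
have uY : Y *m M *m Y^! \in unitmx by rewrite -nondegenerate_rowv // eY.
have h := sphere_deviation c uY.
suff : (0 < fiber (coord_quad Y) c)%N.
  by case/card_gt0P => a; rewrite inE => /eqP ha; exists (a *m Y) => //;
    rewrite -eY; apply/rowvP; exists a.
rewrite lt0n; apply/eqP => f0; move: h; rewrite f0 muln0 sub0r sqrrN leNgt.
have F1 := card_finNzRing_gt1 F.
have hX : (#|F| * #|F| <= #|F| ^ k.+1)%N.
  by rewrite mulnn leq_pexp2l // ltnW.
move: hX F1; move: #|F| (#|F| ^ k.+1)%N => q X hX q1.
have : (q%:Z - 1) ^+ 2 < X%:Z by nia.
have : 0 < X%:Z by nia.
by move=> X0 hlt; rewrite expr2 ltr_pM2r // hlt.
Qed.

(** If zero were the only singular vector, its fibre would lie too far below the average for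
    [sphere_deviation], as soon as the dimension is at least 3. *)
Lemma exists_singular (W : {vspace V}) :
  nondegenerate_subspace B W -> (2 < \dim W)%N ->
  exists z, [/\ z \in W, z != 0 & Q z = 0].
Proof.
move=> nW; case dW: (\dim W) => [|k] // k0.
have [Y fY eY] := exists_rowv dW.
have uY : Y *m M *m Y^! \in unitmx by rewrite -nondegenerate_rowv // eY.
have h := sphere_deviation 0 uY.
have [c c0 Qc] : exists2 c : 'rV[F]_k.+1, c != 0 & coord_quad Y c = 0.
  have [/existsP[c /andP[c0 /eqP Qc]]|] :=
    boolP [exists c : 'rV[F]_k.+1, (c != 0) && (coord_quad Y c == 0)].
    by exists c.
  rewrite negb_exists => /forallP hc; exfalso.
  have f1 : (fiber (coord_quad Y) 0%R <= 1)%N.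
    apply: (@leq_trans #|[set (0 : 'rV[F]_k.+1)]|); last by rewrite cards1.
    apply/subset_leq_card/subsetP => c.
    by rewrite !inE => Qc; have := hc c; rewrite Qc andbT negbK.
  move: h; rewrite leNgt => /negP[].
  have F1 := card_finNzRing_gt1 F.
  have hX : (#|F| * (#|F| * #|F|) <= #|F| ^ k.+1)%N.
    by rewrite mulnn -expnS leq_pexp2l // ltnW.
  have hX' : (#|F| ^ k.+1 = #|F| * #|F| ^ k)%N by rewrite expnS.
  have hk : (#|F| * #|F| <= #|F| ^ k)%N by rewrite mulnn leq_pexp2l // ltnW.
  move: f1 F1; rewrite hX'; move: hk; move: #|F| (#|F| ^ k)%N (fiber _ _) => q X f.
  move=> hk f1 q1.
  have h1 : (q%:Z - 1) * X%:Z < q%:Z * X%:Z - (q * f)%N%:Z by nia.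
  have h2 : (q%:Z - 1) ^+ 2 * (q * X)%N%:Z <= ((q%:Z - 1) * X%:Z) ^+ 2.
    rewrite exprMn ler_wpM2l ?sqr_ge0 //; nia.
  apply: le_lt_trans h2 _; rewrite -[ltRHS]sqrrN opprB PoszM.
  have h3 : 0 <= (q%:Z - 1) * X%:Z by nia.
  by rewrite !expr2 ltr_pM.
exists (c *m Y); split => //; first by rewrite -eY; apply/rowvP; exists c.
by rewrite mulmx_free_eq0.
Qed.

Section HyperbolicComplement.

Variables (W : {vspace V}) (z z' : V).
Hypotheses (nW : nondegenerate_subspace B W).
Hypotheses (zW : z \in W) (z'W : z' \in W).
Hypotheses (Qz : Q z = 0) (Qz' : Q z' = 0) (zz' : B z z' = 1).

Definition hyperbolic_complement : {vspace V} :=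
  (W :&: orthov B <[z]> :&: orthov B <[z']>)%VS.

Local Notation N := hyperbolic_complement.

Lemma mem_hyperbolic_complement v :
  (v \in N) = [&& v \in W, B v z == 0 & B v z' == 0].
Proof. by rewrite /N !memv_cap !mem_orthov1 andbA. Qed.

Let zz : B z z = 0. Proof. by rewrite (polar_diag QB) Qz mul0rn. Qed.
Let zz'' : B z' z' = 0. Proof. by rewrite (polar_diag QB) Qz' mul0rn. Qed.
Let z'z : B z' z = 1. Proof. by rewrite (polarC symB). Qed.

Lemma hyperbolic_decomposition v :
  v \in W -> v - B v z' *: z - B v z *: z' \in N.
Proof.
move=> vW; rewrite mem_hyperbolic_complement !memvB ?memvZ //=.
by rewrite !(polarE symB) zz zz'' zz' z'z; apply/andP; split; apply/eqP; ring.
Qed.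

Lemma orthogonal_decomposition u :
  B u z = 0 -> B u z' = 0 -> (forall v, v \in N -> B u v = 0) ->
  forall v, v \in W -> B u v = 0.
Proof.
move=> uz uz' uN v vW; have := uN _ (hyperbolic_decomposition vW).
by rewrite !(polarE symB) uz uz' !mulr0 !subr0.
Qed.

Lemma nondegenerate_orthogonal u : u \in W -> (forall v, v \in W -> B u v = 0) -> u = 0.
Proof.
move=> uW h; apply/eqP; rewrite -memv0 -(eqP nW) memv_cap uW.
by apply/mem_orthovP => v; apply: h.
Qed.

Lemma hyperbolic_complement_nondegenerate : nondegenerate_subspace B N.
Proof.
apply/eqP/eqP; rewrite -subv0; apply/subvP => u; rewrite memv_cap memv0.
rewrite {1}mem_hyperbolic_complement => /andP[/and3P[uW /eqP uz /eqP uz']].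
move=> /mem_orthovP uN; apply/eqP/nondegenerate_orthogonal => //.
exact: orthogonal_decomposition.
Qed.

Lemma dim_hyperbolic_complement : (\dim W <= \dim N + 2)%N.
Proof.
have h1 := leq_dim_orthov1 B z W.
have h2 := leq_dim_orthov1 B z' (W :&: orthov B <[z]>).
rewrite /hyperbolic_complement addn2 -(addn1 (\dim _).+1) -ltnS -!addn1.
move: h1 h2; clear; move: (\dim W) (\dim (W :&: _)) => a b h1.
by move: (\dim _) => c h2; lia.
Qed.

(** The vectors z' + v - Q(v) z, with v in the hyperbolic complement N, are all partners of z. If x
    were perpendicular to each of them, then B x v = Q(v) B x z on N. The left side is additive in v
    and Q is not, so B x z = 0, and x would be perpendicular to W. *)
Lemma exists_singular_partner x :
  (2 < \dim W)%N -> x \in W -> x != 0 ->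
  exists z1, [/\ z1 \in W, Q z1 = 0, B z z1 = 1 & B x z1 != 0].
Proof.
move=> dW xW x0.
pose zn v := z' + v - Q v *: z.
have znP v : v \in N -> [/\ zn v \in W, Q (zn v) = 0 & B z (zn v) = 1].
  rewrite mem_hyperbolic_complement => /and3P[vW /eqP vz /eqP vz']; split.
  - by rewrite /zn memvB ?memvD ?memvZ.
  - rewrite /zn !(quadD QB) (quadN QB) (quadZ QB) Qz Qz' !(polarE symB) z'z vz.
    by rewrite (polarC symB z') vz'; ring.
  - by rewrite /zn !(polarE symB) zz zz' (polarC symB z) vz; ring.
have [/existsP[v /andP[vN xv]]|] := boolP [exists v, (v \in N) && (B x (zn v) != 0)].
  by have [h1 h2 h3] := znP v vN; exists (zn v).
rewrite negb_exists => /forallP hx.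
have {}hx v : v \in N -> B x (zn v) = 0.
  by move=> vN; have := hx v; rewrite vN /= negbK => /eqP.
have xz' : B x z' = 0.
  by have := hx 0 (mem0v _); rewrite /zn (quad0 QB) scale0r subr0 addr0.
have xv v : v \in N -> B x v = Q v * B x z.
  by move=> /hx; rewrite /zn !(polarE symB) xz' add0r => /eqP; rewrite subr_eq0 => /eqP.
have xz : B x z = 0.
  have [v vN v0] : exists2 v, v \in N & v != 0.
    exists (vpick N); first exact: memv_pick.
    rewrite vpick0; apply/eqP => N0; have := dim_hyperbolic_complement.
    by rewrite N0 dimv0 leqNgt dW.
  have [w wN vw] : exists2 w, w \in N & B v w != 0.
    apply/mem_orthovPn; apply: contra v0 => vo.
    by rewrite -memv0 -(eqP hyperbolic_complement_nondegenerate) memv_cap vN.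
  have := xv (v + w) (memvD vN wN); rewrite (polarDr B) (xv v vN) (xv w wN) (quadD QB) => /eqP.
  rewrite !mulrDl -[X in X == _]addr0 (inj_eq (addrI _)) eq_sym mulf_eq0 (negPf vw).
  by move=> /eqP.
case/eqP: x0; apply: nondegenerate_orthogonal => //.
apply: orthogonal_decomposition => // v vN; by rewrite xv // xz mulr0.
Qed.

End HyperbolicComplement.

(** The Siegel transformation with w = (y - x) / B x z takes x to y plus a multiple of z, and that
    multiple vanishes because Q x = Q y. It preserves W because z and w lie in W. *)
Lemma siegel_transport (W : {vspace V}) z x y :
  (2 < #|F|)%N -> z \in W -> x \in W -> y \in W -> Q z = 0 ->
  B x z = B y z -> B x z != 0 -> Q x = Q y ->
  exists g : GL, [/\ g \in Omega Q, imagev W g = W & x *m GLval g = y].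
Proof.
move=> F3 zW xW yW Qz xyz xz0 Qxy.
have z0 : z != 0 by apply: contraNneq xz0 => ->; rewrite linear0r.
pose b := B x z; pose w := b^-1 *: (y - x).
have zw : B z w = 0.
  by rewrite (polarC symB) !(polarE symB) -xyz subrr mulr0.
have [g gO eg] := siegel_Omega symB QB nB F3 z0 Qz zw.
exists g; split => //; last first.
  rewrite eg siegelE -/b.
  have -> : b *: w = y - x by rewrite /w scalerA divff // scale1r.
  rewrite [x + _]addrC subrK -addrA -opprD -scalerDl.
  suff -> : B x w + Q w * b = 0 by rewrite scale0r subr0.
  rewrite /w (polarZr symB) (quadZ QB) (quadD QB) (quadN QB) !(polarE symB).
  rewrite (polar_diag QB) (polarC symB y) -Qxy; move: xz0; rewrite -/b => b0.
  by field.
have sW : (imagev W g <= W)%VS.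
  apply/subvP => _ /imagevP[v vW ->]; rewrite eg siegelE.
  by rewrite !memvB ?memvD ?memvZ // ?memvB.
by apply/eqP; rewrite -(geq_leqif (dimv_leqif_eq sW)) dim_imagev.
Qed.

(** Two Siegel transformations suffice. A hyperbolic pair z, z' in W is chosen with B x z and B y z'
    nonzero; then an intermediate u with Q u = Q x is built that pairs with z as x does and with z'
    as y does. Its third component v needs a prescribed value of Q, available since the hyperbolic
    complement has dimension at least 2. *)
Lemma sphere_transitive (W : {vspace V}) x y :
  (2 < #|F|)%N -> nondegenerate_subspace B W -> (3 < \dim W)%N ->
  x \in W -> y \in W -> x != 0 -> y != 0 -> Q x = Q y ->
  exists g : GL, [/\ g \in Omega Q, imagev W g = W & x *m GLval g = y].
Proof.
move=> F3 nW dW xW yW x0 y0 Qxy.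
have [z0 [z0W z00 Qz0]] := exists_singular nW (ltnW dW).
have [z0' [z0'W Qz0' zz0]] := hyperbolic_partner symB QB nW z0W z00 Qz0.
have [z [zW Qz _ xz]] :=
  exists_singular_partner nW z0W z0'W Qz0 Qz0' zz0 (ltnW dW) xW x0.
have zn0 : z != 0 by apply: contraNneq xz => ->; rewrite linear0r.
have [z1 [z1W Qz1 zz1]] := hyperbolic_partner symB QB nW zW zn0 Qz.
have [z' [z'W Qz' zz' yz']] :=
  exists_singular_partner nW zW z1W Qz Qz1 zz1 (ltnW dW) yW y0.
have nN := hyperbolic_complement_nondegenerate nW zW z'W Qz Qz' zz'.
have [|v vN Qv] := exists_quad (Q x - B x z * B y z') nN.
  by have := leq_trans dW (dim_hyperbolic_complement W z z'); rewrite addn2 !ltnS.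
move: vN; rewrite mem_hyperbolic_complement => /and3P[vW /eqP vz /eqP vz'].
pose u := B y z' *: z + B x z *: z' + v.
have uW : u \in W by rewrite !memvD ?memvZ.
have z'z : B z' z = 1 by rewrite (polarC symB).
have Qu : Q u = Q x.
  rewrite /u !(quadD QB) !(quadZ QB) Qz Qz' Qv !(polarE symB) zz'.
  by rewrite ![B _ v](polarC symB) vz vz'; ring.
have uz : B u z = B x z.
  by rewrite /u !(polarE symB) (polar_diag QB) Qz z'z vz mul0rn; ring.
have uz' : B u z' = B y z'.
  by rewrite /u !(polarE symB) (polar_diag QB) Qz' zz' vz' mul0rn; ring.
have [g [gO gW xg]] := siegel_transport F3 zW xW uW Qz (esym uz) xz (esym Qu).
have uz'0 : B u z' != 0 by rewrite uz'.
have [h [hO hW uh]] := siegel_transport F3 z'W uW yW Qz' uz' uz'0 (etrans Qu Qxy).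
exists (g * h)%g; split; first exact: groupM.
  by have := actM (imagev_action F n) W g h => /= ->; rewrite gW hW.
by rewrite mulmxA xg uh.
Qed.

End Spheres.

(** * Averaging over non-degenerate subspaces of dimension 2e *)

Lemma card_le_fibers (T T' : finType) (f : T -> T') (A : {set T}) (D : {set T'}) k :
  {in A, forall x, f x \in D} ->
  {in A, forall x, #|[set y in A | f y == f x]| <= k}%N ->
  (#|A| <= #|D| * k)%N.
Proof.
move=> fD hk; rewrite -sum1_card (partition_big f (mem D)) //= -sum_nat_const.
apply: leq_sum => y _; rewrite sum1dep_card.
have [->|[x]] := set_0Vmem [set x | (x \in A) && (f x == y)]; first by rewrite cards0.
by rewrite inE => /andP[xA /eqP <-]; apply: hk.
Qed.

Section Pairs.

Variables (F : finFieldType) (n : nat) (eps : bool) (theta : {rmorphism F -> F}).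
Local Notation d := n.+1.
Local Notation V := 'rV[F]_d.
Local Notation GL := {'GL_d[F]}.
Variables (B : {hermitian V for eps & theta}) (Q : V -> F).
Local Notation q := #|F|.

Local Notation "A ^!" := (map_mx theta A^T).
Local Notation M := (formmx B).

Hypotheses (symB : is_sym B) (QB : quadratic_with_polar Q B) (nB : nondegenerate B).

Definition shell (W : {vspace V}) (c : F) : nat :=
  #|[set v | [&& v \in W, v != 0 & Q v == c]]|.

Lemma card_vspace_quad (k : nat) (Y : 'M[F]_(k, d)) c :
  row_free Y -> #|[set v | (v \in rowv Y) && (Q v == c)]| = fiber (coord_quad Q Y) c.
Proof.
move=> fY; rewrite /fiber -[RHS](card_imset _ (row_free_inj fY)).
apply: eq_card => v; rewrite inE; apply/andP/imsetP => [[/rowvP[a ->] Qa]|[a + ->]].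
  by exists a; rewrite ?inE.
by rewrite inE => Qa; split => //; apply/rowvP; exists a.
Qed.

Lemma shellE (W : {vspace V}) c :
  (#|[set v | (v \in W) && (Q v == c)]| = (c == 0%R) + shell W c)%N.
Proof.
rewrite (cardsD1 0) inE mem0v (quad0 QB) eq_sym; congr (_ + _)%N.
by apply: eq_card => v; rewrite !inE andbCA.
Qed.

(** By [sphere_deviation], |F| times the fibre is at least T^2 - (q - 1) T. Discarding the zero
    vector costs at most q, and T^2 - (q - 1) T - q = (T + 1)(T - q). *)
Lemma shell_ge (W : {vspace V}) (k : nat) c (T := (q ^ k)%N) :
  nondegenerate_subspace B W -> (0 < k)%N -> \dim W = (2 * k)%N ->
  ((T + 1) * (T - q) <= q * shell W c)%N.
Proof.
move=> nW k0 dW; have q1 := card_finNzRing_gt1 F.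
have T0 : (q <= T)%N by rewrite /T -{1}[q]expn1 leq_pexp2l // ltnW.
have [l dl] : exists l, (2 * k = l.+1)%N by exists (2 * k).-1; lia.
have [Y fY eY] := exists_rowv (etrans dW dl).
have uY : Y *m M *m Y^! \in unitmx by rewrite -nondegenerate_rowv // eY.
have := sphere_deviation symB QB c uY.
have eT : (q ^ (2 * k) = T ^ 2)%N by rewrite mulnC expnM.
rewrite -(card_vspace_quad _ fY) eY shellE -dl eT.
have : ((c == 0%R) <= 1)%N by case: eqP.
move: (nat_of_bool _) (shell W c) => b N b1 h.
have hT0 : (0 < T)%N by apply: leq_trans T0; apply: ltnW.
have h' : ((q * (b + N))%N%:Z - (T ^ 2)%N%:Z) ^+ 2 <= ((q%:Z - 1) * T%:Z) ^+ 2.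
  apply: le_trans h _; rewrite exprMn.
  by rewrite (_ : (T ^ 2)%N%:Z = T%:Z ^+ 2) // -mulnn PoszM expr2.
move: h' q1 T0 hT0; clear -b1; move: q T => p t h q1 T0 t0.
rewrite leqNgt; apply/negP => hlt; move: h; rewrite leNgt => /negP[].
have h1 : (p%:Z - 1) * t%:Z < (t ^ 2)%N%:Z - (p * (b + N))%N%:Z by nia.
have h2 : 0 <= (p%:Z - 1) * t%:Z by nia.
by rewrite -[ltRHS]sqrrN opprB !expr2 ltr_pM.
Qed.

(** The sum counts the coincidences of Q on U and U' in which both vectors are nonzero. There are at
    most T (q + T - 1) / q coincidences, and dropping (0, 0) leaves (T - 1)(T + q) / q. *)
Lemma sum_shell_le (U U' : {vspace V}) (k : nat) (T := (q ^ k)%N) :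
  nondegenerate_subspace B U -> nondegenerate_subspace B U' ->
  (0 < k)%N -> \dim U = k -> \dim U' = k ->
  (q * (\sum_c shell U c * shell U' c) <= (T - 1) * (T + q))%N.
Proof.
case: k @T => // k T nU nU' _ dU dU'.
have [Y fY eY] := exists_rowv dU; have [Y' fY' eY'] := exists_rowv dU'.
have uY : Y *m M *m Y^! \in unitmx by rewrite -nondegenerate_rowv // eY.
have uY' : Y' *m M *m Y'^! \in unitmx by rewrite -nondegenerate_rowv // eY'.
have h1 := coord_quad_coincidences symB QB uY.
have h2 := coord_quad_coincidences symB QB uY'.
have h3 := coincidences_le (coord_quad Q Y) (coord_quad Q Y').
have h4 : (1 + \sum_c shell U c * shell U' c <=
    coincidences (coord_quad Q Y) (coord_quad Q Y'))%N.
  rewrite coincidences_sum (bigD1 (0 : F)) //= [X in (_ <= X)%N](bigD1 (0 : F)) //=.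
  rewrite addnA leq_add //.
    rewrite -!card_vspace_quad // eY eY' !shellE eqxx.
    by rewrite mulnDl mulnDr; lia.
  apply: leq_sum => c c0; rewrite -!card_vspace_quad // eY eY' !shellE.
  by rewrite (negPf c0).
have T0 : (0 < T)%N by rewrite expn_gt0 (ltnW (card_finNzRing_gt1 F)).
move: h1 h2 h3 h4 (card_finNzRing_gt1 F) T0; rewrite -/T; clear.
move: (coincidences _ _) (coincidences _ _) (coincidences _ _) (\sum_c _)%N.
by move: q T => p t c1 c2 c3 S; nia.
Qed.

Section Ambient.

Variables (G : {group GL}) (e : nat) (calU : {set {vspace V}}).
Hypotheses (F3 : (2 < q)%N) (OG : Omega Q \subset G).
Hypotheses (GQ : G \subset quadratic_isometries Q).
Hypothesis orbU : calU \in nondegenerate_orbits B G e.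
Hypothesis e1 : (1 < e)%N.

Let sG : G \subset form_isometries B.
Proof. exact: subset_trans GQ (quadratic_isometries_sub QB). Qed.

Lemma calU_dim U : U \in calU -> \dim U = e /\ nondegenerate_subspace B U.
Proof.
case/imsetP: orbU => W0; rewrite inE => /andP[/eqP dW0 nW0] ->.
move=> /orbitP[h hG <-]; rewrite /= dim_imagev dW0; split => //.
by rewrite nondegenerate_imagev // (subsetP sG).
Qed.

Variable W : {vspace V}.
Hypotheses (nW : nondegenerate_subspace B W) (dW : \dim W = (2 * e)%N).

Definition members : {set {vspace V}} := [set U in calU | (U <= W)%VS].

Definition incidence (z : V) : nat := #|[set U in members | z \in U]|.

Lemma incidence_le x y : x \in W -> y \in W -> x != 0 -> y != 0 -> Q x = Q y ->
  (incidence x <= incidence y)%N.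
Proof.
move=> xW yW x0 y0 Qxy.
have [|g [gO gW xg]] := sphere_transitive symB QB nB F3 nW _ xW yW x0 y0 Qxy.
  by rewrite dW; clear -e1; lia.
rewrite /incidence -(card_imset _ (act_inj (imagev_action F n) g)).
apply/subset_leq_card/subsetP => _ /imsetP[U + ->]; rewrite !inE.
move=> /andP[/andP[UU UW] xU]; rewrite /= (imagev_calU orbU) ?(subsetP OG) // UU /=.
apply/andP; split; last by rewrite -xg; apply/imagevP; exists x.
by rewrite -gW; apply: limgS.
Qed.

Lemma incidence_eq x y : x \in W -> y \in W -> x != 0 -> y != 0 -> Q x = Q y ->
  incidence x = incidence y.
Proof. by move=> *; apply/eqP; rewrite eqn_leq !incidence_le. Qed.

Lemma sum_incidence c :
  (\sum_(z | [&& z \in W, z != 0 & Q z == c]%R) incidence z =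
   \sum_(U in members) shell U c)%N.
Proof.
rewrite /incidence.
under eq_bigr => z _ do rewrite -sum1dep_card big_mkcondr.
rewrite exchange_big /=; apply: eq_bigr => U; rewrite inE => /andP[_ UW].
rewrite -big_mkcondr /= sum1dep_card; apply: eq_card => z; rewrite !inE.
by case zU: (z \in U); rewrite ?andbF //= (subvP UW) // andbT.
Qed.

(** The equality case of Cauchy-Schwarz: by transitivity of Omega on the shell, the incidence is
    constant there. *)
Lemma incidence_sum_sqr (z0 : V) (c := Q z0) :
  z0 \in W -> z0 != 0 ->
  (shell W c * \sum_(z | [&& z \in W, z != 0 & Q z == c]%R) incidence z ^ 2 =
   (\sum_(U in members) shell U c) ^ 2)%N.
Proof.
move=> z0W z00; rewrite -sum_incidence.
have h z : [&& z \in W, z != 0 & Q z == c] -> incidence z = incidence z0.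
  by case/and3P=> zW zz /eqP Qz; apply: incidence_eq.
rewrite (eq_bigr (fun=> incidence z0 ^ 2)%N) => [|z /h -> //].
rewrite [X in (_ = X ^ 2)%N](eq_bigr (fun=> incidence z0)) => [|z /h -> //].
rewrite !sum_nat_const.
have -> : #|[pred z | [&& z \in W, z != 0 & Q z == c]]| = shell W c.
  by apply: eq_card => z; rewrite !inE.
by rewrite expnMn mulnA mulnn.
Qed.

Definition meeting_pairs : {set {vspace V} * {vspace V}} :=
  [set p in setX members members | (p.1 :&: p.2 != 0)%VS].

Lemma card_vspace_nonzero (U : {vspace V}) :
  U != 0%VS -> (q - 1 <= #|[set v | (v \in U) && (v != 0%R)]|)%N.
Proof.
rewrite -vpick0 => u0; set u := vpick U in u0.
rewrite subn1 -(cardC1 (0 : F)).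
have inj : injective (fun a : F => a *: u).
  move=> a b /eqP; rewrite -subr_eq0 -scalerBl scaler_eq0 (negPf u0) orbF subr_eq0.
  by move/eqP.
rewrite -(card_imset _ inj); apply/subset_leq_card/subsetP => _ /imsetP[a + ->].
rewrite !inE => a0; rewrite memvZ ?memv_pick //=.
by rewrite scaler_eq0 negb_or a0 u0.
Qed.

Lemma sum_incidence_sqr :
  (\sum_(z | (z \in W) && (z != 0%R)) incidence z ^ 2 =
   \sum_(p in setX members members) #|[set v | (v \in p.1 :&: p.2)%VS && (v != 0%R)]|)%N.
Proof.
under [RHS]eq_bigr => p _ do rewrite -sum1dep_card big_mkcond.
rewrite exchange_big /= big_mkcond; apply: eq_bigr => z _.
rewrite -big_mkcondr /= sum1dep_card; case: ifP => [/andP[zW z0]|hz].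
  rewrite -mulnn -cardsX; apply: eq_card => -[U U']; rewrite !inE /= memv_cap z0 andbT.
  by rewrite andbACA.
apply/esym/eqP; rewrite cards_eq0; apply/eqP/setP => -[U U']; rewrite !inE /=.
apply/negP => /andP[/andP[/andP[_ UW] _]]; rewrite memv_cap => /andP[/andP[zU _] z0].
by move: hz; rewrite z0 (subvP UW).
Qed.

(** For each value c the constant incidence expresses the sum of squares through the shells of the
    members, and [shell_ge] bounds the shell of W in the denominator. Expanding the square gives a
    sum over pairs of members, each bounded by [sum_shell_le]. *)
Lemma incidence_shell_le (T := (q ^ e)%N) :
  ((T + 1) * (T - q) * \sum_(z | (z \in W) && (z != 0%R)) incidence z ^ 2
    <= #|members| ^ 2 * ((T - 1) * (T + q)))%N.
Proof.
have e0 : (0 < e)%N by apply: ltnW.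
have -> : (\sum_(z | (z \in W) && (z != 0%R)) incidence z ^ 2 =
    \sum_c \sum_(z | [&& z \in W, z != 0 & Q z == c]%R) incidence z ^ 2)%N.
  rewrite (partition_big Q xpredT) //=; apply: eq_bigr => c _.
  by apply: eq_bigl => z; rewrite andbA.
apply: (@leq_trans (q * \sum_c (\sum_(U in members) shell U c) ^ 2)%N).
  rewrite !big_distrr /=; apply: leq_sum => c _.
  have [/existsP[z0 /and3P[z0W z00 /eqP zc]]|] :=
    boolP [exists z, [&& z \in W, z != 0 & Q z == c]].
    rewrite -zc -(incidence_sum_sqr z0W z00) mulnA leq_mul2r.
    by rewrite shell_ge ?orbT.
  rewrite negb_exists => /forallP hc; rewrite big_pred0 ?muln0 // => z.
  exact/negbTE/hc.
have -> : (\sum_c (\sum_(U in members) shell U c) ^ 2 =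
    \sum_(p in setX members members) \sum_c shell p.1 c * shell p.2 c)%N.
  rewrite [RHS]exchange_big /=; apply: eq_bigr => c _.
  rewrite -mulnn big_distrlr /= pair_big_dep /=.
  by apply: eq_bigl => -[U U']; rewrite in_setX.
rewrite big_distrr /= -mulnn -cardsX -sum_nat_const; apply: leq_sum => -[U U'].
rewrite !inE /= => /andP[/andP[/calU_dim[dU nU] _] /andP[/calU_dim[dU' nU'] _]].
exact: sum_shell_le.
Qed.

(** The sum of squared incidences counts pairs of members together with a common nonzero vector, and
    a pair that meets has at least q - 1 of these. *)
Lemma meeting_pairs_le (T := (q ^ e)%N) :
  ((T + 1) * (T - q) * ((q - 1) * #|meeting_pairs|)
    <= #|members| ^ 2 * ((T - 1) * (T + q)))%N.
Proof.
apply: leq_trans incidence_shell_le; rewrite leq_mul2l; apply/orP; right.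
rewrite sum_incidence_sqr mulnC -sum_nat_const.
rewrite big_mkcond [X in (_ <= X)%N]big_mkcond /=; apply: leq_sum => p _.
by rewrite inE; case: (p \in _) => //=; case: ifP => // /card_vspace_nonzero.
Qed.

Lemma disjoint_members (T := (q ^ e)%N) (r : rat) :
  (q%:R < T%:R :> rat) ->
  (T%:R - 1) * (T%:R + q%:R) <= (1 - r) * ((T%:R + 1) * (T%:R - q%:R) * (q%:R - 1)) ->
  r * #|members|%:R ^+ 2 <=
    #|[set p in setX members members | (p.1 :&: p.2 == 0)%VS]|%:R.
Proof.
move=> qT hr; have q1 := card_finNzRing_gt1 F.
have T1 : (0 < T)%N by rewrite expn_gt0 ltnW.
have : ((T + 1) * (T - q) * ((q - 1) * #|meeting_pairs|)
    <= #|members| ^ 2 * ((T - 1) * (T + q)))%N := meeting_pairs_le.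
rewrite -(ler_nat rat) !natrM !natrB ?(ltnW q1) //; last first.
  by rewrite -(ler_nat rat) ltW.
rewrite !natrD -expr2 => hm.
set good := #|[set p in _ | _]|.
have hc : #|members|%:R ^+ 2 = #|meeting_pairs|%:R + good%:R :> rat.
  rewrite -natrX -mulnn -cardsX -natrD; congr (_%:R).
  rewrite -(cardsID [set p | (p.1 :&: p.2 != 0)%VS] (setX members members)).
  rewrite /good /meeting_pairs; congr (_ + _)%N.
    by apply: eq_card => p; rewrite !inE.
  by apply: eq_card => p; rewrite !inE negbK andbC.
rewrite hc in hm *.
have c0 : 0 < (T%:R + 1) * (T%:R - q%:R) * (q%:R - 1) :> rat.
  by rewrite !mulr_gt0 ?subr_gt0 ?ltr1n // ltr_wpDl ?ler0n.
have mg0 : 0 <= #|meeting_pairs|%:R + good%:R :> rat by rewrite -natrD ler0n.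
move: hm hr c0 mg0; move: (#|meeting_pairs|%:R) (good%:R) => mt g hm hr c0 mg0.
have h1 : mt * ((T%:R + 1) * (T%:R - q%:R) * (q%:R - 1)) <=
   (mt + g) * ((1 - r) * ((T%:R + 1) * (T%:R - q%:R) * (q%:R - 1))).
  apply: le_trans (_ : _ <= (mt + g) * ((T%:R - 1) * (T%:R + q%:R))) _.
    by apply: le_trans hm; rewrite le_eqVlt; apply/orP; left; apply/eqP; ring.
  by rewrite ler_wpM2l.
have : mt <= (mt + g) * (1 - r) by rewrite -(ler_pM2r c0) -[leRHS]mulrA.
by rewrite mulrBr mulr1 [r * _]mulrC; move: (_ * r) => y; rewrite lerBrDr lerD2l.
Qed.

End Ambient.

End Pairs.

Lemma gl_ratio_step (x : rat) (k : nat) : 0 <= x -> x <= 1 ->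
  (1 - x ^+ k.+1) ^+ 2 <= (1 - x ^+ (2 * k).+1) * (1 - x ^+ (2 * k).+2).
Proof.
move=> x0 x1; pose y := x ^+ k.+1.
have y0 : 0 <= y by apply: exprn_ge0.
have y1 : y <= 1 by apply: exprn_ile1.
have -> : x ^+ (2 * k).+2 = y ^+ 2 by rewrite /y -exprM; congr (_ ^+ _); lia.
have uy : x ^+ (2 * k).+1 <= y.
  by rewrite /y; apply: ler_wiXn2l => //; lia.
rewrite -/y; have -> : 1 - y ^+ 2 = (1 + y) * (1 - y) by ring.
rewrite expr2 mulrA; apply: ler_wpM2r; first by rewrite subr_ge0.
apply: (@le_trans _ _ (1 - x ^+ (2 * k).+1)); first by rewrite lerB.
by rewrite ler_peMr ?subr_ge0 ?(le_trans uy) // lerDl.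
Qed.

(** The quotient of [gl_ratio x (2 * k)] by the square of [gl_ratio x k] does not decrease with k,
    so a bound at one j serves all larger k. *)
Lemma gl_ratio_double (x : rat) (j k : nat) (r : rat) :
  0 <= x -> x <= 1 -> (j <= k)%N ->
  r * gl_ratio x j ^+ 2 <= gl_ratio x (2 * j) -> 0 <= r ->
  r * gl_ratio x k ^+ 2 <= gl_ratio x (2 * k).
Proof.
move=> x0 x1 jk h r0; rewrite -(subnK jk); elim: (k - j)%N => // i IH.
rewrite addSn; set l := (i + j)%N in IH *.
have -> : (2 * l.+1 = (2 * l).+2)%N by lia.
rewrite /gl_ratio big_ord_recr /= -/(gl_ratio x l) 2!big_ord_recr /=.
rewrite -/(gl_ratio x (2 * l)) exprMn mulrA -[leRHS]mulrA.
apply: ler_pM => //; last exact: gl_ratio_step.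
- by rewrite mulr_ge0 ?sqr_ge0.
- by rewrite sqr_ge0.
Qed.

Lemma ambient_exponents (e m : nat) :
  (2 * e * (e + m) + e * e * 2 = e * m * 2 + 2 * e * (2 * e))%N.
Proof. lia. Qed.

Section Orthogonal.

Variables (F : finFieldType) (n : nat) (eps : bool) (theta : {rmorphism F -> F}).
Local Notation d := n.+1.
Local Notation V := 'rV[F]_d.
Local Notation GL := {'GL_d[F]}.
Variables (B : {hermitian V for eps & theta}) (Q : V -> F).
Local Notation q := #|F|.

Local Notation "A ^!" := (map_mx theta A^T).
Local Notation M := (formmx B).

Hypotheses (symB : is_sym B) (QB : quadratic_with_polar Q B) (nB : nondegenerate B).

Variables (G : {group GL}) (e : nat) (calU : {set {vspace V}}).
Hypotheses (F3 : (2 < q)%N) (OG : Omega Q \subset G).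
Hypotheses (GQ : G \subset quadratic_isometries Q).
Hypothesis orbU : calU \in nondegenerate_orbits B G e.
Hypothesis e1 : (1 < e)%N.

Let thetaK : involutive theta. Proof. by move=> x; rewrite !(symB.2). Qed.

Definition ambients : {set {vspace V}} :=
  [set W | (\dim W == (2 * e)%N) && nondegenerate_subspace B W].

Local Notation duos := [set p in setX calU calU | is_duo B p].
Local Notation pairs W :=
  [set p in setX (members calU W) (members calU W) | (p.1 :&: p.2 == 0)%VS].

Lemma pairs_duo W p : W \in ambients -> p \in pairs W ->
  p \in duos /\ (p.1 + p.2 = W)%VS.
Proof.
rewrite !inE => /andP[/eqP dW nW] /andP[/andP[/andP[U1 W1] /andP[U2 W2]] /eqP cap].
have eW : (p.1 + p.2 = W)%VS.
  have sW : (p.1 + p.2 <= W)%VS by rewrite subv_add W1 W2.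
  apply/eqP; rewrite -(geq_leqif (dimv_leqif_eq sW)) dimv_disjoint_sum // dW.
  have [-> _] := calU_dim QB GQ orbU U1; have [-> _] := calU_dim QB GQ orbU U2.
  by rewrite mul2n addnn.
by rewrite U1 U2 /is_duo cap eqxx eW.
Qed.

(** A duo is counted for at most one W, namely the sum of its two members. *)
Lemma sum_pairs_le : (\sum_(W in ambients) #|pairs W| <= #|duos|)%N.
Proof.
apply: (@leq_trans (\sum_(p in duos) #|[set W in ambients | p \in pairs W]|)%N); last first.
  rewrite -sum1_card; apply: leq_sum => p _.
  apply: (@leq_trans #|[set (p.1 + p.2)%VS]|); last by rewrite cards1.
  apply/subset_leq_card/subsetP => W.
  by rewrite in_set => /andP[WA /(pairs_duo WA)[_ ->]]; rewrite inE.
under eq_bigr => W _ do rewrite -sum1_card.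
rewrite (exchange_big_dep (mem duos)) /=; last by move=> W p WA /(pairs_duo WA)[].
apply: leq_sum => p _; rewrite sum1dep_card.
by apply/subset_leq_card/subsetP => W; rewrite !in_set.
Qed.

Lemma duos_ge_full (r : rat) : d = (2 * e)%N ->
  (forall W, W \in ambients ->
    r * #|members calU W|%:R ^+ 2 <= #|pairs W|%:R) ->
  r * #|calU|%:R ^+ 2 <= #|duos|%:R.
Proof.
move=> de hr; have fA : fullv \in ambients.
  rewrite inE dimvf /dim /= mul1n; apply/andP; split; first by rewrite -de.
  by rewrite /nondegenerate_subspace capfv.
have eU : members calU fullv = calU by apply/setP => U; rewrite inE subvf andbT.
have := hr _ fA; rewrite eU => h; apply: le_trans h _; rewrite ler_nat.
apply: leq_trans sum_pairs_le; rewrite (bigD1 _ fA) /= eU.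
exact: leq_addr.
Qed.

Variable m : nat.
Hypothesis em : (e + m)%N = d.

(** Each such b gives the ambient space spanned by A and b C. If b' gives the same space,
    independence of the rows of A and C yields b' = P b with P invertible, so a fibre has at most
    |GL_e| elements. *)
Lemma card_ambients_ge (U : {vspace V}) (A : 'M[F]_(e, d)) (C : 'M[F]_(m, d)) :
  row_free (col_mx A C) -> C *m M *m A^! = 0 -> A *m M *m C^! = 0 ->
  A *m M *m A^! \in unitmx -> rowv A = U ->
  (#|[set b : 'M[F]_(e, m) | (b *m (C *m M *m C^!) *m b^!)%R \in unitmx]| <=
   #|[set W in ambients | (U <= W)%VS]| * #|[set P : 'M[F]_e | P \in unitmx]|)%N.
Proof.
move=> fX CA AC uA eU.
have fC : row_free (A : 'M_(e, d)) := gram_unit_free uA.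
apply: (card_le_fibers (f := fun b => (rowv A + rowv (b *m C))%VS)) => b; rewrite inE => ub.
  have := duo_graph CA AC (p := (0, b)) uA ub.
  rewrite /graph_mx mul0mx add0r => /andP[/= /eqP cap nW].
  have fb : row_free (b *m C).
    apply: (gram_unit_free (B := B)); rewrite (adjmx_mul theta).
    by move: ub; rewrite !mulmxA.
  rewrite !inE nW dimv_disjoint_sum // !dim_rowv // mul2n addnn eqxx /=.
  by rewrite -eU addvSl.
rewrite -(card_imset _ (_ : injective (fun P : 'M[F]_e => P *m b))); last first.
  have fb : row_free b.
    apply/row_freeP; exists (C *m M *m C^! *m b^! *m invmx (b *m (C *m M *m C^!) *m b^!)).
    by rewrite !mulmxA mulmxV //; move: ub; rewrite !mulmxA.
  exact: row_free_inj.
apply/subset_leq_card/subsetP => b'; rewrite inE => /andP[]; rewrite inE => ub' /eqP eW.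
have /rowv_subP[P eP] : (rowv (b' *m C) <= rowv (col_mx A (b *m C)))%VS.
  by rewrite rowv_col_mx -eW addvSr.
have eb : b' = rsubmx P *m b.
  have : row_mx 0 b' *m col_mx A C = row_mx (lsubmx P) (rsubmx P *m b) *m col_mx A C.
    rewrite !mul_row_col mul0mx add0r eP -{1}(hsubmxK P) mul_row_col.
    by rewrite mulmxA.
  by move/(row_free_inj fX)/eq_row_mx => [].
apply/imsetP; exists (rsubmx P) => //; rewrite inE.
move: ub'; rewrite eb (adjmx_mul theta) !mulmxA -!mulmxA unitmx_mul.
by case/andP.
Qed.

Lemma card_ambients_le :
  (#|ambients| * #|[set P : 'M[F]_(2 * e) | P \in unitmx]| <= q ^ (2 * e * d))%N.
Proof.
rewrite -card_frames => [|W]; last by rewrite inE => /andP[/eqP].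
by rewrite -card_mx max_card.
Qed.

Lemma sum_members : (\sum_(W in ambients) #|members calU W| =
  \sum_(U in calU) #|[set W in ambients | (U <= W)%VS]|)%N.
Proof.
under eq_bigr => W _ do rewrite -sum1_card.
rewrite (exchange_big_dep (mem calU)) /=; last by move=> W U _; rewrite inE => /andP[].
apply: eq_bigr => U UU; rewrite sum1dep_card; apply: eq_card => W.
by rewrite !in_set UU.
Qed.

(** Each W contributes at least r times the square of its number of members. Cauchy-Schwarz bounds
    the sum of these squares below by the square of the number of incident pairs (U, W) divided by
    the number of W. The former is at least |calU| s q^(em) / |GL_e|, the latter at most q^(2ed) /
    |GL_2e|. The powers of q cancel, and t absorbs the ratio of the general linear groups. *)
Lemma duos_ge (r s t : rat) :
  0 <= r -> 0 <= s ->
  (forall W, W \in ambients -> r * #|members calU W|%:R ^+ 2 <= #|pairs W|%:R) ->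
  (forall C : 'M[F]_(m, d), C *m M *m C^! \in unitmx ->
    s * q%:R ^+ (e * m) <=
    #|[set b : 'M[F]_(e, m) | (b *m (C *m M *m C^!) *m b^!)%R \in unitmx]|%:R) ->
  t * gl_ratio q%:R^-1 e ^+ 2 <= gl_ratio q%:R^-1 (2 * e) ->
  r * s ^+ 2 * t * #|calU|%:R ^+ 2 <= #|duos|%:R.
Proof.
move=> r0 s0 hr hs ht.
pose g1 : rat := #|[set P : 'M[F]_e | P \in unitmx]|%:R.
pose g2 : rat := #|[set P : 'M[F]_(2 * e) | P \in unitmx]|%:R.
pose N : rat := #|calU|%:R; pose X : rat := q%:R ^+ (e * m).
pose S1 : rat := (\sum_(W in ambients) #|members calU W|)%N%:R.
pose S2 : rat := (\sum_(W in ambients) #|members calU W| ^ 2)%N%:R.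
have q0 : 0 < q%:R :> rat by rewrite ltr0n (ltn_trans _ F3).
have h1 : r * S2 <= #|duos|%:R.
  apply: (@le_trans _ _ (\sum_(W in ambients) #|pairs W|)%N%:R); last first.
    by rewrite ler_nat sum_pairs_le.
  rewrite /S2 !natr_sum mulr_sumr; apply: ler_sum => W WA.
  by rewrite natrX; apply: hr.
have h2 : S1 ^+ 2 <= #|ambients|%:R * S2.
  rewrite /S1 /S2 -natrX -natrM ler_nat.
  by have := sum_sqr_ge (mem ambients) (fun W => #|members calU W|).
have h3 : N * (s * X) <= S1 * g1.
  rewrite /S1 sum_members natr_sum mulr_suml /N -sum1_card natr_sum mulr_suml.
  apply: ler_sum => U UU; rewrite mul1r.
  have [dU nU] := calU_dim QB GQ orbU UU.
  have [A fA eA] := exists_rowv dU.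
  have uA : A *m M *m A^! \in unitmx by rewrite -nondegenerate_rowv ?eA.
  have [C [fX _ CA AC uC]] := exists_orthogonal_complement thetaK nB em uA.
  apply: le_trans (hs C uC) _; rewrite -natrM ler_nat.
  exact: (card_ambients_ge fX CA AC uA eA).
have h4 : #|ambients|%:R * g2 <= q%:R ^+ (2 * e * d).
  by rewrite -natrM -natrX ler_nat card_ambients_le.
have g10 : 0 < g1.
  by rewrite ltr0n; apply/card_gt0P; exists 1%:M; rewrite inE unitmx1.
have g20 : 0 < g2.
  by rewrite ltr0n; apply/card_gt0P; exists 1%:M; rewrite inE unitmx1.
have S20 : 0 <= S2 by rewrite ler0n.
have h5 : (N * (s * X)) ^+ 2 * g2 <= q%:R ^+ (2 * e * d) * S2 * g1 ^+ 2.
  apply: (@le_trans _ _ (S1 ^+ 2 * g1 ^+ 2 * g2)).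
    rewrite ler_wpM2r ?(ltW g20) // -exprMn ler_pXn2r ?nnegrE //.
      by rewrite !mulr_ge0 ?ler0n // exprn_ge0 // ltW.
    by rewrite mulr_ge0 ?ler0n // ltW.
  apply: (@le_trans _ _ (#|ambients|%:R * S2 * g1 ^+ 2 * g2)).
    by rewrite !ler_wpM2r ?(ltW g20) ?sqr_ge0.
  rewrite [leLHS](_ : _ = #|ambients|%:R * g2 * (S2 * g1 ^+ 2)); last by ring.
  by rewrite -[leRHS]mulrA ler_wpM2r // mulr_ge0 ?sqr_ge0.
have eg : q%:R ^+ (2 * e * d) * (q%:R ^+ (e * e)) ^+ 2 =
    X ^+ 2 * q%:R ^+ (2 * e * (2 * e)) :> rat.
  by rewrite /X -!exprM -!exprD -em ambient_exponents.
have h6 : N ^+ 2 * s ^+ 2 * gl_ratio q%:R^-1 (2 * e) <= S2 * gl_ratio q%:R^-1 e ^+ 2.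
  have c0 : 0 < X ^+ 2 * q%:R ^+ (2 * e * (2 * e)) by rewrite mulr_gt0 ?exprn_gt0.
  rewrite -(ler_pM2l c0) -{2}eg; move: h5; rewrite /g1 /g2 !card_unitmx_ratio.
  by move=> h5; apply: le_trans (le_trans _ h5) _; rewrite le_eqVlt; apply/orP; left;
    apply/eqP; ring.
have gr0 : 0 < gl_ratio q%:R^-1 e ^+ 2.
  rewrite exprn_gt0 // -(pmulr_rgt0 _ (exprn_gt0 (e * e) q0)).
  by rewrite -card_unitmx_ratio.
have h7 : N ^+ 2 * s ^+ 2 * t <= S2.
  rewrite -(ler_pM2r gr0); apply: le_trans h6; rewrite -[leLHS]mulrA.
  by rewrite ler_wpM2l // mulr_ge0 ?sqr_ge0.
apply: le_trans h1; apply: le_trans (ler_wpM2l r0 h7).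
by rewrite le_eqVlt; apply/orP; left; apply/eqP; ring.
Qed.

End Orthogonal.

(** * Gram matrices of quadratic forms *)

Lemma card_involution_even (T : finType) (A : {set T}) (f : T -> T) :
  involutive f -> {in A, forall x, f x \in A} -> {in A, forall x, f x != x} ->
  ~~ odd #|A|.
Proof.
move=> fK fA fx; pose A1 := [set x in A | (enum_rank x < enum_rank (f x))%N].
have -> : A = A1 :|: f @: A1.
  apply/setP => x; rewrite !inE; apply/idP/orP => [xA|[/andP[]//|]]; last first.
    by case/imsetP => y; rewrite inE => /andP[yA _] ->; apply: fA.
  case: (ltngtP (enum_rank x) (enum_rank (f x))) => h.
  - by left; rewrite xA.
  - right; apply/imsetP; exists (f x); last by rewrite fK.
    by rewrite inE fA //= fK.
  - by have := fx x xA; rewrite -(inj_eq enum_rank_inj) -(inj_eq val_inj) /= h eqxx.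
rewrite cardsU disjoint_setI0 ?cards0 ?subn0.
  by rewrite card_imset ?addnn ?odd_double //; apply: inv_inj.
apply/pred0P => x /=; apply/negP => /andP[]; rewrite inE => /andP[xA h].
by case/imsetP => y; rewrite inE => /andP[yA h'] ex; move: h; rewrite ex fK ltnNge ltnW.
Qed.

(* Below [k] is the order of the field, [t = k ^ e] and [p = k ^ m] for the    *)
(* dimension [m] of the perpendicular space, [x = 1 / t], and [N] is the      *)
(* number of singular vectors, zero included, of that space.                  *)
Section NumericBounds.

Variable R : realFieldType.
Implicit Types k t p N x : R.

Lemma le_of_sqr_le (a b : R) : 0 <= b -> a ^+ 2 <= b ^+ 2 -> a <= b.
Proof. by move=> b0 h; rewrite leNgt; apply/negP => hlt; move: h; rewrite leNgt !expr2 ltr_pM. Qed.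

Lemma isotropic_gram_bound_five k t p N x :
  0 <= x -> x <= 1 -> 5%:R <= k -> k ^+ 2 <= p -> k * t <= p -> 0 <= t -> 1 <= N ->
  (k * N - p) ^+ 2 <= (k - 1) ^+ 2 * p ->
  (1 - x) * (t + k * (N - 1)) <= (1 - 1 / 2%:R) * ((k - 1) * p).
Proof.
move=> x0 x1 k5 kp ktp t0 N1 hN.
have k0 : 0 < k by lra.
have p0 : 0 < p by apply: lt_le_trans kp; rewrite exprn_gt0.
(* Since k^2 <= p, the deviation (k - 1) sqrt p is at most (k - 1) p / k. *)
have kD : k * (k * N - p) <= (k - 1) * p.
  apply: le_of_sqr_le; first by apply: mulr_ge0; lra.
  rewrite !exprMn; apply: (@le_trans _ _ (k ^+ 2 * ((k - 1) ^+ 2 * p))).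
    by rewrite ler_wpM2l ?sqr_ge0.
  by rewrite mulrCA ler_wpM2l ?sqr_ge0 // [p ^+ 2]expr2 ler_wpM2r // ltW.
have h0 : 0 <= t + k * (N - 1) by rewrite addr_ge0 // mulr_ge0 ?subr_ge0 // ltW.
apply: (@le_trans _ _ (t + k * (N - 1))); first by apply: ler_piMl => //; lra.
have h1 : t + k * (N - 1) <= 2%:R * p.
  rewrite -(ler_pM2l k0).
  have : 0 < k ^+ 2 by rewrite exprn_gt0.
  by lra.
have : 0 <= (k - 5%:R) * p by apply: mulr_ge0; lra.
by lra.
Qed.

Lemma isotropic_gram_bound_three p N :
  81%:R <= p -> 1 <= N -> (3%:R * N - p) ^+ 2 <= (3%:R - 1) ^+ 2 * p ->
  (1 - 1 / 9%:R) * (9%:R + 3%:R * (N - 1)) <= (1 - 103%:R / 243%:R) * ((3%:R - 1) * p).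
Proof.
move=> p81 N1 hN.
(* The deviation 2 sqrt p is at most 2 p / 9 because p is at least 81. *)
have kD : 3%:R * N - p <= 2%:R / 9%:R * p.
  apply: le_of_sqr_le; first by lra.
  apply: le_trans hN _.
  have hp : 0 <= (p - 81%:R) * p by apply: mulr_ge0; lra.
  by lra.
lra.
Qed.

Lemma isotropic_gram_bound_conic (N : R) :
  N <= 9%:R ->
  (1 - 1 / 9%:R) * (9%:R + 3%:R * (N - 1)) <= (1 - 103%:R / 243%:R) * ((3%:R - 1) * 27%:R).
Proof. by move=> hN; lra. Qed.

Lemma isotropic_gram_bound_large t p N x :
  0 <= x -> x <= 1 -> 243%:R <= p -> 3%:R * t <= p -> 0 <= t -> 1 <= N ->
  (3%:R * N - p) ^+ 2 <= (3%:R - 1) ^+ 2 * p ->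
  (1 - x) * (t + 3%:R * (N - 1)) <= (1 - 25%:R / 93%:R) * ((3%:R - 1) * p).
Proof.
move=> x0 x1 p243 ktp t0 N1 hN.
(* The fraction 4/31 is a rational upper bound for 2 / sqrt 243; it is valid once p is at least
   961/4. *)
have kD : 3%:R * N - p <= 4%:R / 31%:R * p.
  apply: le_of_sqr_le; first by lra.
  apply: le_trans hN _.
  have hp : 0 <= (p - 243%:R) * p by apply: mulr_ge0; lra.
  by lra.
have h0 : 0 <= t + 3%:R * (N - 1) by lra.
apply: (@le_trans _ _ (t + 3%:R * (N - 1))); first by apply: ler_piMl => //; lra.
lra.
Qed.

Lemma disjoint_bound_nine :
  (9%:R - 1) * (9%:R + 3%:R) <= (1 - 1 / 5%:R) * ((9%:R + 1) * (9%:R - 3%:R) * (3%:R - 1)) :> R.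
Proof. lra. Qed.

Lemma disjoint_bound_three t : 81%:R <= t ->
  (t - 1) * (t + 3%:R) <= (1 - 6%:R / 13%:R) * ((t + 1) * (t - 3%:R) * (3%:R - 1)).
Proof.
move=> t81; have : 0 <= (t - 81%:R) * (t + 27%:R) by apply: mulr_ge0; lra.
by lra.
Qed.

Lemma disjoint_bound_four k t : 4%:R <= k -> k ^+ 2 <= t ->
  (t - 1) * (t + k) <= (1 - 4%:R / 9%:R) * ((t + 1) * (t - k) * (k - 1)).
Proof.
move=> k4 kt; have kt4 : 4%:R * k <= t.
  by apply: le_trans kt; rewrite expr2 ler_wpM2r //; lra.
have h1 : t + k <= 5%:R / 9%:R * ((t - k) * (k - 1)).
  have : 0 <= (t - k) * (k - 4%:R) by apply: mulr_ge0; lra.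
  by lra.
apply: (@le_trans _ _ ((t + 1) * (t + k))); first by apply: ler_wpM2r; lra.
apply: (@le_trans _ _ ((t + 1) * (5%:R / 9%:R * ((t - k) * (k - 1))))).
  by apply: ler_wpM2l => //; lra.
by rewrite le_eqVlt; apply/orP; left; apply/eqP; field.
Qed.

Lemma alternating_gram_bound_four k : 4%:R <= k ->
  1 + k ^+ 2 <= (1 - 1 / 2%:R) * (k * (k ^+ 2 - 1)).
Proof.
move=> k4; have : 0 <= (k - 4%:R) * (k ^+ 2 + 2%:R * k + 7%:R).
  by apply: mulr_ge0; [lra|have := sqr_ge0 k; lra].
by lra.
Qed.

End NumericBounds.

Lemma good_of_gram_bound (R : realFieldType) (k t p x N y bad r : R) :
  1 < k -> 0 < t -> 0 < p -> 0 <= y -> x * t = 1 ->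
  (k - 1) * bad * k <= (t - 1) * (t + k * (N - 1)) * y ->
  (1 - x) * (t + k * (N - 1)) <= (1 - r) * ((k - 1) * p) ->
  bad * k <= (1 - r) * (t * p) * y.
Proof.
move=> k1 t0 p0 y0 xt h1 h2; have k10 : 0 < k - 1 by lra.
rewrite -(ler_pM2l k10).
have h3 : (t - 1) * (t + k * (N - 1)) * y <= (k - 1) * ((1 - r) * (t * p) * y).
  rewrite (_ : t - 1 = t * (1 - x)); last by rewrite mulrBr mulr1 [t * x]mulrC xt.
  rewrite (_ : _ * _ * y = t * ((1 - x) * (t + k * (N - 1))) * y); last by ring.
  rewrite (_ : (k - 1) * _ = t * ((1 - r) * ((k - 1) * p)) * y); last by ring.
  by rewrite ler_wpM2r // ler_wpM2l // ltW.
by apply: le_trans h3; rewrite mulrA.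
Qed.

(* The fibres of a ternary quadratic form over the field of order 3: the sum *)
(* is 3^3, the second moment 27 * 29 / 3, and v -> -v makes [N] odd.         *)
Lemma conic_fibers (a b N : nat) : odd N ->
  (N + (a + b) = 27)%N -> (N * N + (a * a + b * b) = 261)%N -> (N <= 9)%N.
Proof.
move=> oN h1 h2.
have N27 : (N < 28)%N by lia.
have a27 : (a < 28)%N by lia.
have eb : b = (27 - N - a)%N by lia.
have {h1}h2 : (N * N + (a * a + (27 - N - a) * (27 - N - a)) == 261)%N.
  by rewrite -eb; apply/eqP.
have : all (fun N => all (fun a => odd N ==>
   (N * N + (a * a + (27 - N - a) * (27 - N - a)) == 261)%N ==> (N <= 9)%N) (iota 0 28)) (iota 0 28).
  by vm_compute.
move/allP/(_ N); rewrite mem_iota => /(_ N27)/allP/(_ a).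
by rewrite mem_iota oN h2 => /(_ a27).
Qed.

Section GramFrames.

Variables (F : finFieldType) (n : nat) (eps : bool) (theta : {rmorphism F -> F}).
Local Notation d := n.+1.
Local Notation V := 'rV[F]_d.
Variables (B : {hermitian V for eps & theta}) (Q : V -> F).
Local Notation q := #|F|.

Local Notation "A ^!" := (map_mx theta A^T).
Local Notation M := (formmx B).

Hypotheses (symB : is_sym B) (QB : quadratic_with_polar Q B).

Let thetaK : involutive theta. Proof. by move=> x; rewrite !(symB.2). Qed.

Local Notation nonsingular e J :=
  [set b : 'M[F]_(e, _) | (b *m J *m b^!)%R \in unitmx].

Section Odd.

Hypothesis two0 : 2%:R != 0 :> F.

Variables (m : nat) (C : 'M[F]_(m.+1, d)).
Hypothesis uC : C *m M *m C^! \in unitmx.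

Local Notation N := (fiber (coord_quad Q C) 0%R).

(** Since B v v = 2 Q v, isotropic and singular vectors coincide in odd characteristic. *)
Lemma fiber_form_norm : fiber (form_norm theta (C *m M *m C^!)) 0%R = N.
Proof.
apply: eq_card => c; rewrite !inE /form_norm -form_rows (polar_diag QB) /coord_quad.
by rewrite -mulr_natr mulf_eq0 (negPf two0) orbF.
Qed.

Lemma fiber_coord_quad_odd : odd N.
Proof.
have -> : N = #|[set c | (coord_quad Q C c == 0)%R] :\ 0%R|.+1.
  by rewrite /fiber (cardsD1 0) inE {1}/coord_quad mul0mx (quad0 QB) eqxx.
rewrite /=; apply: (@card_involution_even _ _ (fun c => - c)).
- exact: opprK.
- move=> c; rewrite !inE oppr_eq0 => /andP[-> /=].
  by rewrite /coord_quad mulNmx (quadN QB).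
move=> c; rewrite !inE => /andP[c0 _]; apply: contra c0 => /eqP h.
have /eqP : 2%:R *: c = 0 by rewrite scaler_nat mulr2n -{1}h addNr.
by rewrite scaler_eq0 (negPf two0).
Qed.

Lemma fiber_deviation_rat :
  (q%:R * N%:R - q%:R ^+ m.+1) ^+ 2 <= (q%:R - 1) ^+ 2 * q%:R ^+ m.+1 :> rat.
Proof.
have := sphere_deviation symB QB 0%R uC.
move: q N => k f; rewrite -(ler_int rat).
by rewrite !(rmorphXn, rmorphM, rmorphB) /= -!pmulrn.
Qed.

Lemma gram_good_ge (e : nat) (r : rat) :
  (1 - (q%:R ^+ e.+1)^-1) * (q%:R ^+ e.+1 + q%:R * (N%:R - 1)) <=
    (1 - r) * ((q%:R - 1) * q%:R ^+ m.+1) ->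
  r * q%:R ^+ (e.+1 * m.+1) <= #|nonsingular e.+1 (C *m M *m C^!)|%:R.
Proof.
move=> hr; have q1 := card_finNzRing_gt1 F.
have w0 : (0 < q)%N by apply: ltnW.
have hw (b : 'M[F]_(e.+1, m.+1)) : b *m (C *m M *m C^!) *m b^! \notin unitmx ->
    (q <= #|[set v : 'rV[F]_e.+1 | (v *m (b *m (C *m M *m C^!) *m b^!) == 0)%R]|)%N.
  exact: singular_ker.
have h := card_singular_gram_le thetaK uC w0 hw.
have N1 : (0 < N)%N by have := fiber_coord_quad_odd; case: N.
have q0 : 0 < q%:R :> rat by rewrite ltr0n.
pose bad : rat := #|[set b : 'M[F]_(e.+1, m.+1) | (b *m (C *m M *m C^!) *m b^!)%R \notin unitmx]|%:R.
have hb : (q%:R - 1) * bad * q%:R <=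
    (q%:R ^+ e.+1 - 1) * (q%:R ^+ e.+1 + q%:R * (N%:R - 1)) * q%:R ^+ (e * m).
  move: h; rewrite fiber_form_norm -(ler_nat rat) !natrM natrD natrM !natrX.
  rewrite !natrB ?expn_gt0 ?w0 // natrX => h.
  have -> : (q%:R ^+ e.+1 - 1) * (q%:R ^+ e.+1 + q%:R * (N%:R - 1)) * q%:R ^+ (e * m) =
     (q%:R ^+ e.+1 - 1) * (q%:R ^+ (e * m.+1) + (N%:R - 1) * q%:R ^+ (e * m)) * q%:R :> rat.
    by rewrite mulnS exprD exprS; ring.
  by rewrite ler_wpM2r // ltW.
have q1' : 1 < q%:R :> rat by rewrite ltr1n.
have xt : (q%:R ^+ e.+1)^-1 * q%:R ^+ e.+1 = 1 :> rat.
  by rewrite mulVf // expf_neq0 // gt_eqF.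
have := good_of_gram_bound q1' (exprn_gt0 e.+1 q0) (exprn_gt0 m.+1 q0)
   (exprn_ge0 (e * m) (ltW q0)) xt hb hr.
have -> : (1 - r) * (q%:R ^+ e.+1 * q%:R ^+ m.+1) * q%:R ^+ (e * m) =
   (1 - r) * q%:R ^+ (e.+1 * m.+1) * q%:R.
  rewrite -!mulrA -!exprD -exprSr; congr (_ * _ ^+ _); lia.
rewrite ler_pM2r // => hbad.
have := @card_good_ge _ (fun b : 'M[F]_(e.+1, m.+1) => b *m (C *m M *m C^!) *m b^! \in unitmx) (1 - r).
by rewrite card_mx natrX subKr; apply.
Qed.

(** For ternary forms over the field of order 3 the deviation bound only gives N <= 12, which is too
    weak for the constant required; the exact second moment together with parity gives 9. *)
Lemma conic_fiber_le : q = 3%N -> m = 2%N -> (N <= 9)%N.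
Proof.
move=> q3 m2; have eX : (q ^ m.+1 = 27)%N by rewrite q3 m2.
have [a [b [sN sN2]]] : exists a b, (\sum_c fiber (coord_quad Q C) c = N + (a + b))%N /\
    (\sum_c fiber (coord_quad Q C) c * fiber (coord_quad Q C) c = N * N + (a * a + b * b))%N.
  have : #|[set~ 0%R : F] :\ 1%R| = 1.
    have := cardsC1 (0%R : F); rewrite q3 (cardsD1 1%R) !inE oner_neq0 /=.
    by rewrite add1n => -[].
  move=> /eqP/cards1P[z hz]; have hz' c : (c != 0%R) && (c != 1%R) = (c == z).
    by have /setP/(_ c) := hz; rewrite !inE andbC.
  exists (fiber (coord_quad Q C) 1%R), (fiber (coord_quad Q C) z).
  by split; rewrite (bigD1 0%R) //= (bigD1 1%R) ?oner_neq0 //= (eq_bigl _ _ hz') big_pred1_eq.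
apply: (conic_fibers fiber_coord_quad_odd (a := a) (b := b)).
  by rewrite -sN sum_fiber card_mx mul1n eX.
rewrite -sN2 -coincidences_sum; have := coord_quad_coincidences symB QB uC.
by rewrite eX q3 => h; apply/eqP; rewrite -(eqn_pmul2r (isT : 0 < 3)%N) h.
Qed.

End Odd.

Lemma polar_alternating (k : nat) (C : 'M[F]_(k, d)) :
  2%:R = 0 :> F -> alternating theta (C *m M *m C^!).
Proof.
move=> two0 v; rewrite [LHS]mx11_scalar -form_rows (polar_diag QB).
by rewrite -mulr_natr two0 mulr0 raddf0.
Qed.

(** In characteristic 2 the polar form is alternating, and the symplectic count applies; with |F| at
    least 4 the singular matrices make up less than half. *)
Lemma gram_good_even (e m : nat) (C : 'M[F]_(m.+1, d)) :
  2%:R = 0 :> F -> (3 < q)%N -> odd e -> (e < m)%N -> C *m M *m C^! \in unitmx ->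
  1 / 2%:R * q%:R ^+ (e.+1 * m.+1) <= #|nonsingular e.+1 (C *m M *m C^!)|%:R :> rat.
Proof.
move=> two0 q4 oe em uC.
have := alternating_gram_singular_le symB.2 oe em (polar_alternating C two0) uC.
set bad := _%:R => h.
have k4 : 4%:R <= q%:R :> rat by rewrite ler_nat.
have := @card_good_ge _ (fun b : 'M[F]_(e.+1, m.+1) => b *m (C *m M *m C^!) *m b^! \in unitmx) (1 - 1 / 2%:R).
rewrite card_mx natrX subKr; apply; rewrite -/bad.
have c0 : 0 < q%:R * (q%:R ^+ 2 - 1) :> rat.
  by rewrite mulr_gt0 ?subr_gt0 ?exprn_egt1 // ?(lt_le_trans _ k4) ?ltr_nat.
rewrite -(ler_pM2r c0); apply: le_trans h _; rewrite mulrAC.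
by rewrite [leRHS]mulrC ler_wpM2l ?exprn_ge0 ?ler0n // alternating_gram_bound_four.
Qed.

End GramFrames.

Section GramFrames.

Variables (F : finFieldType) (n : nat) (eps : bool) (theta : {rmorphism F -> F}).
Local Notation d := n.+1.
Local Notation V := 'rV[F]_d.
Variables (B : {hermitian V for eps & theta}) (Q : V -> F).
Local Notation q := #|F|.

Local Notation "A ^!" := (map_mx theta A^T).
Local Notation M := (formmx B).

Hypotheses (symB : is_sym B) (QB : quadratic_with_polar Q B).

Local Notation nonsingular e J :=
  [set b : 'M[F]_(e, _) | (b *m J *m b^!)%R \in unitmx].

Variables (e m : nat) (C : 'M[F]_(m.+1, d)).
Hypotheses (em : (e < m)%N) (uC : C *m M *m C^! \in unitmx).

Let q_gt1 : 1 < q%:R :> rat. Proof. by rewrite ltr1n card_finNzRing_gt1. Qed.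

Let inv_le1 : (q%:R ^+ e.+1)^-1 <= 1 :> rat.
Proof. by rewrite invf_le1 ?exprn_gt0 ?exprn_ege1 // ?(lt_trans ltr01) // ltW. Qed.

Let inv_ge0 : 0 <= (q%:R ^+ e.+1)^-1 :> rat.
Proof. by rewrite invr_ge0 exprn_ge0 // ler0n. Qed.

Lemma gram_good_five : 2%:R != 0 :> F -> (4 < q)%N ->
  1 / 2%:R * q%:R ^+ (e.+1 * m.+1) <= #|nonsingular e.+1 (C *m M *m C^!)|%:R :> rat.
Proof.
move=> two0 q5; apply: (gram_good_ge symB QB two0 uC).
have q1 := ltW q_gt1.
apply: isotropic_gram_bound_five => //.
- by rewrite ler_nat.
- by rewrite ler_weXn2l // ltnS (leq_ltn_trans _ em).
- by rewrite -exprS ler_weXn2l // ltnS.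
- by rewrite exprn_ge0 ?ler0n.
- by rewrite (ler_nat _ 1); have := fiber_coord_quad_odd QB two0 C; case: fiber.
exact: (fiber_deviation_rat symB QB uC).
Qed.

(** U is a plane over the field of order 3. The constant 103/243 is attained by the estimate when
    the perpendicular space has 81 vectors; dimension 3, with 27 vectors, needs the sharper count of
    singular vectors. *)
Lemma gram_good_three : 2%:R != 0 :> F -> q = 3%N -> e = 1%N ->
  103%:R / 243%:R * q%:R ^+ (e.+1 * m.+1) <=
  #|nonsingular e.+1 (C *m M *m C^!)|%:R :> rat.
Proof.
move=> two0 q3 e1; apply: (gram_good_ge symB QB two0 uC).
have -> : q%:R ^+ e.+1 = 9%:R :> rat by rewrite q3 e1.
rewrite -[9%:R^-1]div1r q3; have := em; rewrite e1 leq_eqVlt => /orP[/eqP m2|m3].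
  have -> : (3%:R : rat) ^+ m.+1 = 27%:R by rewrite -m2.
  apply: isotropic_gram_bound_conic; rewrite ler_nat.
  exact: (conic_fiber_le symB QB two0 uC q3 (esym m2)).
apply: isotropic_gram_bound_three.
- by rewrite -natrX (ler_nat _ (3 ^ 4)) leq_pexp2l.
- by rewrite (ler_nat _ 1); have := fiber_coord_quad_odd QB two0 C; case: fiber.
by have := fiber_deviation_rat symB QB uC; rewrite q3.
Qed.

(** Here t <= p / 3 and 3 N <= 35 p / 31, so t + 3 N <= 136 p / 93; against 2 p this leaves the
    proportion 25/93. *)
Lemma gram_good_large : 2%:R != 0 :> F -> q = 3%N -> (2 < e)%N ->
  25%:R / 93%:R * q%:R ^+ (e.+1 * m.+1) <=
  #|nonsingular e.+1 (C *m M *m C^!)|%:R :> rat.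
Proof.
move=> two0 q3 e3; apply: (gram_good_ge symB QB two0 uC).
have q1 := ltW q_gt1; have := fiber_deviation_rat symB QB uC.
move: inv_ge0 inv_le1 q1; rewrite q3 => x0 x1 q1 hN.
apply: (isotropic_gram_bound_large x0 x1 _ _ _ _ hN).
- by rewrite -[X in _ <= X]natrX (ler_nat _ (3 ^ 5)) leq_pexp2l // ltnS (leq_ltn_trans e3).
- by rewrite -exprS; apply: (ler_weXn2l q1); rewrite ltnS.
- by apply: exprn_ge0; apply: ler0n.
by rewrite (ler_nat _ 1); have := fiber_coord_quad_odd QB two0 C; case: fiber.
Qed.

End GramFrames.

Lemma gl_ratio_double_ge (x : rat) (k : nat) : 0 <= x -> x <= 1 ->
  1 * gl_ratio x k ^+ 2 <= gl_ratio x (2 * k).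
Proof.
by move=> x0 x1; apply: (@gl_ratio_double x 0) => //; rewrite /gl_ratio !big_ord0 expr1n mulr1.
Qed.

Lemma gl_ratio_double_third (x : rat) (k : nat) : 3%:R * x = 1 -> (1 < k)%N ->
  130%:R / 81%:R * gl_ratio x k ^+ 2 <= gl_ratio x (2 * k).
Proof.
move=> ex k2; have -> : x = 1 / 3%:R by lra.
have x0 : 0 <= 1 / 3%:R :> rat by lra.
have x1 : 1 / 3%:R <= 1 :> rat by lra.
have r0 : 0 <= 130%:R / 81%:R :> rat by lra.
apply: (gl_ratio_double x0 x1 k2 _ r0).
by rewrite /gl_ratio !big_ord_recr !big_ord0 /=; lra.
Qed.

(* [r]: disjoint pairs in a 2e-space; [s]: non-degenerate frames in the      *)
(* perpendicular space; [t]: |GL_2e| |M_e|^2 / (|GL_e|^2 |M_2e|), which is   *)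
(* 130 / 81 for e = 2 over the field of order 3.                              *)
Definition exceeds_twentieth (r s t : rat) : Prop :=
  [/\ 0 <= r, 0 <= s, 1 / 20%:R < r & 1 / 20%:R < r * s ^+ 2 * t].

Lemma exceeds_twentieth_nine : exceeds_twentieth (1 / 5%:R) (103%:R / 243%:R) (130%:R / 81%:R).
Proof. by split; lra. Qed.

Lemma exceeds_twentieth_three :
  exceeds_twentieth (6%:R / 13%:R) (25%:R / 93%:R) (130%:R / 81%:R).
Proof. by split; lra. Qed.

Lemma exceeds_twentieth_four : exceeds_twentieth (4%:R / 9%:R) (1 / 2%:R) 1.
Proof. by split; lra. Qed.

(** * The bound in the orthogonal case *)

Section OrthogonalDuos.

Variables (F : finFieldType) (n : nat) (eps : bool) (theta : {rmorphism F -> F}).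
Local Notation d := n.+1.
Local Notation V := 'rV[F]_d.
Local Notation GL := {'GL_d[F]}.
Variables (B : {hermitian V for eps & theta}) (Q : V -> F).
Local Notation q := #|F|.

Local Notation "A ^!" := (map_mx theta A^T).
Local Notation M := (formmx B).

Hypotheses (symB : is_sym B) (QB : quadratic_with_polar Q B) (nB : nondegenerate B).

Variables (G : {group GL}) (e : nat) (calU : {set {vspace V}}).
Hypotheses (F3 : (2 < q)%N) (OG : Omega Q \subset G).
Hypotheses (GQ : G \subset quadratic_isometries Q).
Hypothesis orbU : calU \in nondegenerate_orbits B G e.
Hypotheses (e1 : (1 < e)%N) (ed : (2 * e <= d)%N).

Local Notation duos := [set p in setX calU calU | is_duo B p].

Lemma duos_gt (r s t : rat) : exceeds_twentieth r s t ->
  (q%:R ^+ e - 1) * (q%:R ^+ e + q%:R) <=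
    (1 - r) * ((q%:R ^+ e + 1) * (q%:R ^+ e - q%:R) * (q%:R - 1)) ->
  (forall m (C : 'M[F]_(m, d)), (e < m)%N -> C *m M *m C^! \in unitmx ->
    s * q%:R ^+ (e * m) <=
    #|[set b : 'M[F]_(e, m) | (b *m (C *m M *m C^!) *m b^!)%R \in unitmx]|%:R) ->
  t * gl_ratio q%:R^-1 e ^+ 2 <= gl_ratio q%:R^-1 (2 * e) ->
  (0 < #|calU|)%N ->
  1 / 20%:R < #|duos|%:R / (#|calU|%:R * #|calU|%:R) :> rat.
Proof.
move=> [r0 s0]; move: (1 / 20%:R) => c cr cs hr hs ht U0.
have hW W : W \in ambients B e -> r * #|members calU W|%:R ^+ 2 <=
    #|[set p in setX (members calU W) (members calU W) | (p.1 :&: p.2 == 0)%VS]|%:R.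
  rewrite inE => /andP[/eqP dW nW].
  apply: (disjoint_members symB QB nB F3 OG GQ orbU e1 nW dW); rewrite natrX //.
  by rewrite ltr_eXnr ?ltr1n // (ltn_trans _ F3).
have c0 : 0 < #|calU|%:R * #|calU|%:R :> rat by rewrite mulr_gt0 ?ltr0n.
rewrite ltr_pdivlMr //; move: ed; rewrite leq_eqVlt => /orP[/eqP de|de].
  (* When d = 2e, V itself is the only ambient space; no averaging takes place and the proportion is
     at least r. *)
  apply: lt_le_trans (duos_ge_full QB nB GQ orbU (esym de) hW).
  by rewrite expr2 ltr_pM2r.
have em : (e + (d - e))%N = d by clear -de; lia.
apply: lt_le_trans (duos_ge symB QB nB F3 GQ orbU em r0 s0 hW _ ht); last first.
  by move=> C uC; apply: hs => //; clear -de; lia.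
by rewrite [_ ^+ 2 in ltRHS]expr2 ltr_pM2r.
Qed.

(** Four regimes: characteristic 2, where |F| is at least 4; |F| = 3 with e = 2; |F| = 3 with e at
    least 4; and odd |F| at least 5. Over the field of order 3 the factor t = 130/81 is what lifts
    the product above 1/20. *)
Lemma orthogonal_duos : prime_power q -> ~~ odd e -> (0 < #|calU|)%N ->
  1 / 20%:R < #|duos|%:R / (#|calU|%:R * #|calU|%:R) :> rat.
Proof.
move=> [p [k [p_pr k0 qE]]] ee U0.
have [e' ee'] : exists e', e = e'.+1 by exists e.-1; clear -e1; lia.
have oe' : odd e' by move: ee; rewrite ee' /= negbK.
have T2 : q%:R ^+ 2 <= q%:R ^+ e :> rat by rewrite ler_weXn2l ?ler1n // ltnW // ltnW.
have i0 : 0 <= q%:R^-1 :> rat by rewrite invr_ge0 ler0n.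
have i1 : q%:R^-1 <= 1 :> rat.
  have /andP[_ h] := half_unitr F; apply: le_trans h _.
  by rewrite ler_pdivrMr ?ltr0n // mul1r ler1n.
have [two0|two0] := eqVneq (2%:R : F) 0.
  have q4 : (3 < q)%N.
    rewrite ltn_neqAle F3 andbT eq_sym; apply/eqP => q3.
    have c3 : 3%N \in [pchar F] by apply: (@card_finPcharP _ 3 1).
    have : (3%:R : F) = 0 by apply: pcharf0.
    by rewrite -addn1 natrD two0 add0r => /eqP; rewrite oner_eq0.
  have k4 : 4%:R <= q%:R :> rat by rewrite ler_nat.
  apply: (duos_gt exceeds_twentieth_four (disjoint_bound_four k4 T2)) U0.
    rewrite ee' => -[|m] C em uC; first by exfalso; rewrite ltn0 in em.
    exact: (gram_good_even symB QB two0 q4 oe' (em : (e' < m)%N) uC).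
  exact: gl_ratio_double_ge.
have [q3|q3] := eqVneq q 3%N.
  have ex : 3%:R * q%:R^-1 = 1 :> rat by rewrite q3 mulfV // pnatr_eq0.
  have ht := gl_ratio_double_third ex e1.
  have [e2|e3] : e' = 1%N \/ (2 < e')%N by clear -e1 ee' oe'; lia.
    apply: (duos_gt exceeds_twentieth_nine _ _ ht) U0.
      rewrite (_ : q%:R ^+ e = 9%:R); last by rewrite ee' e2 q3.
      by rewrite q3; apply: disjoint_bound_nine.
    rewrite ee' => -[|m] C em uC; first by exfalso; rewrite ltn0 in em.
    exact: (gram_good_three symB QB (em : (e' < m)%N) uC two0 q3 e2).
  apply: (duos_gt exceeds_twentieth_three _ _ ht) U0.
    rewrite q3; apply: disjoint_bound_three; rewrite -[leRHS]natrX ler_nat.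
    have e4 : (4 <= e)%N by rewrite ee'.
    exact: leq_trans (leq_pexp2l (isT : 0 < 3)%N e4).
  rewrite ee' => -[|m] C em uC; first by exfalso; rewrite ltn0 in em.
    exact: (gram_good_large symB QB (em : (e' < m)%N) uC two0 q3 e3).
have q5 : (4 < q)%N.
  rewrite ltn_neqAle [(3 < _)%N]ltn_neqAle F3 andbT eq_sym [_ == q]eq_sym q3 andbT.
  apply/eqP => q4; case/eqP: two0.
  have c2 : 2%N \in [pchar F] by apply: (@card_finPcharP _ 2 2).
  exact: pcharf0.
have k4 : 4%:R <= q%:R :> rat by rewrite ler_nat ltnW.
apply: (duos_gt exceeds_twentieth_four (disjoint_bound_four k4 T2)) U0.
  rewrite ee' => -[|m] C em uC; first by exfalso; rewrite ltn0 in em.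
    exact: (gram_good_five symB QB (em : (e' < m)%N) uC two0 q5).
exact: gl_ratio_double_ge.
Qed.

End OrthogonalDuos.

(** * The unitary and symplectic bounds and the conclusion *)

Lemma unitary_proportion_ge (F : finFieldType) (n q e : nat) (eps : bool)
    (theta : {rmorphism F -> F}) (B : {hermitian 'rV[F]_n.+1 for eps & theta})
    (G : {group {'GL_n.+1[F]}}) (calU : {set {vspace 'rV[F]_n.+1}}) U :
  #|F| = (q ^ 2)%N -> (forall x, theta x = x ^+ q) -> is_unitary B ->
  special_isometries B \subset G -> G \subset form_isometries B ->
  (2 * e.+1 <= n.+1)%N ->
  calU \in nondegenerate_orbits B G e.+1 -> U \in calU ->
  1 / 19%:R <= #|[set W in calU | is_duo B (U, W)]|%:R / #|calU|%:R :> rat.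
Proof.
move=> cardF thetaE [nB eps0] sG Gs ed orbU UU.
have [m em] : exists m, (e.+1 + m.+1 = n.+1)%N by exists (n.+1 - e.+2)%N; lia.
have hM : map_mx theta (formmx B)^T = formmx B.
  by rewrite formmx_adj (_ : (-1) ^+ eps = 1) ?scale1r // eps0.
have thetaK := hermitian_thetaK cardF thetaE.
apply: (duo_proportion_ge nB thetaK em _ _ _ UU); [by lia|by lra| |].
  exact: (orbit_unitary em cardF thetaE nB hM sG Gs orbU).
move=> A C uA uC; apply: (card_good_frames_hermitian cardF thetaE) => //; first by lia.
- exact: (hermitian_congr_adj cardF thetaE _ hM).
- exact: (hermitian_congr_adj cardF thetaE _ hM).
Qed.

Lemma symplectic_proportion_ge (F : finFieldType) (n e : nat) (eps : bool)
    (theta : {rmorphism F -> F}) (B : {hermitian 'rV[F]_n.+1 for eps & theta})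
    (G : {group {'GL_n.+1[F]}}) (calU : {set {vspace 'rV[F]_n.+1}}) U :
  is_psymplectic B -> G :=: form_isometries B ->
  odd e -> (2 * e.+1 <= n.+1)%N ->
  calU \in nondegenerate_orbits B G e.+1 -> U \in calU ->
  1 / 18%:R <= #|[set W in calU | is_duo B (U, W)]|%:R / #|calU|%:R :> rat.
Proof.
move=> [nB [eps1 thetaE] B2] eG oe ed orbU UU.
have [m em] : exists m, (e.+1 + m.+1 = n.+1)%N by exists (n.+1 - e.+2)%N; lia.
(* Skew-symmetry gives B v v = 0 unless 2 = 0, and that case is part of the definition of a
   symplectic form. *)
have aM : alternating theta (formmx B).
  move=> v; rewrite [LHS]mx11_scalar -formmxE.
  suff -> : B v v = 0 by rewrite raddf0.
  have [two0|two0] := eqVneq (2%:R : F) 0; first by apply: B2; rewrite inE two0 eqxx.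
  have es : (-1) ^+ eps = -1 :> F by rewrite eps1.
  have := hermC B v v; rewrite thetaE es mulN1r => /eqP.
  by rewrite -addr_eq0 -mulr2n -mulr_natr mulf_eq0 (negPf two0) orbF => /eqP.
have thetaK : involutive theta by move=> x; rewrite !thetaE.
apply: (duo_proportion_ge nB thetaK em _ _ _ UU); [by lia|by lra| |].
  exact: (orbit_symplectic em nB thetaE aM eG orbU).
move=> A C uA uC; apply: (card_good_frames_alternating thetaE) => //; first by lia.
- exact: (alternating_congr _ aM).
- exact: (alternating_congr _ aM).
Qed.

Theorem lemma3p4 (F : finFieldType) (n q e : nat) (X : classical_type)
    (eps : bool) (theta : {rmorphism F -> F})
    (B : {hermitian 'rV[F]_n.+1 for eps & theta}) (Q : 'rV[F]_n.+1 -> F)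
    (G : {group {'GL_n.+1[F]}})
    (calU : {set {vspace 'rV[F]_n.+1}}) (U : {vspace 'rV[F]_n.+1}) :
  prime_power q ->
  classical_form X q B Q ->
  classical_group X B Q G ->
  (0 < e)%N -> (2 * e <= n.+1)%N ->
  (X <> Unitary -> ~~ odd e) ->
  calU \in nondegenerate_orbits B G e ->
  U \in calU ->
  let T := spanning_isometries B G U in
  #|T|%:R / #|G|%:R = duo_proportion B calU calU /\
  5%:R / 100%:R < #|T|%:R / #|G|%:R :> rat.
Proof.
case: e => [//|e] qq hX hG _ ed ee orbU UU T.
have sG : G \subset form_isometries B.
  case: X hX hG {ee} => [|_ <-|s] //=; first by move=> _ [].
  by case=> _ [_ QB] _ _ [_ sG]; apply: subset_trans sG (quadratic_isometries_sub QB).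
rewrite /T (spanning_proportion orbU UU) (duo_proportionE sG orbU UU).
split; first exact: erefl.
case: X hX hG ee => [|hX hG|s].
- case=> cardF thetaE uB [/andP[SG _] _] _.
  apply: lt_le_trans (unitary_proportion_ge cardF thetaE uB SG sG ed orbU UU).
  by lra.
- case: hX => _ sB ee; move: hG => /= hG.
  apply: lt_le_trans (symplectic_proportion_ge sB hG _ ed orbU UU); first by lra.
  by rewrite -[odd e]negbK; apply: ee.
case=> -[cardF q3] [symB QB] nB _ [/andP[OG _] GQ] ee.
have ee' : ~~ odd e.+1 by apply: ee.
(* The dimension, here written e + 1, is even and positive, hence at least 2. *)
have e1 : (0 < e)%N by case: e ee' {ee orbU ed}.
(* The orthogonal estimate averages over both members of a duo, so the proportion of partners of U
   is turned back into the proportion of duos. *)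
rewrite -(duo_proportionE sG orbU UU) /duo_proportion.
rewrite -cardF in q3 qq.
apply: le_lt_trans (orthogonal_duos symB QB nB q3 OG GQ orbU e1 ed qq ee' _); last first.
  exact: card_calU_gt0 UU.
by lra.
Qed.
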